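(* Consider the equation $y''=P(x,y)+3Q(x,y)y'+3R(x,y)y'^2+S(x,y)y'^3$ near a point $p$ of the $(x,y)$-plane, with $A,B,F,N,M,\Omega,\Lambda,K$ and the invariants $I_1,I_2$ computed from its coefficients as in the context. Suppose the equation belongs to the third case of intermediate degeneration, i.e. $A$ and $B$ do not vanish simultaneously, $F=0$, $M=0$ and $\Omega=0$ identically, $N\neq 0$ and $\Lambda\neq 0$. Then the Lie algebra of point symmetries of the equation is one-dimensional if and only if both functions $$I_1=\frac{L^8N^6}{\Lambda^{12}},\qquad I_2=\frac{E\,N^3}{\Lambda^4}$$ are identically constant. If at least one of $I_1,I_2$ is not constant, then the algebra of point symmetries is trivial (zero).
   Context: Setting. $P,Q,R,S$ are smooth real functions of $(x,y)$ near a point $p$. Everything is local (germs at $p$): ''$=0$'' and ''constant'' mean identically in a neighbourhood of $p$, ''$\ne0$'' means non-vanishing at $p$ (hence near $p$). Subscripts $x,y$ denote partial derivatives; $x^1=x$, $x^2=y$, $\partial_1=\partial_x$, $\partial_2=\partial_y$. The algebra of point symmetries is the Lie algebra of (germs of) vector fields on the $(x,y)$-plane whose local flows map graphs of solutions to graphs of solutions. Basic quantities. $A=P_{yy}-2Q_{xy}+R_{xx}+2PS_x+SP_x-3PR_y-3RP_y-3QR_x+6QQ_y$, $B=S_{xx}-2R_{xy}+Q_{yy}-2SP_y-PS_y+3SQ_x+3QS_x+3RQ_y-6RR_x$. $F$ is defined by $F^5=ABA_y+ABB_x-A^2B_y-B^2A_x-PB^3+3QAB^2-3RA^2B+SA^3$.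 $G=-BB_x-3AB_y+4BA_y+3SA^2-6RAB+3QB^2$, $\;H=-AA_y-3BA_x+4AB_x-3PB^2+6QAB-3RA^2$. Assume $(A,B)\neq(0,0)$ and $F=0$. Where two expressions are given below, one for $B\ne0$ and one for $A\neq0$, they agree when both apply. $N=\frac{G}{3B}$ (if $B\ne0$), $N=-\frac{H}{3A}$ (if $A\ne0$). If $B\ne0$: $\varphi_1=-3A\frac{AS-B_y}{5B^2}-3\frac{A_y+B_x-3AR}{5B}-\frac65Q$, $\varphi_2=3\frac{AS-B_y}{5B}-\frac35R$. If $A\ne0$: $\varphi_1=-3\frac{BP+A_x}{5A}+\frac35Q$, $\varphi_2=3B\frac{BP+A_x}{5A^2}-3\frac{B_x+A_y+3BQ}{5A}+\frac65R$. $\Omega=\frac53(\partial_y\varphi_1-\partial_x\varphi_2)$, $\;M=B(N_x+2\varphi_1N)-A(N_y+2\varphi_2N)$. $\gamma^1=-2\Omega B-(N_y+2\varphi_2N)$, $\gamma^2=2\Omega A+(N_x+2\varphi_1N)$. Assume $M=0$. Then $\Lambda=\gamma^1/B$ (if $B\neq0$), $\Lambda=-\gamma^2/A$ (if $A\ne0$). Curvature. Let $\varGamma^k_{ij}=\varGamma^k_{ji}$ be: $\varGamma^1_{11}=Q-\frac23\varphi_1$, $\varGamma^1_{12}=R-\frac13\varphi_2$, $\varGamma^1_{22}=S$, $\varGamma^2_{11}=-P$, $\varGamma^2_{12}=-Q-\frac13\varphi_1$, $\varGamma^2_{22}=-R-\frac23\varphi_2$. Put $\rho^k_q=\partial_1\varGamma^k_{2q}-\partial_2\varGamma^k_{1q}+\sum_{s=1}^2(\varGamma^k_{1s}\varGamma^s_{2q}-\varGamma^k_{2s}\varGamma^s_{1q})$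 and $\lambda_2=\frac35(\Omega+\Lambda)$. Define $\omega_1=\frac{\rho^1_1-\lambda_2}{B}$, $\omega_2=\frac{\rho^1_2}{B}$ (if $B\ne0$); $\omega_1=-\frac{\rho^2_1}{A}$, $\omega_2=\frac{\lambda_2-\rho^2_2}{A}$ (if $A\neq0$). Let $w_i=N\omega_i+(\partial_i\Lambda+\varphi_i\Lambda)+\frac13(\partial_i\Omega+\varphi_i\Omega)$; $K=w_2/B$ (if $B\ne0$), $K=w_1/A$ (if $A\ne0$). Quantities of the third case ($N\ne0$, $\Omega=0$, $\Lambda\neq0$). $C=\omega^1=\omega_2$, $D=\omega^2=-\omega_1$. $Z=\frac{5}{6\Lambda}\bigl(CD(C_x-D_y)+D^2C_y-C^2D_x+PC^3+3QC^2D+3RCD^2+SD^3\bigr)$. $L=K+\frac59+\frac{2\Lambda^2}{N}$, $\;\nabla_\omega L=\omega^1L_x+\omega^2L_y$. $$E=Z-\frac{\nabla_\omega L}{N}+\frac{9L^2}{5N}-\frac{2L}{N}-\frac{12L\Lambda^2}{5N^2}+\frac{7\Lambda^2}{3N^2}+\frac{5}{9N}+\frac{63\Lambda^4}{20N^3}.$$ *)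

(* Defs.v *)
From Stdlib Require Export Reals.
From Coquelicot Require Export Coquelicot.

Open Scope R_scope.

(** * Smooth functions and germs at a point of the plane *)

Definition near (p : R * R) (Pr : R -> R -> Prop) : Prop :=
  locally_2d Pr (fst p) (snd p).

(** Value of a function of two variables at the base point. *)
Definition at_pt (f : R -> R -> R) (p : R * R) : R := f (fst p) (snd p).

(** [ex_diff_n f n x y] says that the iterated partial derivatives of order at
    most [n] exist at [(x, y)] and are continuous there. *)
Definition smooth_near (p : R * R) (f : R -> R -> R) : Prop :=
  near p (fun x y => forall n : nat, ex_diff_n f n x y).

Definition zero_near (p : R * R) (f : R -> R -> R) : Prop :=
  near p (fun x y => f x y = 0).

Definition constant_near (p : R * R) (f : R -> R -> R) : Prop :=
  exists c : R, near p (fun x y => f x y = c).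

(** The analogue of [ex_diff_n] for functions of three variables. *)
Fixpoint ex_diff3_n (f : R -> R -> R -> R) (n : nat) (t x y : R) : Prop :=
  continuous (fun q : R * (R * R) => f (fst q) (fst (snd q)) (snd (snd q)))
             (t, (x, y)) /\
  match n with
  | O => True
  | S n' =>
      ex_derive (fun z => f z x y) t /\
      ex_derive (fun z => f t z y) x /\
      ex_derive (fun z => f t x z) y /\
      ex_diff3_n (fun s u v => Derive (fun z => f z u v) s) n' t x y /\
      ex_diff3_n (fun s u v => Derive (fun z => f s z v) u) n' t x y /\
      ex_diff3_n (fun s u v => Derive (fun z => f s u z) v) n' t x y
  end.

Definition dx (f : R -> R -> R) : R -> R -> R :=
  fun x y => Derive (fun z => f z y) x.

Definition dy (f : R -> R -> R) : R -> R -> R :=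
  fun x y => Derive (fun z => f x z) y.

(** * The equation y'' = P + 3 Q y' + 3 R y'^2 + S y'^3 *)

Record equation := Equation {
  coP : R -> R -> R;
  coQ : R -> R -> R;
  coR : R -> R -> R;
  coS : R -> R -> R
}.

Definition smooth_equation (e : equation) (p : R * R) : Prop :=
  smooth_near p (coP e) /\ smooth_near p (coQ e) /\
  smooth_near p (coR e) /\ smooth_near p (coS e).

Definition is_solution (e : equation) (a b : R) (u : R -> R) : Prop :=
  forall x, a < x < b ->
    ex_derive u x /\
    is_derive (Derive u) x
      (coP e x (u x) + 3 * coQ e x (u x) * Derive u x
       + 3 * coR e x (u x) * Derive u x ^ 2 + coS e x (u x) * Derive u x ^ 3).

(** * Point symmetries *)

Record vfield := VField {
  vx : R -> R -> R;
  vy : R -> R -> R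
}.

Definition smooth_vfield (p : R * R) (X : vfield) : Prop :=
  smooth_near p (vx X) /\ smooth_near p (vy X).

Definition vfield_eq_near (p : R * R) (X Y : vfield) : Prop :=
  near p (fun x y => vx X x y = vx Y x y /\ vy X x y = vy Y x y).

Definition in_box (p : R * R) (eps x y : R) : Prop :=
  Rabs (x - fst p) < eps /\ Rabs (y - snd p) < eps.

(** [(f t x y, g t x y)] is the position at time [t] of the point that starts
    from [(x, y)]. *)
Definition is_local_flow (X : vfield) (p : R * R) (eps : R)
    (f g : R -> R -> R -> R) : Prop :=
  forall x y, in_box p eps x y ->
    f 0 x y = x /\ g 0 x y = y /\
    forall t, Rabs t < eps ->
      (forall n : nat, ex_diff3_n f n t x y) /\
      (forall n : nat, ex_diff3_n g n t x y) /\
      is_derive (fun s => f s x y) t (vx X (f t x y) (g t x y)) /\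
      is_derive (fun s => g s x y) t (vy X (f t x y) (g t x y)).

(** The graph of [u] over [(a, b)] is mapped by [(f, g)] onto the graph of a
    solution over some open interval. *)
Definition maps_onto_solution_graph (e : equation) (f g : R -> R -> R)
    (a b : R) (u : R -> R) : Prop :=
  exists (c d : R) (v : R -> R),
    c < d /\ is_solution e c d v /\
    forall x' y' : R,
      (c < x' < d /\ y' = v x') <->
      (exists x, a < x < b /\ x' = f x (u x) /\ y' = g x (u x)).

(** The time-[t] map of a symmetry may turn a graph with a steep tangent into a
    curve with a vertical one, and such a [t] may be arbitrarily small if the
    slope is unbounded.  The range of [t] therefore depends on the
    solution and on the point of its graph around which it is transported. *)
Definition point_symmetry (e : equation) (p : R * R) (X : vfield) : Prop :=
  smooth_vfield p X /\
  exists (eps : R) (f g : R -> R -> R -> R),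
    0 < eps /\ is_local_flow X p eps f g /\
    forall (a b : R) (u : R -> R),
      is_solution e a b u ->
      (forall x, a < x < b -> in_box p eps x (u x)) ->
      forall x0, a < x0 < b ->
        exists tau eta : R,
          0 < tau <= eps /\ 0 < eta /\ a <= x0 - eta /\ x0 + eta <= b /\
          forall t, Rabs t < tau ->
            maps_onto_solution_graph e (f t) (g t) (x0 - eta) (x0 + eta) u.

Fixpoint lin_comb (n : nat) (c : nat -> R) (X : nat -> vfield) : vfield :=
  match n with
  | O => VField (fun _ _ => 0) (fun _ _ => 0)
  | S m =>
      VField (fun x y => vx (lin_comb m c X) x y + c m * vx (X m) x y)
             (fun x y => vy (lin_comb m c X) x y + c m * vy (X m) x y)
  end.

(** The germs at [p] of the fields satisfying [V] form a vector space of
    dimension [n]: they are exactly the combinations of [n] linearly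
    independent germs. *)
Definition germ_space_dim (p : R * R) (V : vfield -> Prop) (n : nat) : Prop :=
  exists X : nat -> vfield,
    (forall c : nat -> R,
        vfield_eq_near p (lin_comb n c X) (lin_comb 0 c X) ->
        forall i, (i < n)%nat -> c i = 0) /\
    (forall Y : vfield,
        V Y <-> exists c : nat -> R, vfield_eq_near p Y (lin_comb n c X)).

Definition symmetry_algebra_dim (e : equation) (p : R * R) (n : nat) : Prop :=
  germ_space_dim p (point_symmetry e p) n.

(** * The pseudoinvariants of the equation *)

Definition cA (e : equation) : R -> R -> R := fun x y =>
  let P := coP e in let Q := coQ e in let R' := coR e in let S' := coS e in
  dy (dy P) x y - 2 * dy (dx Q) x y + dx (dx R') x y
  + 2 * P x y * dx S' x y + S' x y * dx P x y
  - 3 * P x y * dy R' x y - 3 * R' x y * dy P x y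
  - 3 * Q x y * dx R' x y + 6 * Q x y * dy Q x y.

Definition cB (e : equation) : R -> R -> R := fun x y =>
  let P := coP e in let Q := coQ e in let R' := coR e in let S' := coS e in
  dx (dx S') x y - 2 * dy (dx R') x y + dy (dy Q) x y
  - 2 * S' x y * dy P x y - P x y * dy S' x y
  + 3 * S' x y * dx Q x y + 3 * Q x y * dx S' x y
  + 3 * R' x y * dy Q x y - 6 * R' x y * dx R' x y.

(** The real fifth root; it sends [0] to [0] because [sign 0 = 0]. *)
Definition root5 (z : R) : R := sign z * Rpower (Rabs z) (1 / 5).

Definition cF (e : equation) : R -> R -> R := fun x y =>
  let A := cA e x y in let B := cB e x y in
  root5 (A * B * dy (cA e) x y + B * A * dx (cB e) x y
         - A ^ 2 * dy (cB e) x y - B ^ 2 * dx (cA e) x y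
         - coP e x y * B ^ 3 + 3 * coQ e x y * A * B ^ 2
         - 3 * coR e x y * A ^ 2 * B + coS e x y * A ^ 3).

Definition cG (e : equation) : R -> R -> R := fun x y =>
  let A := cA e x y in let B := cB e x y in
  - B * dx (cB e) x y - 3 * A * dy (cB e) x y + 4 * B * dy (cA e) x y
  + 3 * coS e x y * A ^ 2 - 6 * coR e x y * A * B + 3 * coQ e x y * B ^ 2.

Definition cH (e : equation) : R -> R -> R := fun x y =>
  let A := cA e x y in let B := cB e x y in
  - A * dy (cA e) x y - 3 * B * dx (cA e) x y + 4 * A * dx (cB e) x y
  - 3 * coP e x y * B ^ 2 + 6 * coQ e x y * A * B - 3 * coR e x y * A ^ 2.

(** Choice between the expression [fB], meant for [B <> 0], and [fA], meant for
    [A <> 0].  Non-vanishing is tested at the base point [p], so that one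
    expression is used on a whole neighbourhood of [p]; when both apply they
    agree (as soon as [F = 0]). *)
Definition by_chart (e : equation) (p : R * R) (fB fA : R -> R -> R)
    : R -> R -> R :=
  if Req_EM_T (at_pt (cB e) p) 0 then fA else fB.

Definition cN (e : equation) (p : R * R) : R -> R -> R :=
  by_chart e p
    (fun x y => cG e x y / (3 * cB e x y))
    (fun x y => - (cH e x y / (3 * cA e x y))).

(** The indices 1, 2 of the coordinates [x^1 = x], [x^2 = y]. *)
Inductive idx := i1 | i2.

Definition pd (i : idx) : (R -> R -> R) -> R -> R -> R :=
  match i with i1 => dx | i2 => dy end.

Definition sum_idx (f : idx -> R) : R := f i1 + f i2.

Definition phi (e : equation) (p : R * R) (i : idx) : R -> R -> R :=
  let P := coP e in let Q := coQ e in let R' := coR e in let S' := coS e in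
  let A := cA e in let B := cB e in
  match i with
  | i1 =>
      by_chart e p
        (fun x y =>
           - 3 * A x y * ((A x y * S' x y - dy B x y) / (5 * B x y ^ 2))
           - 3 * ((dy A x y + dx B x y - 3 * A x y * R' x y) / (5 * B x y))
           - 6 / 5 * Q x y)
        (fun x y =>
           - 3 * ((B x y * P x y + dx A x y) / (5 * A x y)) + 3 / 5 * Q x y)
  | i2 =>
      by_chart e p
        (fun x y =>
           3 * ((A x y * S' x y - dy B x y) / (5 * B x y)) - 3 / 5 * R' x y)
        (fun x y =>
           3 * B x y * ((B x y * P x y + dx A x y) / (5 * A x y ^ 2))
           - 3 * ((dx B x y + dy A x y + 3 * B x y * Q x y) / (5 * A x y))
           + 6 / 5 * R' x y)
  end.

Definition cOmega (e : equation) (p : R * R) : R -> R -> R := fun x y =>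
  5 / 3 * (dy (phi e p i1) x y - dx (phi e p i2) x y).

Definition cM (e : equation) (p : R * R) : R -> R -> R := fun x y =>
  let N := cN e p in
  cB e x y * (dx N x y + 2 * phi e p i1 x y * N x y)
  - cA e x y * (dy N x y + 2 * phi e p i2 x y * N x y).

Definition gamma (e : equation) (p : R * R) (i : idx) : R -> R -> R := fun x y =>
  let N := cN e p in
  match i with
  | i1 => - 2 * cOmega e p x y * cB e x y
          - (dy N x y + 2 * phi e p i2 x y * N x y)
  | i2 => 2 * cOmega e p x y * cA e x y
          + (dx N x y + 2 * phi e p i1 x y * N x y)
  end.

Definition cLambda (e : equation) (p : R * R) : R -> R -> R :=
  by_chart e p
    (fun x y => gamma e p i1 x y / cB e x y)
    (fun x y => - (gamma e p i2 x y / cA e x y)).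

(** * Curvature *)

(** [Gam e p k i j] is Gamma^k_{ij}. *)
Definition Gam (e : equation) (p : R * R) (k i j : idx) : R -> R -> R := fun x y =>
  let P := coP e x y in let Q := coQ e x y in
  let R' := coR e x y in let S' := coS e x y in
  let phi1 := phi e p i1 x y in let phi2 := phi e p i2 x y in
  match k, i, j with
  | i1, i1, i1 => Q - 2 / 3 * phi1
  | i1, i1, i2 | i1, i2, i1 => R' - 1 / 3 * phi2
  | i1, i2, i2 => S'
  | i2, i1, i1 => - P
  | i2, i1, i2 | i2, i2, i1 => - Q - 1 / 3 * phi1
  | i2, i2, i2 => - R' - 2 / 3 * phi2
  end.

(** [rho e p k q] is rho^k_q. *)
Definition rho (e : equation) (p : R * R) (k q : idx) : R -> R -> R := fun x y =>
  pd i1 (Gam e p k i2 q) x y - pd i2 (Gam e p k i1 q) x y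
  + sum_idx (fun s => Gam e p k i1 s x y * Gam e p s i2 q x y
                      - Gam e p k i2 s x y * Gam e p s i1 q x y).

Definition lambda2 (e : equation) (p : R * R) : R -> R -> R := fun x y =>
  3 / 5 * (cOmega e p x y + cLambda e p x y).

Definition omega (e : equation) (p : R * R) (i : idx) : R -> R -> R :=
  match i with
  | i1 =>
      by_chart e p
        (fun x y => (rho e p i1 i1 x y - lambda2 e p x y) / cB e x y)
        (fun x y => - (rho e p i2 i1 x y / cA e x y))
  | i2 =>
      by_chart e p
        (fun x y => rho e p i1 i2 x y / cB e x y)
        (fun x y => (lambda2 e p x y - rho e p i2 i2 x y) / cA e x y)
  end.

Definition cw (e : equation) (p : R * R) (i : idx) : R -> R -> R := fun x y =>
  cN e p x y * omega e p i x y
  + (pd i (cLambda e p) x y + phi e p i x y * cLambda e p x y)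
  + 1 / 3 * (pd i (cOmega e p) x y + phi e p i x y * cOmega e p x y).

Definition cK (e : equation) (p : R * R) : R -> R -> R :=
  by_chart e p
    (fun x y => cw e p i2 x y / cB e x y)
    (fun x y => cw e p i1 x y / cA e x y).

(** * The third case of intermediate degeneration *)

Definition third_case (e : equation) (p : R * R) : Prop :=
  ~ (at_pt (cA e) p = 0 /\ at_pt (cB e) p = 0) /\
  zero_near p (cF e) /\
  zero_near p (cM e p) /\
  zero_near p (cOmega e p) /\
  at_pt (cN e p) p <> 0 /\
  at_pt (cLambda e p) p <> 0.

Definition cC (e : equation) (p : R * R) : R -> R -> R := omega e p i2.

Definition cD (e : equation) (p : R * R) : R -> R -> R :=
  fun x y => - omega e p i1 x y.

Definition cZ (e : equation) (p : R * R) : R -> R -> R := fun x y =>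
  let C := cC e p x y in let D := cD e p x y in
  5 / (6 * cLambda e p x y) *
  (C * D * (dx (cC e p) x y - dy (cD e p) x y)
   + D ^ 2 * dy (cC e p) x y - C ^ 2 * dx (cD e p) x y
   + coP e x y * C ^ 3 + 3 * coQ e x y * C ^ 2 * D
   + 3 * coR e x y * C * D ^ 2 + coS e x y * D ^ 3).

Definition cL (e : equation) (p : R * R) : R -> R -> R := fun x y =>
  cK e p x y + 5 / 9 + 2 * cLambda e p x y ^ 2 / cN e p x y.

(** Derivative along the field with components [(C, D)]. *)
Definition nabla_omega (e : equation) (p : R * R) (f : R -> R -> R)
    : R -> R -> R := fun x y =>
  cC e p x y * dx f x y + cD e p x y * dy f x y.

Definition cE (e : equation) (p : R * R) : R -> R -> R := fun x y =>
  let N := cN e p x y in let L := cL e p x y in let La := cLambda e p x y in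
  cZ e p x y - nabla_omega e p (cL e p) x y / N
  + 9 * L ^ 2 / (5 * N) - 2 * L / N
  - 12 * L * La ^ 2 / (5 * N ^ 2) + 7 * La ^ 2 / (3 * N ^ 2)
  + 5 / (9 * N) + 63 * La ^ 4 / (20 * N ^ 3).

Definition I1 (e : equation) (p : R * R) : R -> R -> R := fun x y =>
  cL e p x y ^ 8 * cN e p x y ^ 6 / cLambda e p x y ^ 12.

Definition I2 (e : equation) (p : R * R) : R -> R -> R := fun x y =>
  cE e p x y * cN e p x y ^ 3 / cLambda e p x y ^ 4.

(* Main.v *)
Require Import Defs.
From Stdlib Require Import Lra Lia Psatz ClassicalEpsilon.
Open Scope R_scope.

(* In the third case the curve direction a = (B, -A)/N and w = (omega^1, omega^2) form a frame
   built from the equation, and I = Lambda^2/N is an invariant function with a(I) = 12/5 I.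
   Differentiating the defining relations gives structure equations in which everything is
   expressed by the frame, I, L and E; in particular a(I_1) = a(I_2) = 0 always.
   A field X is a point symmetry iff the Lie derivative of the projective connection of the
   equation along X vanishes.  Such an X preserves A, B, N, Lambda, omega, L, E, hence commutes
   with a and w and annihilates I.  So X is a constant multiple of the single field
   V = (m a + 12/5 w)/I, m = 4/3 - 12/5 L + 18/5 I, and X <> 0 forces I_1 and I_2, which are
   killed by a and by V, to be constant.  Conversely, if I_1 and I_2 are constant then V commutes
   with a and w, so the Lie derivative of the connection vanishes.  The flow of c V is a
   translation in the coordinates (I, s), where ds is a closed form with ds(V) = 1.
   Fields and solutions are linked by the residual of the transported second order jet, which
   satisfies along the flow a linear equation whose inhomogeneity is the Lie derivative. *)

(** * Smooth functions on open sets of the plane *)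

(** The preserved quantities are relative. Let delta be the divergence of a symmetry and let weight
    k mean that the Lie derivative is -k delta times the quantity. Then alpha = (A, B) and Lambda
    have weight 1, N has 2, omega has -1, E has -2, and L and I have 0; phi changes by d(delta), so
    it acts as a connection for weights. Raising an index with the area element raises the weight by
    one, so a and w are true vector fields. The exponents in I_1 = L^8/I^6 and I_2 = E N/I^2 balance
    the growth rates along a: 9/5 for L, 12/5 for I, 24/5 for E N. The field V is (a(I) w - w(I)
    a)/I^2, and m appears because w(I) = -m I. Most structure equations are equalities of mixed
    partials, of A, B, N, Lambda or omega. Once written with alpha and omega they hold in both
    charts, so the choice between B <> 0 and A <> 0 matters only when definitions are unfolded.
    Graphs may turn vertical under transport. The residual is polynomial in the transported jet, so
    no slope has to be divided out until the image is known to be a graph. *)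

Notation is_derive_constR := (is_derive_const (K := R_AbsRing) (V := R_NormedModule)).
Notation is_derive_idR := (is_derive_id (K := R_AbsRing)).
Notation is_derive_plusR := (is_derive_plus (K := R_AbsRing) (V := R_NormedModule)).
Notation is_derive_multR := (is_derive_mult (K := R_AbsRing)).
Notation is_derive_compR := (is_derive_comp (K := R_AbsRing) (V := R_NormedModule)).
Notation ex_derive_continuousR := (ex_derive_continuous (V := R_NormedModule)).

Lemma Rabs_diag x : Rabs (x - x) = 0.
Proof. rewrite Rminus_diag; apply Rabs_R0. Qed.

Ltac Rmin_bounds t :=
  lazymatch t with
  | Rmin ?a ?b => let l := fresh "Rl" in let r := fresh "Rr" in
      pose proof (Rmin_l a b) as l; pose proof (Rmin_r a b) as r; Rmin_bounds a; Rmin_bounds b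
  | _ => idtac
  end.

Definition open_2d (O : R -> R -> Prop) : Prop :=
  forall x y, O x y -> locally_2d O x y.

Definition class_on (O : R -> R -> Prop) (n : nat) (f : R -> R -> R) : Prop :=
  forall x y, O x y -> ex_diff_n f n x y.

Definition smooth_on (O : R -> R -> Prop) (f : R -> R -> R) : Prop :=
  forall n, class_on O n f.

Lemma open_2d_in_box p d : open_2d (in_box p d).
Proof.
intros x y [H1 H2].
assert (Hd : 0 < Rmin (d - Rabs (x - fst p)) (d - Rabs (y - snd p))).
{ apply Rmin_glb_lt; lra. }
exists (mkposreal _ Hd); intros u v Hu Hv; simpl in Hu, Hv.
Rmin_bounds (Rmin (d - Rabs (x - fst p)) (d - Rabs (y - snd p))).
assert (T1 := Rabs_triang (u - x) (x - fst p)).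
assert (T2 := Rabs_triang (v - y) (y - snd p)).
replace (u - x + (x - fst p)) with (u - fst p) in T1 by ring.
replace (v - y + (y - snd p)) with (v - snd p) in T2 by ring.
split; lra.
Qed.

Lemma locally_2d_locally_x (P : R -> R -> Prop) x y :
  locally_2d P x y -> locally x (fun z => P z y).
Proof.
intros [d H]; exists d; intros z Hz; apply H.
- exact Hz.
- replace (y - y) with 0 by ring; rewrite Rabs_R0; apply cond_pos.
Qed.

Lemma locally_2d_locally_y (P : R -> R -> Prop) x y :
  locally_2d P x y -> locally y (fun z => P x z).
Proof.
intros [d H]; exists d; intros z Hz; apply H.
- replace (x - x) with 0 by ring; rewrite Rabs_R0; apply cond_pos.
- exact Hz.
Qed.

Lemma locally_2d_eq_on (O : R -> R -> Prop) (f g : R -> R -> R) :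
  open_2d O -> (forall x y, O x y -> f x y = g x y) ->
  forall x y, O x y -> locally_2d (fun u v => f u v = g u v) x y.
Proof.
intros HO H x y Hxy.
apply locally_2d_impl with (2 := HO x y Hxy).
apply locally_2d_forall; exact H.
Qed.

Section Calculus.

Variable O : R -> R -> Prop.
Hypothesis HO : open_2d O.

(** Existence and values of both partials in one relation: derivatives are found by composing rules
    with [fx] and [fy] unknown, and an identity is differentiated by applying the rules to both
    sides. *)
Definition pderiv (f fx fy : R -> R -> R) : Prop :=
  forall x y, O x y ->
    is_derive (fun z => f z y) x (fx x y) /\ is_derive (fun z => f x z) y (fy x y).

Lemma pderiv_intro f fx fy :
  (forall x y, O x y ->
    is_derive (fun z => f z y) x (fx x y) /\ is_derive (fun z => f x z) y (fy x y)) ->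
  pderiv f fx fy.
Proof. exact (fun H => H). Qed.

Lemma pderiv_elim f fx fy x y : pderiv f fx fy -> O x y ->
  is_derive (fun z => f z y) x (fx x y) /\ is_derive (fun z => f x z) y (fy x y).
Proof. intros H; apply H. Qed.

Lemma class_on_ext n f g :
  (forall x y, O x y -> f x y = g x y) -> class_on O n f -> class_on O n g.
Proof.
intros H Hf x y Hxy.
apply ex_diff_n_ext_loc with f; auto.
apply locally_2d_eq_on with O; auto.
Qed.

Lemma class_on_le n m f : (m <= n)%nat -> class_on O n f -> class_on O m f.
Proof. intros H Hf x y Hxy; apply ex_diff_n_m with n; auto. Qed.

Lemma class_on_cont n f : class_on O n f -> forall x y, O x y -> continuity_2d_pt f x y.
Proof. intros H x y Hxy; specialize (H x y Hxy); destruct n; apply H. Qed.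

Lemma class_on_S_pderiv n f : class_on O (S n) f -> pderiv f (dx f) (dy f).
Proof.
intros H x y Hxy; destruct (H x y Hxy) as (_ & H1 & H2 & _).
split; apply Derive_correct; assumption.
Qed.

(** The inductive step of the closure properties below: explicit partials of class n replace [dx f]
    and [dy f], with which they agree on the whole open set. *)
Lemma class_on_S n f fx fy :
  (forall x y, O x y -> continuity_2d_pt f x y) -> pderiv f fx fy ->
  class_on O n fx -> class_on O n fy -> class_on O (S n) f.
Proof.
intros Hc Hd Hx Hy x y Hxy; simpl.
destruct (Hd x y Hxy) as [D1 D2].
split; [auto|]; split; [eexists; eassumption|]; split; [eexists; eassumption|].
split.
- apply ex_diff_n_ext_loc with fx; [|auto].
  apply locally_2d_eq_on with O; auto.
  intros u v Huv; symmetry; apply is_derive_unique, Hd; auto.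
- apply ex_diff_n_ext_loc with fy; [|auto].
  apply locally_2d_eq_on with O; auto.
  intros u v Huv; symmetry; apply is_derive_unique, Hd; auto.
Qed.

Lemma class_on_dx n f : class_on O (S n) f -> class_on O n (dx f).
Proof. intros H x y Hxy; apply (H x y Hxy). Qed.

Lemma class_on_dy n f : class_on O (S n) f -> class_on O n (dy f).
Proof. intros H x y Hxy; apply (H x y Hxy). Qed.

Lemma pderiv_dx f fx fy : pderiv f fx fy -> forall x y, O x y -> dx f x y = fx x y.
Proof. intros H x y Hxy; apply is_derive_unique, H; auto. Qed.

Lemma pderiv_dy f fx fy : pderiv f fx fy -> forall x y, O x y -> dy f x y = fy x y.
Proof. intros H x y Hxy; apply is_derive_unique, H; auto. Qed.

(** An identity on an open set may be differentiated; all integrability conditions rest on this. *)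
Lemma pderiv_eq f g fx fy gx gy :
  (forall x y, O x y -> f x y = g x y) -> pderiv f fx fy -> pderiv g gx gy ->
  forall x y, O x y -> fx x y = gx x y /\ fy x y = gy x y.
Proof.
intros E Hf Hg x y Hxy.
destruct (Hf x y Hxy) as [F1 F2]; destruct (Hg x y Hxy) as [G1 G2].
assert (L := locally_2d_eq_on O f g HO E x y Hxy).
split.
- rewrite <- (is_derive_unique _ _ _ F1), <- (is_derive_unique _ _ _ G1).
  apply Derive_ext_loc, (locally_2d_locally_x (fun u v => f u v = g u v)), L.
- rewrite <- (is_derive_unique _ _ _ F2), <- (is_derive_unique _ _ _ G2).
  apply Derive_ext_loc, (locally_2d_locally_y (fun u v => f u v = g u v)), L.
Qed.

Lemma pderiv_ext f g fx fy :
  (forall x y, O x y -> f x y = g x y) -> pderiv f fx fy -> pderiv g fx fy.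
Proof.
intros E Hf x y Hxy; destruct (Hf x y Hxy) as [F1 F2].
assert (L := locally_2d_eq_on O f g HO E x y Hxy).
split.
- apply is_derive_ext_loc with (2 := F1).
  apply (locally_2d_locally_x (fun u v => f u v = g u v)), L.
- apply is_derive_ext_loc with (2 := F2).
  apply (locally_2d_locally_y (fun u v => f u v = g u v)), L.
Qed.

Lemma pderiv_const c : pderiv (fun _ _ => c) (fun _ _ => 0) (fun _ _ => 0).
Proof. intros x y _; split; apply (is_derive_constR c). Qed.

Lemma pderiv_x : pderiv (fun x _ => x) (fun _ _ => 1) (fun _ _ => 0).
Proof. intros x y _; split; [apply is_derive_idR|apply is_derive_constR]. Qed.

Lemma pderiv_y : pderiv (fun _ y => y) (fun _ _ => 0) (fun _ _ => 1).
Proof. intros x y _; split; [apply is_derive_constR|apply is_derive_idR]. Qed.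

Lemma pderiv_plus f fx fy g gx gy : pderiv f fx fy -> pderiv g gx gy ->
  pderiv (fun x y => f x y + g x y)
    (fun x y => fx x y + gx x y) (fun x y => fy x y + gy x y).
Proof.
intros Hf Hg x y Hxy; destruct (Hf x y Hxy), (Hg x y Hxy).
split; apply (is_derive_plusR); assumption.
Qed.

Lemma pderiv_opp f fx fy : pderiv f fx fy ->
  pderiv (fun x y => - f x y) (fun x y => - fx x y) (fun x y => - fy x y).
Proof.
intros Hf x y Hxy; destruct (Hf x y Hxy).
split; apply (is_derive_opp (K := R_AbsRing) (V := R_NormedModule)); assumption.
Qed.

Lemma pderiv_minus f fx fy g gx gy : pderiv f fx fy -> pderiv g gx gy ->
  pderiv (fun x y => f x y - g x y)
    (fun x y => fx x y - gx x y) (fun x y => fy x y - gy x y).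
Proof.
intros Hf Hg x y Hxy; destruct (Hf x y Hxy), (Hg x y Hxy).
split; apply (is_derive_minus (K := R_AbsRing) (V := R_NormedModule)); assumption.
Qed.

Lemma pderiv_mult f fx fy g gx gy : pderiv f fx fy -> pderiv g gx gy ->
  pderiv (fun x y => f x y * g x y)
    (fun x y => fx x y * g x y + f x y * gx x y)
    (fun x y => fy x y * g x y + f x y * gy x y).
Proof.
intros Hf Hg x y Hxy; destruct (Hf x y Hxy), (Hg x y Hxy).
split.
- apply (is_derive_multR (fun z => f z y) (fun z => g z y));
    auto; intros; apply Rmult_comm.
- apply (is_derive_multR (fun z => f x z) (fun z => g x z));
    auto; intros; apply Rmult_comm.
Qed.

Lemma pderiv_inv f fx fy : (forall x y, O x y -> f x y <> 0) -> pderiv f fx fy ->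
  pderiv (fun x y => / f x y)
    (fun x y => - fx x y / f x y ^ 2) (fun x y => - fy x y / f x y ^ 2).
Proof.
intros H0 Hf x y Hxy; destruct (Hf x y Hxy).
split.
- apply (is_derive_inv (fun z => f z y)); auto.
- apply (is_derive_inv (fun z => f x z)); auto.
Qed.

Lemma pderiv_div f fx fy g gx gy : (forall x y, O x y -> g x y <> 0) ->
  pderiv f fx fy -> pderiv g gx gy ->
  pderiv (fun x y => f x y / g x y)
    (fun x y => (fx x y * g x y - f x y * gx x y) / g x y ^ 2)
    (fun x y => (fy x y * g x y - f x y * gy x y) / g x y ^ 2).
Proof.
intros H0 Hf Hg x y Hxy; destruct (Hf x y Hxy), (Hg x y Hxy).
split.
- apply (is_derive_div (fun z => f z y) (fun z => g z y)); auto.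
- apply (is_derive_div (fun z => f x z) (fun z => g x z)); auto.
Qed.

Lemma pderiv_pow n f fx fy : pderiv f fx fy ->
  pderiv (fun x y => f x y ^ n)
    (fun x y => INR n * fx x y * f x y ^ pred n)
    (fun x y => INR n * fy x y * f x y ^ pred n).
Proof.
intros Hf x y Hxy; destruct (Hf x y Hxy).
split.
- apply (is_derive_pow (fun z => f z y)); assumption.
- apply (is_derive_pow (fun z => f x z)); assumption.
Qed.

Lemma class_on_const n c : class_on O n (fun _ _ => c).
Proof.
revert c; induction n as [|n IH]; intros c.
- intros x y _; split; [apply continuity_2d_pt_const|exact I].
- apply class_on_S with (fun _ _ => 0) (fun _ _ => 0); auto.
  + intros x y _; apply continuity_2d_pt_const.
  + apply pderiv_const.
Qed.

Lemma class_on_x n : class_on O n (fun x _ => x).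
Proof.
destruct n as [|n].
- intros x y _; split; [apply continuity_2d_pt_id1|exact I].
- apply class_on_S with (fun _ _ => 1) (fun _ _ => 0); auto using class_on_const.
  + intros x y _; apply continuity_2d_pt_id1.
  + apply pderiv_x.
Qed.

Lemma class_on_y n : class_on O n (fun _ y => y).
Proof.
destruct n as [|n].
- intros x y _; split; [apply continuity_2d_pt_id2|exact I].
- apply class_on_S with (fun _ _ => 0) (fun _ _ => 1); auto using class_on_const.
  + intros x y _; apply continuity_2d_pt_id2.
  + apply pderiv_y.
Qed.

Lemma class_on_plus n f g : class_on O n f -> class_on O n g ->
  class_on O n (fun x y => f x y + g x y).
Proof.
revert f g; induction n as [|n IH]; intros f g Hf Hg.
- intros x y Hxy; split; [apply continuity_2d_pt_plus|exact I];
    [apply (Hf x y Hxy)|apply (Hg x y Hxy)].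
- eapply class_on_S.
  + intros x y Hxy; apply continuity_2d_pt_plus;
      [apply (Hf x y Hxy)|apply (Hg x y Hxy)].
  + apply pderiv_plus; apply class_on_S_pderiv with n; assumption.
  + apply IH; apply class_on_dx; assumption.
  + apply IH; apply class_on_dy; assumption.
Qed.

Lemma class_on_mult n f g : class_on O n f -> class_on O n g ->
  class_on O n (fun x y => f x y * g x y).
Proof.
revert f g; induction n as [|n IH]; intros f g Hf Hg.
- intros x y Hxy; split; [apply continuity_2d_pt_mult|exact I];
    [apply (Hf x y Hxy)|apply (Hg x y Hxy)].
- assert (Hf' := class_on_le _ n _ (Nat.le_succ_diag_r n) Hf).
  assert (Hg' := class_on_le _ n _ (Nat.le_succ_diag_r n) Hg).
  eapply class_on_S.
  + intros x y Hxy; apply continuity_2d_pt_mult;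
      [apply (Hf x y Hxy)|apply (Hg x y Hxy)].
  + apply pderiv_mult; apply class_on_S_pderiv with n; assumption.
  + apply class_on_plus; apply IH; auto; apply class_on_dx; assumption.
  + apply class_on_plus; apply IH; auto; apply class_on_dy; assumption.
Qed.

Lemma class_on_inv n f : (forall x y, O x y -> f x y <> 0) -> class_on O n f ->
  class_on O n (fun x y => / f x y).
Proof.
intros H0; revert f H0; induction n as [|n IH]; intros f H0 Hf.
- intros x y Hxy; split; [|exact I].
  apply continuity_2d_pt_inv; [apply (Hf x y Hxy)|auto].
- assert (Hf' := class_on_le _ n _ (Nat.le_succ_diag_r n) Hf).
  (* The quotient is a product of [g] and two copies of the inverse, so the induction hypothesis
     covers it. *)
  assert (HD : forall g, class_on O n g -> class_on O n (fun x y => - g x y / f x y ^ 2)).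
  { intros g Hg.
    apply class_on_ext with (fun x y => (-1) * g x y * (/ f x y * / f x y)).
    - intros x y Hxy; field; auto.
    - apply class_on_mult; apply class_on_mult; auto using class_on_const. }
  eapply class_on_S.
  + intros x y Hxy; apply continuity_2d_pt_inv; [apply (Hf x y Hxy)|auto].
  + apply pderiv_inv; auto; apply class_on_S_pderiv with n; assumption.
  + apply HD, class_on_dx; assumption.
  + apply HD, class_on_dy; assumption.
Qed.

Lemma smooth_on_ext f g :
  (forall x y, O x y -> f x y = g x y) -> smooth_on O f -> smooth_on O g.
Proof. intros H Hf n; apply class_on_ext with f; auto. Qed.

Lemma smooth_on_dx f : smooth_on O f -> smooth_on O (dx f).
Proof. intros H n; apply class_on_dx, H. Qed.

Lemma smooth_on_dy f : smooth_on O f -> smooth_on O (dy f).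
Proof. intros H n; apply class_on_dy, H. Qed.

Lemma smooth_on_const c : smooth_on O (fun _ _ => c).
Proof. intros n; apply class_on_const. Qed.

Lemma smooth_on_plus f g : smooth_on O f -> smooth_on O g ->
  smooth_on O (fun x y => f x y + g x y).
Proof. intros Hf Hg n; apply class_on_plus; auto. Qed.

Lemma smooth_on_mult f g : smooth_on O f -> smooth_on O g ->
  smooth_on O (fun x y => f x y * g x y).
Proof. intros Hf Hg n; apply class_on_mult; auto. Qed.

Lemma smooth_on_opp f : smooth_on O f -> smooth_on O (fun x y => - f x y).
Proof.
intros Hf; apply smooth_on_ext with (fun x y => (-1) * f x y).
- intros; ring.
- apply smooth_on_mult; auto using smooth_on_const.
Qed.

Lemma smooth_on_minus f g : smooth_on O f -> smooth_on O g ->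
  smooth_on O (fun x y => f x y - g x y).
Proof. intros Hf Hg; apply smooth_on_plus; auto using smooth_on_opp. Qed.

Lemma smooth_on_div f g : (forall x y, O x y -> g x y <> 0) ->
  smooth_on O f -> smooth_on O g -> smooth_on O (fun x y => f x y / g x y).
Proof.
intros H0 Hf Hg; apply smooth_on_mult; auto.
intros n; apply class_on_inv; auto.
Qed.

Lemma smooth_on_pow f n : smooth_on O f -> smooth_on O (fun x y => f x y ^ n).
Proof.
intros Hf; induction n as [|n IH]; simpl.
- apply smooth_on_const.
- apply smooth_on_mult; auto.
Qed.

Lemma smooth_on_pderiv f : smooth_on O f -> pderiv f (dx f) (dy f).
Proof. intros H; apply class_on_S_pderiv with 0%nat; apply H. Qed.

Lemma dx_dy f : smooth_on O f -> forall x y, O x y -> dx (dy f) x y = dy (dx f) x y.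
Proof.
intros H x y Hxy.
assert (Hx := smooth_on_pderiv f H).
assert (Hdx := smooth_on_pderiv _ (smooth_on_dx f H)).
assert (Hdy := smooth_on_pderiv _ (smooth_on_dy f H)).
unfold dx at 1, dy at 2.
symmetry; unfold dx, dy; symmetry; apply Schwarz.
- apply locally_2d_impl with (2 := HO x y Hxy), locally_2d_forall.
  intros u v Huv.
  split; [eexists; apply (Hx u v Huv)|]; split; [eexists; apply (Hx u v Huv)|].
  split; eexists; [apply (Hdy u v Huv)|apply (Hdx u v Huv)].
- apply (class_on_cont 0 (dx (dy f))); auto.
  apply smooth_on_dx, smooth_on_dy, H.
- apply (class_on_cont 0 (dy (dx f))); auto.
  apply smooth_on_dy, smooth_on_dx, H.
Qed.

(** Differentiability comes from an x-partial that exists nearby and is continuous, together with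
    the y-partial at the point. *)
Lemma class_on_differentiable n f : class_on O (S n) f -> forall x y, O x y ->
  differentiable_pt_lim f x y (dx f x y) (dy f x y).
Proof.
intros H x y Hxy.
apply filterdiff_differentiable_pt_lim.
apply (is_derive_filterdiff f x y (dx f) (dy f x y)).
- apply (locally_2d_locally (fun u v => is_derive (fun z => f z v) u (dx f u v))).
  apply locally_2d_impl with (2 := HO x y Hxy), locally_2d_forall.
  intros u v Huv; apply (class_on_S_pderiv n f H u v Huv).
- apply (class_on_S_pderiv n f H x y Hxy).
- apply (continuity_2d_pt_filterlim (dx f)).
  apply (class_on_cont n _ (class_on_dx n f H)); auto.
Qed.

End Calculus.

(** * Composition with functions of two variables *)

Lemma is_derive_comp_2d (O : R -> R -> Prop) n F u v z u' v' :
  open_2d O -> class_on O (S n) F -> O (u z) (v z) ->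
  is_derive u z u' -> is_derive v z v' ->
  is_derive (fun s => F (u s) (v s)) z (dx F (u z) (v z) * u' + dy F (u z) (v z) * v').
Proof.
intros HO HF Hz Hu Hv.
apply is_derive_Reals, derivable_pt_lim_comp_2d.
- apply class_on_differentiable with O n; auto.
- apply is_derive_Reals; auto.
- apply is_derive_Reals; auto.
Qed.

Lemma continuity_2d_pt_comp F u v x y :
  continuity_2d_pt F (u x y) (v x y) -> continuity_2d_pt u x y ->
  continuity_2d_pt v x y -> continuity_2d_pt (fun a b => F (u a b) (v a b)) x y.
Proof.
intros HF Hu Hv eps.
destruct (HF eps) as [d Hd].
generalize (locally_2d_and _ _ x y (Hu d) (Hv d)).
apply locally_2d_impl, locally_2d_forall.
intros a b [Ha Hb]; apply Hd; assumption.
Qed.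

Lemma pderiv_comp (O V : R -> R -> Prop) F u v ux uy vx vy :
  open_2d V -> smooth_on V F -> (forall x y, O x y -> V (u x y) (v x y)) ->
  pderiv O u ux uy -> pderiv O v vx vy ->
  pderiv O (fun x y => F (u x y) (v x y))
    (fun x y => dx F (u x y) (v x y) * ux x y + dy F (u x y) (v x y) * vx x y)
    (fun x y => dx F (u x y) (v x y) * uy x y + dy F (u x y) (v x y) * vy x y).
Proof.
intros HV HF H Hu Hv x y Hxy.
destruct (Hu x y Hxy) as [U1 U2]; destruct (Hv x y Hxy) as [V1 V2].
split.
- apply (is_derive_comp_2d V 0 F (fun z => u z y) (fun z => v z y)); auto.
- apply (is_derive_comp_2d V 0 F (fun z => u x z) (fun z => v x z)); auto.
Qed.

(** The induction runs over all [F] at once, since the chain rule replaces [F] by [dx F] and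
    [dy F]. *)
Lemma class_on_comp (O V : R -> R -> Prop) n F u v :
  open_2d O -> open_2d V -> smooth_on V F ->
  (forall x y, O x y -> V (u x y) (v x y)) ->
  class_on O n u -> class_on O n v -> class_on O n (fun x y => F (u x y) (v x y)).
Proof.
intros HO HV HF H; revert F HF; induction n as [|n IH]; intros F HF Hu Hv.
- intros x y Hxy; split; [|exact I].
  apply continuity_2d_pt_comp; [apply (HF 0%nat); auto|apply (Hu x y Hxy)|apply (Hv x y Hxy)].
- assert (Hu' := class_on_le O _ n _ (Nat.le_succ_diag_r n) Hu).
  assert (Hv' := class_on_le O _ n _ (Nat.le_succ_diag_r n) Hv).
  eapply class_on_S; auto.
  + intros x y Hxy.
    apply continuity_2d_pt_comp; [apply (HF 0%nat); auto|apply (Hu x y Hxy)|apply (Hv x y Hxy)].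
  + apply pderiv_comp with V; auto; apply class_on_S_pderiv with n; assumption.
  + apply class_on_plus; auto; apply class_on_mult; auto;
      try (apply class_on_dx; assumption); apply IH; auto using smooth_on_dx, smooth_on_dy.
  + apply class_on_plus; auto; apply class_on_mult; auto;
      try (apply class_on_dy; assumption); apply IH; auto using smooth_on_dx, smooth_on_dy.
Qed.

Lemma smooth_on_comp (O V : R -> R -> Prop) F u v :
  open_2d O -> open_2d V -> smooth_on V F ->
  (forall x y, O x y -> V (u x y) (v x y)) ->
  smooth_on O u -> smooth_on O v -> smooth_on O (fun x y => F (u x y) (v x y)).
Proof. intros HO HV HF H Hu Hv n; apply class_on_comp with V; auto. Qed.

Lemma smooth_on_incl (O V : R -> R -> Prop) f :
  (forall x y, O x y -> V x y) -> smooth_on V f -> smooth_on O f.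
Proof. intros H Hf n x y Hxy; apply Hf; auto. Qed.

(** The x-derivative of [dy g] is returned as the y-derivative of the known x-derivative [gx], so
    that each mixed partial has one syntactic form that [field] can match. *)
Lemma pderiv_dy_canonical O (HO : open_2d O) g gx gy :
  smooth_on O g -> pderiv O g gx gy -> pderiv O (dy g) (dy gx) (dy (dy g)).
Proof.
intros Hg Hd.
assert (E : forall x y, O x y -> dx (dy g) x y = dy gx x y).
{ intros x y Hxy; rewrite dx_dy with (O := O); auto.
  apply Derive_ext_loc, (locally_2d_locally_y (fun u v => dx g u v = gx u v)).
  apply locally_2d_eq_on with O; auto.
  exact (pderiv_dx O g gx gy Hd). }
intros x y Hxy.
destruct (smooth_on_pderiv O _ (smooth_on_dy O g Hg) x y Hxy) as [D1 D2].
rewrite E in D1; auto.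
Qed.

#[global] Opaque pderiv.

(* Automatic differentiation of identities *)
Create HintDb smooth.
#[global] Hint Resolve smooth_on_dx smooth_on_dy smooth_on_const smooth_on_plus smooth_on_mult
  smooth_on_opp smooth_on_minus smooth_on_pow : smooth.

(* Mixed derivatives come out in the normal form dy (... (dx (... f))). *)
Ltac pderiv_atom :=
  lazymatch goal with
  | |- pderiv ?O (fun x y => ?f x y) ?a ?b => change (pderiv O f a b)
  | _ => idtac
  end;
  lazymatch goal with
  | |- pderiv _ (dy _) _ _ =>
      eapply pderiv_dy_canonical; [assumption | solve [auto 10 with smooth] | pderiv_atom]
  | |- pderiv _ _ _ _ => eapply smooth_on_pderiv; solve [auto 10 with smooth]
  end.

Ltac pderiv_tac :=
  first [eapply pderiv_const | eapply pderiv_x | eapply pderiv_y |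
  lazymatch goal with
  | |- pderiv _ (fun x y => @?f x y + @?g x y) _ _ => eapply pderiv_plus; pderiv_tac
  | |- pderiv _ (fun x y => @?f x y - @?g x y) _ _ => eapply pderiv_minus; pderiv_tac
  | |- pderiv _ (fun x y => - @?f x y) _ _ => eapply pderiv_opp; pderiv_tac
  | |- pderiv _ (fun x y => @?f x y * @?g x y) _ _ => eapply pderiv_mult; pderiv_tac
  | |- pderiv _ (fun x y => @?f x y / @?g x y) _ _ =>
      eapply pderiv_div; [solve [eauto] | pderiv_tac | pderiv_tac]
  | |- pderiv _ (fun x y => @?f x y ^ _) _ _ => eapply pderiv_pow; pderiv_tac
  | |- _ => pderiv_atom
  end].

(** From an identity [H] on an open set, [H'] is the equality of the x- and y-derivatives of its two
    sides, computed by the rules. *)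
Ltac diff_eq HO H H' :=
  lazymatch type of H with
  | forall x y, ?O x y -> @?f x y = @?g x y =>
      unshelve epose proof (pderiv_eq O HO f g _ _ _ _ H _ _) as H';
      [ | | | | pderiv_tac | pderiv_tac | ]; cbv beta in H'; cbn [INR Init.Nat.pred] in H'
  end.

(* [lincomb t] proves an equality whose two sides differ by the combination [t] of the
   differences [diff H] of the sides of known equalities [H]. *)
Definition diff {a b : R} (_ : a = b) : R := a - b.

Lemma diff_0 a b (H : a = b) : diff H = 0.
Proof. unfold diff; lra. Qed.

Tactic Notation "lincomb" constr(t) "after" tactic3(tac) :=
  apply Rminus_diag_uniq; transitivity t;
  [unfold diff; tac; field; auto | rewrite ?diff_0; field; auto].
Tactic Notation "lincomb" constr(t) := lincomb t after idtac.

Ltac neq0 :=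
  unfold Rdiv; repeat first [solve [auto] | apply Rmult_integral_contrapositive_currified
    | apply Rinv_neq_0_compat | apply pow_nonzero | lra].

(** Serves [eval_pderiv]: the goal, abstracted over the two partials of [f] at a point, is restated
    with the values that the rules compute. *)
Lemma pderiv_at O f x y (G : R -> R -> Prop) : O x y ->
  (exists fx fy, pderiv O f fx fy /\ G (fx x y) (fy x y)) -> G (dx f x y) (dy f x y).
Proof.
intros Hxy (fx & fy & D & H).
rewrite (pderiv_dx O f fx fy D x y Hxy), (pderiv_dy O f fx fy D x y Hxy); exact H.
Qed.

Ltac eval_pderiv Hxy f tac :=
  lazymatch type of Hxy with ?O ?x ?y =>
    pattern (dx f x y), (dy f x y); apply (pderiv_at O f x y _ Hxy); eexists; eexists;
    split; [solve [tac] | cbv beta; cbn [INR Init.Nat.pred]]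
  end.

(** * The Lie derivative of the equation *)

Section LieDerivative.

Variable O : R -> R -> Prop.
Hypothesis HO : open_2d O.
Variables P Q R' S' X Y : R -> R -> R.
Hypotheses (SP : smooth_on O P) (SQ : smooth_on O Q) (SR : smooth_on O R')
  (SS : smooth_on O S') (SX : smooth_on O X) (SY : smooth_on O Y).

(* The Lie derivative of the projective connection of the equation along (X, Y):
   the coefficients of v1^3, v1^2 v2, v1 v2^2, v2^3 in its contraction with v. *)
Definition lie0 (x y : R) : R :=
  dx (dx Y) x y - (X x y * dx P x y + Y x y * dy P x y)
  - 3 * dx Y x y * Q x y + dy Y x y * P x y - 2 * dx X x y * P x y.
Definition lie1 (x y : R) : R :=
  2 * dy (dx Y) x y - dx (dx X) x y - 3 * (X x y * dx Q x y + Y x y * dy Q x y)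
  - 6 * dx Y x y * R' x y - 3 * dx X x y * Q x y - 3 * dy X x y * P x y.
Definition lie2 (x y : R) : R :=
  dy (dy Y) x y - 2 * dy (dx X) x y - 3 * (X x y * dx R' x y + Y x y * dy R' x y)
  - 3 * dx Y x y * S' x y - 3 * dy Y x y * R' x y - 6 * dy X x y * Q x y.
Definition lie3 (x y : R) : R :=
  - dy (dy X) x y - (X x y * dx S' x y + Y x y * dy S' x y)
  - 3 * dy X x y * R' x y - 2 * dy Y x y * S' x y + dx X x y * S' x y.

(** This is the bivector v ^ nabla_v v of the projective connection; where [v1] is nonzero, it
    vanishes iff the integral curves of v satisfy the equation. *)
Definition theta (v1 v2 : R -> R -> R) (x y : R) : R :=
  v1 x y * (v1 x y * dx v2 x y + v2 x y * dy v2 x y)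
  - v2 x y * (v1 x y * dx v1 x y + v2 x y * dy v1 x y)
  - (P x y * v1 x y ^ 3 + 3 * Q x y * v1 x y ^ 2 * v2 x y
     + 3 * R' x y * v1 x y * v2 x y ^ 2 + S' x y * v2 x y ^ 3).

Definition commutes (v1 v2 : R -> R -> R) : Prop :=
  (forall x y, O x y -> X x y * dx v1 x y + Y x y * dy v1 x y
                      = v1 x y * dx X x y + v2 x y * dy X x y) /\
  (forall x y, O x y -> X x y * dx v2 x y + Y x y * dy v2 x y
                      = v1 x y * dx Y x y + v2 x y * dy Y x y).

(** Being a bivector, [theta] contributes the divergence term. Since v is preserved, the rest of the
    Lie derivative comes only from the change of the connection, whose contraction with v, v, v is
    the cubic. *)
Lemma theta_lie v1 v2 : smooth_on O v1 -> smooth_on O v2 -> commutes v1 v2 ->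
  forall x y, O x y ->
  X x y * dx (theta v1 v2) x y + Y x y * dy (theta v1 v2) x y
  = (dx X x y + dy Y x y) * theta v1 v2 x y
    + (lie0 x y * v1 x y ^ 3 + lie1 x y * v1 x y ^ 2 * v2 x y
       + lie2 x y * v1 x y * v2 x y ^ 2 + lie3 x y * v2 x y ^ 3).
Proof.
intros S1 S2 [B1 B2] x y Hxy.
diff_eq HO B1 D1; diff_eq HO B2 D2.
destruct (D1 x y Hxy) as [B1x B1y]; destruct (D2 x y Hxy) as [B2x B2y]; clear D1 D2.
specialize (B1 x y Hxy); specialize (B2 x y Hxy).
eval_pderiv Hxy (theta v1 v2) ltac:(unfold theta; pderiv_tac).
unfold theta, lie0, lie1, lie2, lie3.
lincomb (v1 x y * v1 x y * diff B2x + v1 x y * v2 x y * diff B2y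
  - v2 x y * v1 x y * diff B1x - v2 x y * v2 x y * diff B1y
  + (2 * v1 x y * dx v2 x y + v2 x y * dy v2 x y - v2 x y * dx v1 x y
     - 3 * P x y * v1 x y ^ 2 - 6 * Q x y * v1 x y * v2 x y - 3 * R' x y * v2 x y ^ 2)
    * diff B1
  + (v1 x y * dy v2 x y - v1 x y * dx v1 x y - 2 * v2 x y * dy v1 x y
     - 3 * Q x y * v1 x y ^ 2 - 6 * R' x y * v1 x y * v2 x y - 3 * S' x y * v2 x y ^ 2)
    * diff B2).
Qed.

Hypothesis det0 : forall x y, O x y -> lie0 x y = 0.
Hypothesis det1 : forall x y, O x y -> lie1 x y = 0.
Hypothesis det2 : forall x y, O x y -> lie2 x y = 0.
Hypothesis det3 : forall x y, O x y -> lie3 x y = 0.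

Variables A B : R -> R -> R.
Hypotheses (SA : smooth_on O A) (SB : smooth_on O B).
Hypothesis defA : forall x y, O x y -> A x y =
  dy (dy P) x y - 2 * dy (dx Q) x y + dx (dx R') x y
  + 2 * P x y * dx S' x y + S' x y * dx P x y
  - 3 * P x y * dy R' x y - 3 * R' x y * dy P x y
  - 3 * Q x y * dx R' x y + 6 * Q x y * dy Q x y.
Hypothesis defB : forall x y, O x y -> B x y =
  dx (dx S') x y - 2 * dy (dx R') x y + dy (dy Q) x y
  - 2 * S' x y * dy P x y - P x y * dy S' x y
  + 3 * S' x y * dx Q x y + 3 * Q x y * dx S' x y
  + 3 * R' x y * dy Q x y - 6 * R' x y * dx R' x y.

(** [A] and [B] are natural second-order expressions in the connection, so a field that preserves
    the connection preserves (A, B) as a covector of weight one. *)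
Lemma lie_AB x y : O x y ->
  X x y * dx A x y + Y x y * dy A x y + dx X x y * A x y + dx Y x y * B x y
    + (dx X x y + dy Y x y) * A x y = 0 /\
  X x y * dx B x y + Y x y * dy B x y + dy X x y * A x y + dy Y x y * B x y
    + (dx X x y + dy Y x y) * B x y = 0.
Proof.
intros Hxy.
diff_eq HO defA DA; diff_eq HO defB DB.
assert (hA := defA x y Hxy); assert (hB := defB x y Hxy).
destruct (DA x y Hxy) as [Ax Ay]; destruct (DB x y Hxy) as [Bx By].
rewrite Ax, Ay, Bx, By, hA, hB; clear DA DB Ax Ay Bx By hA hB.
assert (d0 := det0); assert (d1 := det1); assert (d2 := det2); assert (d3 := det3).
unfold lie0, lie1, lie2, lie3 in *.
diff_eq HO d0 D0; diff_eq HO d1 D1; diff_eq HO d2 D2; diff_eq HO d3 D3.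
assert (D0x := fun x y H => proj1 (D0 x y H)); assert (D0y := fun x y H => proj2 (D0 x y H)).
assert (D1x := fun x y H => proj1 (D1 x y H)); assert (D1y := fun x y H => proj2 (D1 x y H)).
assert (D2x := fun x y H => proj1 (D2 x y H)); assert (D2y := fun x y H => proj2 (D2 x y H)).
assert (D3x := fun x y H => proj1 (D3 x y H)); assert (D3y := fun x y H => proj2 (D3 x y H)).
cbv beta in *.
diff_eq HO D0y H0; destruct (H0 x y Hxy) as [_ D0yy]; clear H0.
diff_eq HO D1x H1; destruct (H1 x y Hxy) as [D1xx D1xy]; clear H1.
diff_eq HO D1y H1; destruct (H1 x y Hxy) as [_ D1yy]; clear H1.
diff_eq HO D2x H2; destruct (H2 x y Hxy) as [D2xx D2xy]; clear H2.
diff_eq HO D3x H3; destruct (H3 x y Hxy) as [D3xx _]; clear H3.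
specialize (d0 x y Hxy); specialize (d1 x y Hxy); specialize (d2 x y Hxy); specialize (d3 x y Hxy).
specialize (D0x x y Hxy); specialize (D1x x y Hxy); specialize (D2x x y Hxy);
  specialize (D3x x y Hxy).
specialize (D0y x y Hxy); specialize (D1y x y Hxy); specialize (D2y x y Hxy);
  specialize (D3y x y Hxy).
clear D0 D1 D2 D3.
split.
(* Up to sign, this is the linearisation of the formula for [A] when (P, Q, R, S) changes in the
   direction ([lie0], [lie1]/3, [lie2]/3, [lie3]); the next combination is the same for [B]. *)
- lincomb (- (diff D0yy - 2 / 3 * diff D1xy + / 3 * diff D2xx
    + 2 * P x y * diff D3x + 2 * diff d0 * dx S' x y + S' x y * diff D0x + diff d3 * dx P x y
    - P x y * diff D2y - 3 * diff d0 * dy R' x y - 3 * R' x y * diff D0y - diff d2 * dy P x y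
    - Q x y * diff D2x - diff d1 * dx R' x y + 2 * Q x y * diff D1y + 2 * diff d1 * dy Q x y)).
- lincomb (- (diff D3xx - 2 / 3 * diff D2xy + / 3 * diff D1yy
    - 2 * S' x y * diff D0y - 2 * diff d3 * dy P x y - P x y * diff D3y - diff d0 * dy S' x y
    + S' x y * diff D1x + 3 * diff d3 * dx Q x y + Q x y * diff D3x * 3 + diff d1 * dx S' x y
    + R' x y * diff D1y + diff d2 * dy Q x y - 2 * R' x y * diff D2x - 2 * diff d2 * dx R' x y)).
Qed.

End LieDerivative.

(** * Structure equations *)

Section Structure.

Variable O : R -> R -> Prop.
Hypothesis HO : open_2d O.
(* [f1], [f2], [La], [w1], [w2] stand for phi_1, phi_2, Lambda, omega_1, omega_2. *)
Variables P Q R' S' f1 f2 A B N La w1 w2 K Z : R -> R -> R.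
Hypotheses (SP : smooth_on O P) (SQ : smooth_on O Q) (SR : smooth_on O R')
  (SS : smooth_on O S') (Sf1 : smooth_on O f1) (Sf2 : smooth_on O f2)
  (SA : smooth_on O A) (SB : smooth_on O B) (SN : smooth_on O N)
  (SLa : smooth_on O La) (Sw1 : smooth_on O w1) (Sw2 : smooth_on O w2)
  (SK : smooth_on O K) (SZ : smooth_on O Z).
Hypothesis N0 : forall x y, O x y -> N x y <> 0.
Hypothesis La0 : forall x y, O x y -> La x y <> 0.

Hypothesis defA : forall x y, O x y -> A x y =
  dy (dy P) x y - 2 * dy (dx Q) x y + dx (dx R') x y
  + 2 * P x y * dx S' x y + S' x y * dx P x y
  - 3 * P x y * dy R' x y - 3 * R' x y * dy P x y
  - 3 * Q x y * dx R' x y + 6 * Q x y * dy Q x y.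
Hypothesis defB : forall x y, O x y -> B x y =
  dx (dx S') x y - 2 * dy (dx R') x y + dy (dy Q) x y
  - 2 * S' x y * dy P x y - P x y * dy S' x y
  + 3 * S' x y * dx Q x y + 3 * Q x y * dx S' x y
  + 3 * R' x y * dy Q x y - 6 * R' x y * dx R' x y.

(** With alpha = (A, B), the connection Gamma below and eps_12 = 1, these four say (nabla_i + phi_i)
    alpha_j = -(3/5) N eps_ij. The next two say (d_i + 2 phi_i) N = -Lambda alpha_i, and [eqf] says
    that phi is closed. *)
Hypothesis eqAx : forall x y, O x y ->
  dx A x y = Q x y * A x y - P x y * B x y - 5 / 3 * f1 x y * A x y.
Hypothesis eqBy : forall x y, O x y ->
  dy B x y = S' x y * A x y - R' x y * B x y - 5 / 3 * f2 x y * B x y.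
Hypothesis eqAy : forall x y, O x y ->
  dy A x y = 3 / 5 * N x y + R' x y * A x y - Q x y * B x y
             - 4 / 3 * f2 x y * A x y - 1 / 3 * f1 x y * B x y.
Hypothesis eqBx : forall x y, O x y ->
  dx B x y = - (3 / 5) * N x y + R' x y * A x y - Q x y * B x y
             - 1 / 3 * f2 x y * A x y - 4 / 3 * f1 x y * B x y.
Hypothesis eqNx : forall x y, O x y ->
  dx N x y = - 2 * f1 x y * N x y - La x y * A x y.
Hypothesis eqNy : forall x y, O x y ->
  dy N x y = - 2 * f2 x y * N x y - La x y * B x y.
Hypothesis eqf : forall x y, O x y -> dx f2 x y = dy f1 x y.

(** * The connection, its curvature and the integrability conditions *)

Definition g111 x y := Q x y - 2 / 3 * f1 x y.
Definition g112 x y := R' x y - 1 / 3 * f2 x y.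
Definition g122 x y := S' x y.
Definition g211 x y := - P x y.
Definition g212 x y := - Q x y - 1 / 3 * f1 x y.
Definition g222 x y := - R' x y - 2 / 3 * f2 x y.

(** [curv11] to [curv22] are the rho^k_q with derivatives written out, and [g111] to [g222] are the
    Gamma^k_ij. The trace Gamma^k_ki equals -phi_i. *)
Definition curv11 x y :=
  (dx R' x y - 1 / 3 * dx f2 x y) - (dy Q x y - 2 / 3 * dy f1 x y)
  + (g111 x y * g112 x y - g112 x y * g111 x y
     + (g112 x y * g212 x y - g122 x y * g211 x y)).
Definition curv12 x y :=
  dx S' x y - (dy R' x y - 1 / 3 * dy f2 x y)
  + (g111 x y * g122 x y - g112 x y * g112 x y
     + (g112 x y * g222 x y - g122 x y * g212 x y)).
Definition curv21 x y :=
  (- dx Q x y - 1 / 3 * dx f1 x y) - (- dy P x y)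
  + (g211 x y * g112 x y - g212 x y * g111 x y
     + (g212 x y * g212 x y - g222 x y * g211 x y)).
Definition curv22 x y :=
  (- dx R' x y - 2 / 3 * dx f2 x y) - (- dy Q x y - 1 / 3 * dy f1 x y)
  + (g211 x y * g122 x y - g212 x y * g112 x y
     + (g212 x y * g222 x y - g222 x y * g212 x y)).

(** In a chart, the definition of omega supplies two entries of the matrix identity rho = (3/5)
    Lambda Id + (B, -A) (x) omega. *)
Hypothesis chart_curv : forall x y, O x y ->
  (B x y <> 0 /\ curv11 x y = 3 / 5 * La x y + B x y * w1 x y
    /\ curv12 x y = B x y * w2 x y) \/
  (A x y <> 0 /\ curv21 x y = - A x y * w1 x y
    /\ curv22 x y = 3 / 5 * La x y - A x y * w2 x y).

Ltac pderiv_by C := eapply pderiv_ext; [exact HO|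
  intros; symmetry; apply C; eassumption|pderiv_tac].

Ltac jets := rewrite ?eqAx, ?eqAy, ?eqBx, ?eqBy, ?eqNx, ?eqNy, ?eqf in * by assumption.

(** Equality of the mixed partials of [A] and of [B] is a Ricci identity: alpha is a left
    eigenvector of the curvature. The vanishing trace amounts to d(phi) = 0. *)
Lemma curvature_annihilates_A x y : O x y ->
  A x y * curv11 x y + B x y * curv21 x y = 3 / 5 * La x y * A x y /\
  A x y * curv12 x y + B x y * curv22 x y = 3 / 5 * La x y * B x y /\
  curv11 x y + curv22 x y = 0.
Proof.
intros Hxy.
diff_eq HO eqAx HAx; diff_eq HO eqAy HAy; diff_eq HO eqBx HBx; diff_eq HO eqBy HBy.
(* Both equations express the same normal form [dy (dx A)]; the final arithmetic eliminates it. *)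
destruct (HAx x y Hxy) as [_ H1]; destruct (HAy x y Hxy) as [H2 _].
destruct (HBx x y Hxy) as [_ H3]; destruct (HBy x y Hxy) as [H4 _].
clear HAx HAy HBx HBy.
unfold curv11, curv12, curv21, curv22, g111, g112, g122, g211, g212, g222.
jets.
split; [|split]; lra.
Qed.

(** The eigenvector relation turns the two entries known in a chart into all four; the zero trace
    then normalises omega by alpha ^ omega = (6/5) Lambda. *)
Lemma curvature_form x y : O x y ->
  curv11 x y = 3 / 5 * La x y + B x y * w1 x y /\
  curv12 x y = B x y * w2 x y /\
  curv21 x y = - A x y * w1 x y /\
  curv22 x y = 3 / 5 * La x y - A x y * w2 x y /\
  A x y * w2 x y - B x y * w1 x y = 6 / 5 * La x y.
Proof.
intros Hxy.
destruct (curvature_annihilates_A x y Hxy) as (H1 & H2 & H3).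
destruct (chart_curv x y Hxy) as [(H0 & E1 & E2)|(H0 & E1 & E2)].
- rewrite E1 in H1, H3; rewrite E2 in H2.
  assert (E3 : curv21 x y = - A x y * w1 x y).
  { apply Rmult_eq_reg_l with (B x y); auto; lra. }
  assert (E4 : curv22 x y = 3 / 5 * La x y - A x y * w2 x y).
  { apply Rmult_eq_reg_l with (B x y); auto; lra. }
  repeat split; auto; lra.
- rewrite E1 in H1; rewrite E2 in H2, H3.
  assert (E3 : curv11 x y = 3 / 5 * La x y + B x y * w1 x y).
  { apply Rmult_eq_reg_l with (A x y); auto; lra. }
  assert (E4 : curv12 x y = B x y * w2 x y).
  { apply Rmult_eq_reg_l with (A x y); auto; lra. }
  repeat split; auto; lra.
Qed.

Let curv11E x y Hxy := proj1 (curvature_form x y Hxy).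
Let curv12E x y Hxy := proj1 (proj2 (curvature_form x y Hxy)).
Let curv21E x y Hxy := proj1 (proj2 (proj2 (curvature_form x y Hxy))).
Let curv22E x y Hxy := proj1 (proj2 (proj2 (proj2 (curvature_form x y Hxy)))).

Hypothesis chart_K : forall x y, O x y ->
  (B x y <> 0 /\ N x y * w2 x y + (dy La x y + f2 x y * La x y) = K x y * B x y) \/
  (A x y <> 0 /\ N x y * w1 x y + (dx La x y + f1 x y * La x y) = K x y * A x y).

(** Equality of the mixed partials of [N] makes the covector N omega_i + d_i Lambda + phi_i Lambda
    proportional to alpha; [K] is the factor, read off in either chart. *)
Lemma La_derivatives x y : O x y ->
  dx La x y = K x y * A x y - N x y * w1 x y - f1 x y * La x y /\
  dy La x y = K x y * B x y - N x y * w2 x y - f2 x y * La x y.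
Proof.
intros Hxy.
diff_eq HO eqNx HNx; diff_eq HO eqNy HNy.
destruct (HNx x y Hxy) as [_ H1]; destruct (HNy x y Hxy) as [H2 _]; clear HNx HNy.
destruct (curvature_form x y Hxy) as (_ & _ & _ & _ & H3).
jets.
assert (H4 : A x y * (dy La x y + f2 x y * La x y + N x y * w2 x y)
           = B x y * (dx La x y + f1 x y * La x y + N x y * w1 x y)).
{ replace (A x y * (dy La x y + f2 x y * La x y + N x y * w2 x y)) with
   (A x y * (dy La x y + f2 x y * La x y) + N x y * (A x y * w2 x y - B x y * w1 x y + B x y * w1
     x y))
   by ring.
  rewrite H3; lra. }
destruct (chart_K x y Hxy) as [(H0 & E)|(H0 & E)].
- split; [|lra].
  apply Rmult_eq_reg_l with (B x y); auto.
  replace (dy La x y + f2 x y * La x y + N x y * w2 x y) with (K x y * B x y) in H4 by lra.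
  lra.
- split; [lra|].
  apply Rmult_eq_reg_l with (A x y); auto.
  replace (dx La x y + f1 x y * La x y + N x y * w1 x y) with (K x y * A x y) in H4 by lra.
  lra.
Qed.

Let eqLax x y Hxy := proj1 (La_derivatives x y Hxy).
Let eqLay x y Hxy := proj2 (La_derivatives x y Hxy).

Hypothesis defZ : forall x y, O x y ->
  6 / 5 * La x y * Z x y =
  w2 x y * (- w1 x y) * (dx w2 x y + dy w1 x y) + w1 x y ^ 2 * dy w2 x y
  + w2 x y ^ 2 * dx w1 x y + P x y * w2 x y ^ 3 - 3 * Q x y * w2 x y ^ 2 * w1 x y
  + 3 * R' x y * w2 x y * w1 x y ^ 2 - S' x y * w1 x y ^ 3.

(* The divergence of the curvature is (A, B). *)
Lemma curvature_divergence x y : O x y ->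
  A x y * (1 - 3 / 5 * K x y) =
   B x y * (dx w1 x y - (g111 x y * w1 x y + g211 x y * w2 x y) - f1 x y * w1 x y)
   - A x y * (dy w1 x y - (g112 x y * w1 x y + g212 x y * w2 x y) - f2 x y * w1 x y)
   - 9 / 5 * N x y * w1 x y /\
  B x y * (1 - 3 / 5 * K x y) =
   B x y * (dx w2 x y - (g112 x y * w1 x y + g212 x y * w2 x y) - f1 x y * w2 x y)
   - A x y * (dy w2 x y - (g122 x y * w1 x y + g222 x y * w2 x y) - f2 x y * w2 x y)
   - 9 / 5 * N x y * w2 x y.
Proof.
intros Hxy.
assert (C11 := curv11E); assert (C12 := curv12E); assert (C21 := curv21E); assert (C22 := curv22E).
assert (V11 := C11 x y Hxy); assert (V12 := C12 x y Hxy).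
assert (V21 := C21 x y Hxy); assert (V22 := C22 x y Hxy).
unfold curv11, curv12, curv21, curv22, g111, g112, g122, g211, g212, g222 in C11, C12, C21, C22.
diff_eq HO C11 D11; diff_eq HO C12 D12; diff_eq HO C21 D21; diff_eq HO C22 D22.
diff_eq HO eqf Df.
destruct (D11 x y Hxy) as [E1 _]; destruct (D21 x y Hxy) as [_ E2].
destruct (D12 x y Hxy) as [E3 _]; destruct (D22 x y Hxy) as [_ E4].
destruct (Df x y Hxy) as [F1 F2].
assert (hA := defA x y Hxy); assert (hB := defB x y Hxy).
clear C11 C12 C21 C22 D11 D12 D21 D22 Df.
(* [l1] and [l2] are the x-derivative of rho^1_1 and the y-derivative of rho^2_1, as jets of the
   coefficients. In the weighted divergence the phi-term cancels Gamma^k_ki = -phi_i, so only the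
   contraction on the lower index of rho remains. *)
match type of E1 with ?l1 = _ => match type of E2 with ?l2 = _ =>
  assert (I1 : A x y = l1 + l2
    - (g111 x y * curv11 x y + g211 x y * curv12 x y
       + g112 x y * curv21 x y + g212 x y * curv22 x y))
end end.
{ rewrite hA; unfold curv11, curv12, curv21, curv22, g111, g112, g122, g211, g212, g222.
  rewrite ?eqf by assumption; rewrite ?F1, ?F2; field. }
match type of E3 with ?l1 = _ => match type of E4 with ?l2 = _ =>
  assert (I2 : B x y = l1 + l2
    - (g112 x y * curv11 x y + g212 x y * curv12 x y
       + g122 x y * curv21 x y + g222 x y * curv22 x y))
end end.
{ rewrite hB; unfold curv11, curv12, curv21, curv22, g111, g112, g122, g211, g212, g222.
  rewrite ?eqf by assumption; rewrite ?F1, ?F2; field. }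
rewrite E1, E2, V11, V12, V21, V22 in I1; rewrite E3, E4, V11, V12, V21, V22 in I2.
clear E1 E2 E3 E4 V11 V12 V21 V22 hA hB F1 F2.
rewrite ?eqLax, ?eqLay in * by assumption.
jets.
unfold g111, g112, g122, g211, g212, g222 in *.
split; lra.
Qed.

Lemma La_neq0_A_or_B x y : O x y -> A x y <> 0 \/ B x y <> 0.
Proof. intros Hxy; destruct (chart_curv x y Hxy) as [(H & _)|(H & _)]; auto. Qed.

Lemma al_cancel x y g : O x y -> A x y * g = 0 -> B x y * g = 0 -> g = 0.
Proof.
intros Hxy HA HB; apply Rmult_integral in HA; apply Rmult_integral in HB.
destruct (La_neq0_A_or_B x y Hxy); tauto.
Qed.

(* A form that is a multiple of al (x) al and vanishes on a vector on which al does not. *)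
Lemma tensor_vanishes a b u1 u2 t11 t12 t21 t22 :
  a <> 0 \/ b <> 0 -> a * u2 - b * u1 <> 0 ->
  a * t12 - b * t11 = 0 -> a * t22 - b * t21 = 0 ->
  b * t11 - a * t21 = 0 -> b * t12 - a * t22 = 0 ->
  u2 * (- u1) * (t12 + t21) + u1 ^ 2 * t22 + u2 ^ 2 * t11 = 0 ->
  t11 = 0 /\ t12 = 0 /\ t21 = 0 /\ t22 = 0.
Proof.
intros [H|H] Hu E1 E2 E3 E4 E5.
- assert (T12 : t12 = b / a * t11) by (apply Rmult_eq_reg_l with a; auto; field_simplify; auto;
    lra).
  assert (T21 : t21 = b / a * t11) by (apply Rmult_eq_reg_l with a; auto; field_simplify; auto;
    lra).
  assert (T22 : t22 = b / a * t21) by (apply Rmult_eq_reg_l with a; auto; field_simplify; auto;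
    lra).
  assert (T11 : t11 = 0).
  { rewrite T22, T12, T21 in E5.
    apply Rmult_eq_reg_l with ((a * u2 - b * u1) ^ 2); [|apply pow_nonzero; auto].
    rewrite Rmult_0_r, <- (Rmult_0_r (a ^ 2)), <- E5; field; auto. }
  rewrite T22, T12, T21, T11; repeat split; ring.
- assert (T12 : t12 = a / b * t22) by (apply Rmult_eq_reg_l with b; auto; field_simplify; auto;
    lra).
  assert (T21 : t21 = a / b * t22) by (apply Rmult_eq_reg_l with b; auto; field_simplify; auto;
    lra).
  assert (T11 : t11 = a / b * t21) by (apply Rmult_eq_reg_l with b; auto; field_simplify; auto;
    lra).
  assert (T22 : t22 = 0).
  { rewrite T11, T12, T21 in E5.
    apply Rmult_eq_reg_l with ((a * u2 - b * u1) ^ 2); [|apply pow_nonzero; auto].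
    rewrite Rmult_0_r, <- (Rmult_0_r (b ^ 2)), <- E5; field; auto. }
  rewrite T11, T12, T21, T22; repeat split; ring.
Qed.

(** The value of d_i omega_j, with [g1], [g2] for Gamma^1_ij, Gamma^2_ij: the weighted derivative
    (nabla_i - phi_i) omega_j is expanded in tensor products of alpha and omega. *)
Definition omega_deriv (g1 g2 fi al_i al_j om_i om_j : R) x y :=
  g1 * w1 x y + g2 * w2 x y + fi * om_j
  + (5 / 6 * Z x y * al_i * al_j + K x y * al_i * om_j
     + (K x y / 2 - 5 / 6) * om_i * al_j - 3 / 2 * N x y * om_i * om_j) / La x y.

(** The difference from the claimed values is killed by contraction with (B, -A) in j, by the
    derivatives of alpha ^ omega = (6/5) Lambda, and in i, by the divergence of the curvature. What
    is left is a multiple of alpha (x) alpha, and that is the component which the definition of [Z]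
    measures. *)
Lemma omega_derivatives x y : O x y ->
  dx w1 x y = omega_deriv (g111 x y) (g211 x y) (f1 x y) (A x y) (A x y) (w1 x y) (w1 x y) x y /\
  dx w2 x y = omega_deriv (g112 x y) (g212 x y) (f1 x y) (A x y) (B x y) (w1 x y) (w2 x y) x y /\
  dy w1 x y = omega_deriv (g112 x y) (g212 x y) (f2 x y) (B x y) (A x y) (w2 x y) (w1 x y) x y /\
  dy w2 x y = omega_deriv (g122 x y) (g222 x y) (f2 x y) (B x y) (B x y) (w2 x y) (w2 x y) x y.
Proof.
intros Hxy.
assert (C := fun x y H => proj2 (proj2 (proj2 (proj2 (curvature_form x y H))))).
cbv beta in C; assert (V := C x y Hxy).
diff_eq HO C DC; destruct (DC x y Hxy) as [E1 E2]; clear C DC.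
destruct (curvature_divergence x y Hxy) as [E3 E4].
assert (E5 := defZ x y Hxy).
rewrite ?eqLax, ?eqLay in * by assumption.
jets.
assert (L0 := La0 x y Hxy).
assert (U0 : A x y * w2 x y - B x y * w1 x y <> 0) by lra.
(* Replacing Lambda by its expression in alpha and omega leaves [field] no hidden relation. *)
assert (LV : La x y = 5 / 6 * (A x y * w2 x y - B x y * w1 x y)) by lra.
destruct (tensor_vanishes (A x y) (B x y) (w1 x y) (w2 x y)
  (dx w1 x y - omega_deriv (g111 x y) (g211 x y) (f1 x y) (A x y) (A x y) (w1 x y) (w1 x y) x y)
  (dx w2 x y - omega_deriv (g112 x y) (g212 x y) (f1 x y) (A x y) (B x y) (w1 x y) (w2 x y) x y)
  (dy w1 x y - omega_deriv (g112 x y) (g212 x y) (f2 x y) (B x y) (A x y) (w2 x y) (w1 x y) x y)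
  (dy w2 x y - omega_deriv (g122 x y) (g222 x y) (f2 x y) (B x y) (B x y) (w2 x y) (w2 x y) x y))
  as (T1 & T2 & T3 & T4); auto using La_neq0_A_or_B;
  try (repeat split; lra);
  unfold omega_deriv, g111, g112, g122, g211, g212, g222 in *.
- lincomb (diff E1) after (rewrite LV).
- lincomb (diff E2) after (rewrite LV).
- lincomb (- diff E3) after (rewrite LV).
- lincomb (- diff E4) after (rewrite LV).
- lincomb (- diff E5) after (rewrite LV).
Qed.

Let eqw1x x y Hxy := proj1 (omega_derivatives x y Hxy).
Let eqw2x x y Hxy := proj1 (proj2 (omega_derivatives x y Hxy)).
Let eqw1y x y Hxy := proj1 (proj2 (proj2 (omega_derivatives x y Hxy))).
Let eqw2y x y Hxy := proj2 (proj2 (proj2 (omega_derivatives x y Hxy))).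

Ltac all_jets :=
  rewrite ?eqLax, ?eqLay, ?eqw1x, ?eqw1y, ?eqw2x, ?eqw2y in * by assumption; jets;
  unfold omega_deriv, g111, g112, g122, g211, g212, g222 in *.

Lemma La_alt x y : O x y -> La x y = 5 / 6 * (A x y * w2 x y - B x y * w1 x y).
Proof. intros Hxy; destruct (curvature_form x y Hxy) as (_ & _ & _ & _ & H); lra. Qed.

Lemma al_w_neq0 x y : O x y -> A x y * w2 x y - B x y * w1 x y <> 0.
Proof. intros Hxy H; apply (La0 x y Hxy); rewrite La_alt, H by assumption; ring. Qed.

(** Equality of the mixed partials of Lambda; divided by N it reads a(K) = (9/5) K + 1 - (6/5) I. *)
Lemma K_along_al x y : O x y ->
  B x y * dx K x y - A x y * dy K x y
  = 9 / 5 * N x y * K x y + N x y - 6 / 5 * La x y ^ 2.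
Proof.
intros Hxy.
assert (Ex := eqLax); assert (Ey := eqLay).
diff_eq HO Ex D1; diff_eq HO Ey D2; clear Ex Ey.
destruct (D1 x y Hxy) as [_ E1]; destruct (D2 x y Hxy) as [E2 _]; clear D1 D2.
all_jets.
assert (LV := La_alt x y Hxy); assert (U0 := al_w_neq0 x y Hxy).
lincomb (diff E1 - diff E2) after (rewrite LV).
Qed.

Variable L : R -> R -> R.
Hypothesis SL : smooth_on O L.
Hypothesis defL : forall x y, O x y -> L x y = K x y + 5 / 9 + 2 * La x y ^ 2 / N x y.

(** In the derivative of [K] the shift by 5/9 absorbs the constant 1, and the shift by 2 I absorbs
    -(6/5) I because a(I) = (12/5) I. *)
Lemma L_along_al x y : O x y ->
  B x y * dx L x y - A x y * dy L x y = 9 / 5 * N x y * L x y.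
Proof.
intros Hxy.
assert (HK := K_along_al x y Hxy).
diff_eq HO defL DL; destruct (DL x y Hxy) as [E1 E2]; clear DL.
rewrite E1, E2, defL by assumption.
all_jets.
assert (LV := La_alt x y Hxy); assert (U0 := al_w_neq0 x y Hxy).
lincomb (diff HK) after (rewrite LV).
Qed.

(** The Ricci identity for omega: its two components are the same relation multiplied by [A] and by
    [B]. *)
Lemma Z_along_al x y : O x y ->
  B x y * dx Z x y - A x y * dy Z x y =
  24 / 5 * N x y * Z x y + 2 * Z x y * (B x y * f1 x y - A x y * f2 x y)
  - 3 / 5 * (w2 x y * dx L x y - w1 x y * dy L x y) + 27 / 25 * L x y ^ 2 - 18 / 5 * L x y
  - 36 / 25 * L x y * La x y ^ 2 / N x y + 28 / 5 * La x y ^ 2 / N x y + 8 / 3.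
Proof.
intros Hxy.
assert (HK := K_along_al x y Hxy).
diff_eq HO defL DL; destruct (DL x y Hxy) as [F1 F2]; clear DL.
rewrite F1, F2, defL by assumption; clear F1 F2.
assert (Ex := eqw1x); assert (Ey := eqw1y); assert (Ex2 := eqw2x); assert (Ey2 := eqw2y).
unfold omega_deriv, g111, g112, g122, g211, g212, g222 in *.
diff_eq HO Ex D1; diff_eq HO Ey D2; clear Ex Ey.
diff_eq HO Ex2 D3; diff_eq HO Ey2 D4; clear Ex2 Ey2.
destruct (D1 x y Hxy) as [_ E1]; destruct (D2 x y Hxy) as [E2 _]; clear D1 D2.
destruct (D3 x y Hxy) as [_ E3]; destruct (D4 x y Hxy) as [E4 _]; clear D3 D4.
assert (V11 := curv11E x y Hxy); assert (V12 := curv12E x y Hxy).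
assert (V21 := curv21E x y Hxy); assert (V22 := curv22E x y Hxy).
unfold curv11, curv12, curv21, curv22 in *.
all_jets.
assert (LV := La_alt x y Hxy); assert (U0 := al_w_neq0 x y Hxy).
assert (N1 := N0 x y Hxy).
apply Rminus_diag_uniq.
apply (al_cancel x y _ Hxy).
- lincomb (6 / 5 * La x y * ((diff E1 - diff E2) - w1 x y * diff V11 - w2 x y * diff V21)
     - 6 / 5 * w1 x y * diff HK) after (rewrite LV).
- lincomb (6 / 5 * La x y * ((diff E3 - diff E4) - w1 x y * diff V12 - w2 x y * diff V22)
     - 6 / 5 * w2 x y * diff HK) after (rewrite LV).
Qed.

Variable E : R -> R -> R.
Hypothesis SE : smooth_on O E.
Hypothesis defE : forall x y, O x y -> E x y =
  Z x y - (w2 x y * dx L x y - w1 x y * dy L x y) / N x y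
  + 9 * L x y ^ 2 / (5 * N x y) - 2 * L x y / N x y
  - 12 * L x y * La x y ^ 2 / (5 * N x y ^ 2) + 7 * La x y ^ 2 / (3 * N x y ^ 2)
  + 5 / (9 * N x y) + 63 * La x y ^ 4 / (20 * N x y ^ 3).

(** The terms added to [Z] in [E] cancel the inhomogeneous part of the derivative of [Z]. The
    derivative of w(L) along a is reached by differentiating [L_along_al]. *)
Lemma E_along_al x y : O x y ->
  B x y * dx E x y - A x y * dy E x y
  = 24 / 5 * N x y * E x y + 2 * E x y * (B x y * f1 x y - A x y * f2 x y).
Proof.
intros Hxy.
(* Rewritten so that every quotient by a function has the denominator [N] alone, which the division
   rule can discharge. *)
assert (dE : forall x y, O x y -> E x y =
  Z x y + (w1 x y * dy L x y - w2 x y * dx L x y + 9 / 5 * L x y ^ 2 - 2 * L x y + 5 / 9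
   + (7 / 3 * La x y ^ 2 - 12 / 5 * L x y * La x y ^ 2 + 63 / 20 * La x y ^ 4 / N x y) / N x y)
   / N x y).
{ intros x' y' H'; rewrite defE by assumption; field; auto. }
assert (HL := L_along_al); diff_eq HO HL DL.
destruct (DL x y Hxy) as [L1 L2]; clear DL; specialize (HL x y Hxy).
diff_eq HO dE DE; destruct (DE x y Hxy) as [E1 E2]; clear DE.
rewrite E1, E2, dE by assumption;
assert (HZ := Z_along_al x y Hxy).
assert (KL : K x y = L x y - 5 / 9 - 2 * La x y ^ 2 / N x y)
  by (rewrite defL by assumption; ring).
clear E1 E2 dE.
all_jets.
assert (LV := La_alt x y Hxy); assert (U0 := al_w_neq0 x y Hxy).
assert (N1 := N0 x y Hxy).
lincomb (diff HZ - (w2 x y * diff L1 - w1 x y * diff L2) / N x y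
  + diff HL * ((- (4 / 3 - 3 / 5 * L x y)
      + w2 x y * (- 2 * f1 x y - La x y * A x y / N x y)
      - w1 x y * (- 2 * f2 x y - La x y * B x y / N x y)
      + 18 / 5 * L x y - 2 - 12 / 5 * La x y ^ 2 / N x y) / N x y)) after (rewrite KL, LV).
Qed.

Definition inv1 (x y : R) : R := L x y ^ 8 * N x y ^ 6 / La x y ^ 12.
Definition inv2 (x y : R) : R := E x y * N x y ^ 3 / La x y ^ 4.

Lemma La_pow_neq0 n x y : O x y -> La x y ^ n <> 0.
Proof. intros Hxy; apply pow_nonzero; auto. Qed.

(** A common factor is split off, so that the vanishing of the derivative can be read from the
    bracket. *)
Lemma inv1_deriv u v x y : O x y ->
  u * dx inv1 x y + v * dy inv1 x y =
  (8 * (u * dx L x y + v * dy L x y) * N x y * La x y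
   + 6 * L x y * (u * dx N x y + v * dy N x y) * La x y
   - 12 * L x y * N x y * (u * dx La x y + v * dy La x y))
  * (L x y ^ 7 * N x y ^ 5 / La x y ^ 13).
Proof.
intros Hxy.
assert (Q0 := La_pow_neq0 12).
eval_pderiv Hxy inv1 ltac:(unfold inv1; pderiv_tac); field; auto.
Qed.

Lemma inv2_deriv u v x y : O x y ->
  u * dx inv2 x y + v * dy inv2 x y =
  ((u * dx E x y + v * dy E x y) * N x y * La x y
   + 3 * E x y * (u * dx N x y + v * dy N x y) * La x y
   - 4 * E x y * N x y * (u * dx La x y + v * dy La x y))
  * (N x y ^ 2 / La x y ^ 5).
Proof.
intros Hxy.
assert (Q0 := La_pow_neq0 4).
eval_pderiv Hxy inv2 ltac:(unfold inv2; pderiv_tac); field; auto.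
Qed.

Lemma invariants_along_al x y : O x y ->
  B x y * dx inv1 x y + - A x y * dy inv1 x y = 0 /\
  B x y * dx inv2 x y + - A x y * dy inv2 x y = 0.
Proof.
intros Hxy.
assert (HL := L_along_al x y Hxy); assert (HE := E_along_al x y Hxy).
rewrite inv1_deriv, inv2_deriv by assumption.
replace (B x y * dx L x y + - A x y * dy L x y) with (9 / 5 * N x y * L x y) by lra.
replace (B x y * dx E x y + - A x y * dy E x y)
  with (24 / 5 * N x y * E x y + 2 * E x y * (B x y * f1 x y - A x y * f2 x y)) by lra.
clear HL HE; all_jets.
assert (LV := La_alt x y Hxy); assert (U0 := al_w_neq0 x y Hxy).
split; rewrite LV; field; auto.
Qed.

(* (m a + (12/5) w) / I with a = (B, -A)/N, w = (w2, -w1), I = La^2/N,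
   m = 4/3 - 12/5 L + 18/5 I. *)
Definition field1 x y :=
  N x y / La x y ^ 2 * ((4 / 3 - 12 / 5 * L x y + 18 / 5 * La x y ^ 2 / N x y)
    * (B x y / N x y) + 12 / 5 * w2 x y).
Definition field2 x y :=
  N x y / La x y ^ 2 * ((4 / 3 - 12 / 5 * L x y + 18 / 5 * La x y ^ 2 / N x y)
    * (- A x y / N x y) - 12 / 5 * w1 x y).

(** * Consequences of invariance under a field *)

Section Symmetry.

Variables X Y : R -> R -> R.
Hypotheses (SX : smooth_on O X) (SY : smooth_on O Y).
Hypothesis det0 : forall x y, O x y -> lie0 P Q X Y x y = 0.
Hypothesis det1 : forall x y, O x y -> lie1 P Q R' X Y x y = 0.
Hypothesis det2 : forall x y, O x y -> lie2 Q R' S' X Y x y = 0.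
Hypothesis det3 : forall x y, O x y -> lie3 R' S' X Y x y = 0.

Lemma lie_alpha x y : O x y ->
  X x y * dx A x y + Y x y * dy A x y + dx X x y * A x y + dx Y x y * B x y
    + (dx X x y + dy Y x y) * A x y = 0 /\
  X x y * dx B x y + Y x y * dy B x y + dy X x y * A x y + dy Y x y * B x y
    + (dx X x y + dy Y x y) * B x y = 0.
Proof. apply (lie_AB O HO P Q R' S' X Y); assumption. Qed.

(* The Lie derivative of phi is the differential of the divergence. *)
Lemma lie_phi_N x y : O x y ->
  X x y * dx f1 x y + Y x y * dy f1 x y + dx X x y * f1 x y + dx Y x y * f2 x y
    = dx (dx X) x y + dy (dx Y) x y /\
  X x y * dx f2 x y + Y x y * dy f2 x y + dy X x y * f1 x y + dy Y x y * f2 x y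
    = dy (dx X) x y + dy (dy Y) x y /\
  X x y * dx N x y + Y x y * dy N x y = - 2 * (dx X x y + dy Y x y) * N x y.
Proof.
intros Hxy.
assert (EA := fun x y H => proj1 (lie_alpha x y H)).
assert (EB := fun x y H => proj2 (lie_alpha x y H)).
cbv beta in EA, EB.
diff_eq HO EA DA; diff_eq HO EB DB; specialize (EA x y Hxy); specialize (EB x y Hxy).
assert (Hx := eqAx); assert (Hx' := eqBx); assert (Hy := eqAy); assert (Hy' := eqBy).
diff_eq HO Hx D1; diff_eq HO Hx' D2; diff_eq HO Hy D3; diff_eq HO Hy' D4.
destruct (D1 x y Hxy) as [A1 A2]; destruct (D2 x y Hxy) as [B1 B2].
destruct (D3 x y Hxy) as [A4 A3]; destruct (D4 x y Hxy) as [B4 B3].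
destruct (DA x y Hxy) as [EAx EAy]; destruct (DB x y Hxy) as [EBx EBy].
clear DA DB D1 D2 D3 D4 Hx Hx' Hy Hy'.
rewrite A1, A2 in EAx; rewrite A4, A3 in EAy; rewrite B1, B2 in EBx; rewrite B4, B3 in EBy.
clear A1 A2 A3 A4 B1 B2 B3 B4.
assert (d0 := det0 x y Hxy); assert (d1 := det1 x y Hxy).
assert (d2 := det2 x y Hxy); assert (d3 := det3 x y Hxy).
unfold lie0, lie1, lie2, lie3 in *.
jets.
(* The Lie derivative of (nabla_i + phi_i) alpha_j = -(3/5) N eps_ij relates the defects [F1], [F2]
   of phi to the defect of [N]. The diagonal components give A F1 = 0 and B F2 = 0, the sum of the
   other two gives A F2 + B F1 = 0, and alpha is nonzero. *)
match goal with |- ?l1 = ?r1 /\ ?l2 = ?r2 /\ ?l3 = ?r3 =>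
  assert (G1 : A x y * (l1 - r1) = 0);
  [|assert (G2 : B x y * (l2 - r2) = 0);
  [|assert (G3 : 3 / 5 * (l3 - r3) = 4 / 3 * (A x y * (l2 - r2)) + 1 / 3 * (B x y * (l1 - r1)));
  [|assert (G4 : - (3 / 5) * (l3 - r3) = 1 / 3 * (A x y * (l2 - r2)) + 4 / 3 * (B x y * (l1 - r1)));
  [|set (F1 := l1 - r1) in *; set (F2 := l2 - r2) in *]]]]
end.
- lincomb (- (3 / 5) * (diff EAx - (Q x y - 5 / 3 * f1 x y) * diff EA + P x y * diff EB)
    - 1 / 5 * A x y * diff d1 + 3 / 5 * B x y * diff d0).
- lincomb (- (3 / 5) * (diff EBy - S' x y * diff EA + (R' x y + 5 / 3 * f2 x y) * diff EB)
    - 3 / 5 * A x y * diff d3 + 1 / 5 * B x y * diff d2).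
- lincomb (diff EAy - (R' x y - 4 / 3 * f2 x y) * diff EA + (Q x y + 1 / 3 * f1 x y) * diff EB
    + 1 / 3 * A x y * diff d2 - 1 / 3 * B x y * diff d1).
- lincomb (diff EBx - (R' x y - 1 / 3 * f2 x y) * diff EA + (Q x y + 4 / 3 * f1 x y) * diff EB
    + 1 / 3 * A x y * diff d2 - 1 / 3 * B x y * diff d1).
- assert (G5 : A x y * F2 + B x y * F1 = 0) by lra.
  assert (H : F1 = 0 /\ F2 = 0).
  { apply Rmult_integral in G1; apply Rmult_integral in G2.
    destruct (La_neq0_A_or_B x y Hxy) as [H|H].
    - destruct G1 as [|G1]; [contradiction|]; split; [exact G1|].
      apply Rmult_eq_reg_l with (A x y); [rewrite G1 in G5; lra|exact H].
    - destruct G2 as [|G2]; [contradiction|]; split; [|exact G2].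
      apply Rmult_eq_reg_l with (B x y); [rewrite G2 in G5; lra|exact H]. }
  destruct H as [H1 H2]; rewrite H1, H2 in G3.
  unfold F1 in H1; unfold F2 in H2; repeat split; lra.
Qed.

(** In the Lie derivative of (d_i + 2 phi_i) N = -Lambda alpha_i only alpha_i times the defect of
    Lambda survives. *)
Lemma lie_La x y : O x y ->
  X x y * dx La x y + Y x y * dy La x y = - (dx X x y + dy Y x y) * La x y.
Proof.
intros Hxy.
destruct (lie_alpha x y Hxy) as [EA EB]; destruct (lie_phi_N x y Hxy) as (F1 & F2 & _).
assert (EN := fun x y H => proj2 (proj2 (lie_phi_N x y H))); cbv beta in EN.
diff_eq HO EN DN; destruct (DN x y Hxy) as [ENx ENy]; specialize (EN x y Hxy); clear DN.
assert (Hx := eqNx); assert (Hy := eqNy); diff_eq HO Hx D1; diff_eq HO Hy D2.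
destruct (D1 x y Hxy) as [N1 N2]; destruct (D2 x y Hxy) as [N3 N4]; clear D1 D2 Hx Hy.
rewrite N1, N2 in ENx; rewrite N3, N4 in ENy; clear N1 N2 N3 N4.
jets.
apply Rminus_diag_uniq.
apply (al_cancel x y _ Hxy).
- lincomb (- (diff ENx + 2 * f1 x y * diff EN + 2 * N x y * diff F1 + La x y * diff EA)).
- lincomb (- (diff ENy + 2 * f2 x y * diff EN + 2 * N x y * diff F2 + La x y * diff EB)).
Qed.

Definition lie_f1 x y :=
  X x y * dx f1 x y + Y x y * dy f1 x y + dx X x y * f1 x y + dx Y x y * f2 x y.
Definition lie_f2 x y :=
  X x y * dx f2 x y + Y x y * dy f2 x y + dy X x y * f1 x y + dy Y x y * f2 x y.

(* The Lie derivative of the connection. *)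
Definition lieG111 x y := dx (dx X) x y + (X x y * dx Q x y + Y x y * dy Q x y)
  + dx X x y * Q x y + dy X x y * P x y + 2 * dx Y x y * R' x y - 2 / 3 * lie_f1 x y.
Definition lieG112 x y := dy (dx X) x y + (X x y * dx R' x y + Y x y * dy R' x y)
  + dx Y x y * S' x y + 2 * dy X x y * Q x y + dy Y x y * R' x y - 1 / 3 * lie_f2 x y.
Definition lieG122 x y := dy (dy X) x y + (X x y * dx S' x y + Y x y * dy S' x y)
  - dx X x y * S' x y + 3 * dy X x y * R' x y + 2 * dy Y x y * S' x y.
Definition lieG211 x y := dx (dx Y) x y - (X x y * dx P x y + Y x y * dy P x y)
  - 3 * dx Y x y * Q x y + dy Y x y * P x y - 2 * dx X x y * P x y.
Definition lieG212 x y := dy (dx Y) x y - (X x y * dx Q x y + Y x y * dy Q x y)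
  - 2 * dx Y x y * R' x y - dx X x y * Q x y - dy X x y * P x y - 1 / 3 * lie_f1 x y.
Definition lieG222 x y := dy (dy Y) x y - (X x y * dx R' x y + Y x y * dy R' x y)
  - dx Y x y * S' x y - dy Y x y * R' x y - 2 * dy X x y * Q x y - 2 / 3 * lie_f2 x y.

(** The connection is fixed by its projective class and its trace -phi_i. The class is invariant by
    hypothesis; the Lie derivative of the trace is the gradient of the divergence minus the Lie
    derivative of phi, which is zero. *)
Lemma lie_connection x y : O x y ->
  lieG111 x y = 0 /\ lieG112 x y = 0 /\ lieG122 x y = 0 /\
  lieG211 x y = 0 /\ lieG212 x y = 0 /\ lieG222 x y = 0.
Proof.
intros Hxy.
destruct (lie_phi_N x y Hxy) as (F1 & F2 & _).
fold (lie_f1 x y) in F1; fold (lie_f2 x y) in F2.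
assert (d0 := det0 x y Hxy); assert (d1 := det1 x y Hxy).
assert (d2 := det2 x y Hxy); assert (d3 := det3 x y Hxy).
unfold lie0, lie1, lie2, lie3 in *.
unfold lieG111, lieG112, lieG122, lieG211, lieG212, lieG222.
repeat split; lra.
Qed.

Ltac unfold_curv :=
  unfold curv11, curv12, curv21, curv22, g111, g112, g122, g211, g212, g222,
    lieG111, lieG112, lieG122, lieG211, lieG212, lieG222, lie_f1, lie_f2 in *.

(** The Lie derivative of the curvature is the exterior covariant derivative of that of the
    connection, which vanishes. The divergence enters because rho is the coefficient of a
    two-form. *)
Lemma lie_curvature x y : O x y ->
  X x y * dx curv11 x y + Y x y * dy curv11 x y - dy X x y * curv21 x y + dx Y x y * curv12 x y
    + (dx X x y + dy Y x y) * curv11 x y = 0 /\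
  X x y * dx curv12 x y + Y x y * dy curv12 x y - dx X x y * curv12 x y + dy X x y * curv11 x y -
    dy X x y * curv22 x y + dy Y x y * curv12 x y
    + (dx X x y + dy Y x y) * curv12 x y = 0 /\
  X x y * dx curv21 x y + Y x y * dy curv21 x y - dx Y x y * curv11 x y + dx X x y * curv21 x y -
    dy Y x y * curv21 x y + dx Y x y * curv22 x y
    + (dx X x y + dy Y x y) * curv21 x y = 0 /\
  X x y * dx curv22 x y + Y x y * dy curv22 x y - dx Y x y * curv12 x y + dy X x y * curv21 x y
    + (dx X x y + dy Y x y) * curv22 x y = 0.
Proof.
intros Hxy.
assert (l111 := fun x y H => proj1 (lie_connection x y H)).
assert (l112 := fun x y H => proj1 (proj2 (lie_connection x y H))).
assert (l122 := fun x y H => proj1 (proj2 (proj2 (lie_connection x y H)))).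
assert (l211 := fun x y H => proj1 (proj2 (proj2 (proj2 (lie_connection x y H))))).
assert (l212 := fun x y H => proj1 (proj2 (proj2 (proj2 (proj2 (lie_connection x y H)))))).
assert (l222 := fun x y H => proj2 (proj2 (proj2 (proj2 (proj2 (lie_connection x y H)))))).
cbv beta in *.
assert (h111 := l111 x y Hxy); assert (h112 := l112 x y Hxy); assert (h122 := l122 x y Hxy).
assert (h211 := l211 x y Hxy); assert (h212 := l212 x y Hxy); assert (h222 := l222 x y Hxy).
unfold lieG111, lieG112, lieG122, lieG211, lieG212, lieG222, lie_f1, lie_f2 in l111, l112, l122,
  l211, l212, l222.
diff_eq HO l111 D111; diff_eq HO l112 D112; diff_eq HO l122 D122.
diff_eq HO l211 D211; diff_eq HO l212 D212; diff_eq HO l222 D222.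
destruct (D111 x y Hxy) as [_ E111]; destruct (D112 x y Hxy) as [E112x E112y].
destruct (D122 x y Hxy) as [E122 _].
destruct (D211 x y Hxy) as [_ E211]; destruct (D212 x y Hxy) as [E212x E212y].
destruct (D222 x y Hxy) as [E222 _].
clear D111 D112 D122 D211 D212 D222 l111 l112 l122 l211 l212 l222.
split; [|split; [|split]].
- eval_pderiv Hxy curv11 ltac:(unfold curv11, g111, g112, g122, g211, g212, g222; pderiv_tac).
  lincomb (diff E112x - diff E111
    + g112 x y * diff h212 - g211 x y * diff h122 - g122 x y * diff h211 + g212 x y * diff h112)
        after unfold_curv.
- eval_pderiv Hxy curv12 ltac:(unfold curv12, g111, g112, g122, g211, g212, g222; pderiv_tac).
  lincomb (diff E122 - diff E112y
    + g111 x y * diff h122 - 2 * g112 x y * diff h112 + g122 x y * diff h111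
    + g112 x y * diff h222 - g212 x y * diff h122 - g122 x y * diff h212 + g222 x y * diff h112)
        after unfold_curv.
- eval_pderiv Hxy curv21 ltac:(unfold curv21, g111, g112, g122, g211, g212, g222; pderiv_tac).
  lincomb (diff E212x - diff E211
    + g211 x y * diff h112 - g111 x y * diff h212 - g212 x y * diff h111 + g112 x y * diff h211
    + 2 * g212 x y * diff h212 - g211 x y * diff h222 - g222 x y * diff h211) after unfold_curv.
- eval_pderiv Hxy curv22 ltac:(unfold curv22, g111, g112, g122, g211, g212, g222; pderiv_tac).
  lincomb (diff E222 - diff E212y
    + g211 x y * diff h122 - g112 x y * diff h212 - g212 x y * diff h112 + g122 x y * diff h211)
        after unfold_curv.
Qed.

(** In rho = (3/5) Lambda Id + (B, -A) (x) omega everything but omega is already known to be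
    preserved; a nonzero component of alpha is cancelled. *)
Lemma lie_omega x y : O x y ->
  X x y * dx w1 x y + Y x y * dy w1 x y + dx X x y * w1 x y + dx Y x y * w2 x y
    = (dx X x y + dy Y x y) * w1 x y /\
  X x y * dx w2 x y + Y x y * dy w2 x y + dy X x y * w1 x y + dy Y x y * w2 x y
    = (dx X x y + dy Y x y) * w2 x y.
Proof.
intros Hxy.
destruct (lie_curvature x y Hxy) as (L11 & L12 & L21 & L22).
destruct (lie_alpha x y Hxy) as [EA EB]; assert (EL := lie_La x y Hxy).
revert L11 L12 L21 L22.
eval_pderiv Hxy curv11 ltac:(pderiv_by curv11E); eval_pderiv Hxy curv12 ltac:(pderiv_by curv12E).
eval_pderiv Hxy curv21 ltac:(pderiv_by curv21E); eval_pderiv Hxy curv22 ltac:(pderiv_by curv22E).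
rewrite ?curv11E, ?curv12E, ?curv21E, ?curv22E by assumption; intros L11 L12 L21 L22.
split; apply Rminus_diag_uniq, (al_cancel x y _ Hxy).
- lincomb (- diff L21 - w1 x y * diff EA).
- lincomb (diff L11 - 3 / 5 * diff EL - w1 x y * diff EB).
- lincomb (- diff L22 + 3 / 5 * diff EL - w2 x y * diff EA).
- lincomb (diff L12 - w2 x y * diff EB).
Qed.

(** Differentiating the invariance of Lambda in x and in y gives alpha_i X(K) = 0; the other
    ingredients of [L] are known. *)
Lemma lie_L x y : O x y -> X x y * dx L x y + Y x y * dy L x y = 0.
Proof.
intros Hxy.
destruct (lie_alpha x y Hxy) as [EA EB]; destruct (lie_phi_N x y Hxy) as (F1 & F2 & EN).
destruct (lie_omega x y Hxy) as (E1 & E2).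
assert (EL := lie_La); diff_eq HO EL DL; destruct (DL x y Hxy) as [ELx ELy].
specialize (EL x y Hxy); clear DL.
assert (Hx := eqLax); assert (Hy := eqLay); diff_eq HO Hx D1; diff_eq HO Hy D2.
destruct (D1 x y Hxy) as [N1 N2]; destruct (D2 x y Hxy) as [N3 N4]; clear D1 D2 Hx Hy.
rewrite N1, N2 in ELx; rewrite N3, N4 in ELy; clear N1 N2 N3 N4.
rewrite ?eqLax, ?eqLay in EL, ELx, ELy by assumption.
rewrite ?eqLax, ?eqLay in * by assumption.
assert (HK : X x y * dx K x y + Y x y * dy K x y = 0).
{ apply (al_cancel x y _ Hxy).
  - lincomb (diff ELx - K x y * diff EA + N x y * diff E1 + w1 x y * diff EN
      + f1 x y * diff EL + La x y * diff F1).
  - lincomb (diff ELy - K x y * diff EB + N x y * diff E2 + w2 x y * diff EN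
      + f2 x y * diff EL + La x y * diff F2). }
assert (EL' := lie_La x y Hxy).
diff_eq HO defL DL; destruct (DL x y Hxy) as [G1 G2]; clear DL.
rewrite G1, G2.
assert (N1 := N0 x y Hxy).
lincomb (diff HK + 4 * La x y * diff EL' / N x y - 2 * La x y ^ 2 / N x y ^ 2 * diff EN).
Qed.

Lemma dx_opp f x y : dx (fun x y => - f x y) x y = - dx f x y.
Proof. apply (Derive_opp (fun z => f z y)). Qed.

Lemma dy_opp f x y : dy (fun x y => - f x y) x y = - dy f x y.
Proof. apply (Derive_opp (fun z => f x z)). Qed.

(** omega has weight -1, so turning its index with the area element yields a true vector field, and
    invariance becomes commutation. *)
Lemma commutes_omega : commutes O X Y w2 (fun x y => - w1 x y).
Proof.
split; intros x y Hxy; destruct (lie_omega x y Hxy) as (E1 & E2); [lra|].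
rewrite dx_opp, dy_opp; lra.
Qed.

Lemma theta_omega x y : O x y ->
  theta P Q R' S' w2 (fun x y => - w1 x y) x y = - (6 / 5) * La x y * Z x y.
Proof.
intros Hxy; assert (HZ := defZ x y Hxy); unfold theta.
rewrite dx_opp, dy_opp; lra.
Qed.

(** Up to the factor -(6/5) Lambda, [Z] is [theta] of w, to which [theta_lie] applies. *)
Lemma lie_Z x y : O x y ->
  X x y * dx Z x y + Y x y * dy Z x y = 2 * (dx X x y + dy Y x y) * Z x y.
Proof.
intros Hxy.
assert (T := theta_lie O HO P Q R' S' X Y SP SQ SR SS SX SY w2 _ Sw2
  (smooth_on_opp O HO _ Sw1) commutes_omega x y Hxy).
rewrite det0, det1, det2, det3, theta_omega in T by assumption.
revert T; eval_pderiv Hxy (theta P Q R' S' w2 (fun x y => - w1 x y)) ltac:(pderiv_by theta_omega).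
intros T.
assert (EL := lie_La x y Hxy).
apply Rminus_diag_uniq, Rmult_eq_reg_l with (La x y); [|auto].
lincomb (- (5 / 6) * diff T - Z x y * diff EL).
Qed.

Lemma lie_E x y : O x y ->
  X x y * dx E x y + Y x y * dy E x y = 2 * (dx X x y + dy Y x y) * E x y.
Proof.
intros Hxy.
destruct (lie_phi_N x y Hxy) as (_ & _ & EN).
destruct (lie_omega x y Hxy) as (E1 & E2).
assert (EL := lie_La x y Hxy); assert (EZ := lie_Z x y Hxy).
assert (HL := lie_L); diff_eq HO HL DL; destruct (DL x y Hxy) as [HLx HLy].
specialize (HL x y Hxy); clear DL.
assert (dE : forall x y, O x y -> E x y =
  Z x y + (w1 x y * dy L x y - w2 x y * dx L x y + 9 / 5 * L x y ^ 2 - 2 * L x y + 5 / 9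
   + (7 / 3 * La x y ^ 2 - 12 / 5 * L x y * La x y ^ 2 + 63 / 20 * La x y ^ 4 / N x y) / N x y)
   / N x y).
{ intros x' y' H'; rewrite defE by assumption; field; auto. }
diff_eq HO dE DE; destruct (DE x y Hxy) as [G1 G2]; clear DE.
rewrite G1, G2, dE by assumption; clear G1 G2 dE.
assert (N1 := N0 x y Hxy).
lincomb (diff EZ + ((w1 x y * diff HLy - w2 x y * diff HLx + dy L x y * diff E1 - dx L x y * diff
  E2)
  + (18 / 5 * L x y - 2 - 12 / 5 * La x y ^ 2 / N x y) * diff HL
  + (14 / 3 * La x y - 24 / 5 * L x y * La x y + 63 / 5 * La x y ^ 3 / N x y) / N x y * diff EL
  - (w1 x y * dy L x y - w2 x y * dx L x y + 9 / 5 * L x y ^ 2 - 2 * L x y + 5 / 9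
     + 2 * (7 / 3 * La x y ^ 2 - 12 / 5 * L x y * La x y ^ 2) / N x y
     + 3 * (63 / 20 * La x y ^ 4 / N x y) / N x y) / N x y * diff EN) / N x y).
Qed.

Lemma invariants_along_symmetry x y : O x y ->
  X x y * dx inv1 x y + Y x y * dy inv1 x y = 0 /\
  X x y * dx inv2 x y + Y x y * dy inv2 x y = 0.
Proof.
intros Hxy; destruct (lie_phi_N x y Hxy) as (_ & _ & EN).
rewrite inv1_deriv, inv2_deriv, lie_L, lie_E, lie_La, EN by assumption.
split; ring.
Qed.

(** The constant is the inverse of (12/5)(6/5): the canonical field satisfies alpha(V) = (72/25)
    N/Lambda, so the factor of a multiple of V is read off from its pairing with alpha. *)
Definition multiplier x y := 25 / 72 * (A x y * X x y + B x y * Y x y) * La x y / N x y.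

(** The form (Lambda/N) alpha is closed and invariant, so by Cartan's formula its value on X has
    zero differential. *)
Lemma multiplier_constant x y : O x y -> dx multiplier x y = 0 /\ dy multiplier x y = 0.
Proof.
intros Hxy.
eval_pderiv Hxy multiplier ltac:(unfold multiplier; pderiv_tac).
destruct (lie_alpha x y Hxy) as [EA EB]; destruct (lie_phi_N x y Hxy) as (_ & _ & EN).
assert (EL := lie_La x y Hxy); all_jets.
assert (N1 := N0 x y Hxy); assert (LV := La_alt x y Hxy).
split.
- lincomb (25 / 72 * (diff EA * La x y / N x y + A x y / N x y * diff EL
    - A x y * La x y / N x y ^ 2 * diff EN)) after (rewrite LV).
- lincomb (25 / 72 * (diff EB * La x y / N x y + B x y / N x y * diff EL
    - B x y * La x y / N x y ^ 2 * diff EN)) after (rewrite LV).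
Qed.

(** X annihilates I, as V does, so both are tangent to its level curves; their pairings with alpha
    give the factor. *)
Lemma symmetry_multiple x y : O x y ->
  X x y = multiplier x y * field1 x y /\ Y x y = multiplier x y * field2 x y.
Proof.
intros Hxy.
destruct (lie_phi_N x y Hxy) as (_ & _ & EN); assert (EL := lie_La x y Hxy).
unfold multiplier, field1, field2.
assert (KL : K x y = L x y - 5 / 9 - 2 * La x y ^ 2 / N x y)
  by (rewrite defL by assumption; ring).
all_jets.
assert (N1 := N0 x y Hxy); assert (La1 := La0 x y Hxy).
assert (LV := La_alt x y Hxy); assert (U0 := al_w_neq0 x y Hxy).
split.
- lincomb (5 / 6 * B x y / (La x y * N x y) * (diff EL - La x y / (2 * N x y) * diff EN))
    after (rewrite KL, LV).
- lincomb (- (5 / 6) * A x y / (La x y * N x y) * (diff EL - La x y / (2 * N x y) * diff EN))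
    after (rewrite KL, LV).
Qed.
End Symmetry.

Lemma K_of_L x y : O x y -> K x y = L x y - 5 / 9 - 2 * La x y ^ 2 / N x y.
Proof. intros; rewrite defL by assumption; ring. Qed.

(** * Equations with constant invariants *)

Section Converse.

Variables (c c1 c2 : R) (X Y : R -> R -> R).
Hypotheses (SX : smooth_on O X) (SY : smooth_on O Y).
Hypothesis hX : forall x y, O x y -> X x y = c * field1 x y.
Hypothesis hY : forall x y, O x y -> Y x y = c * field2 x y.
Hypothesis hI1 : forall x y, O x y -> inv1 x y = c1.
Hypothesis hI2 : forall x y, O x y -> inv2 x y = c2.

(** Constancy of I_1 means L^8 = c1 I^6. If [L] vanishes at one point then c1 = 0 and [L] vanishes
    on all of [O]; otherwise the factor L^7 can be divided out. *)
Lemma L_derivatives x y : O x y ->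
  dx L x y = L x y * (3 / 2 * dx La x y / La x y - 3 / 4 * dx N x y / N x y) /\
  dy L x y = L x y * (3 / 2 * dy La x y / La x y - 3 / 4 * dy N x y / N x y).
Proof.
intros Hxy.
assert (N1 := N0 x y Hxy); assert (La1 := La0 x y Hxy).
destruct (Req_dec (L x y) 0) as [L0|L0].
- assert (HL : forall x' y', O x' y' -> L x' y' = 0).
  { intros x' y' H'.
    assert (C1 : c1 = 0) by (rewrite <- (hI1 x y Hxy); unfold inv1; rewrite L0; field; auto).
    assert (C2 := hI1 x' y' H'); rewrite C1 in C2; unfold inv1 in C2.
    assert (N2 := N0 x' y' H'); assert (La2 := La0 x' y' H').
    destruct (Req_dec (L x' y') 0) as [E'|E']; [assumption|exfalso].
    revert C2; neq0. }
  diff_eq HO HL DL; destruct (DL x y Hxy) as [E1 E2].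
  rewrite E1, E2, L0; split; ring.
- assert (H : dx inv1 x y = 0 /\ dy inv1 x y = 0)
    by (eval_pderiv Hxy inv1 ltac:(pderiv_by hI1); auto).
  destruct H as [H1 H2].
  assert (D1 := inv1_deriv 1 0 x y Hxy); assert (D2 := inv1_deriv 0 1 x y Hxy).
  rewrite H1, H2 in D1, D2.
  assert (Q0 : L x y ^ 7 * N x y ^ 5 / La x y ^ 13 <> 0) by neq0.
  rewrite Rmult_0_r, Rmult_0_r, Rplus_0_r in D1, D2.
  symmetry in D1, D2; apply Rmult_integral in D1; apply Rmult_integral in D2.
  destruct D1 as [D1|D1]; [|contradiction]; destruct D2 as [D2|D2]; [|contradiction].
  split; apply Rminus_diag_uniq.
  + lincomb (diff D1 / (8 * N x y * La x y)).
  + lincomb (diff D2 / (8 * N x y * La x y)).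
Qed.

Let eqLx x y Hxy := proj1 (L_derivatives x y Hxy).
Let eqLy x y Hxy := proj2 (L_derivatives x y Hxy).

Ltac converse_field :=
  rewrite ?eqLx, ?eqLy by assumption; all_jets;
  rewrite ?K_of_L, ?La_alt by assumption; field; auto using al_w_neq0.

Lemma field_derivs x y : O x y ->
  dx X x y = c * (((4 / 3 - 12 / 5 * L x y) * B x y + 12 / 5 * N x y * w2 x y) / La x y / La x y
     * (-2 * dx La x y / La x y)
   + (- (12 / 5) * dx L x y * B x y + (4 / 3 - 12 / 5 * L x y) * dx B x y
      + 12 / 5 * (dx N x y * w2 x y + N x y * dx w2 x y)) / La x y / La x y
   + 18 / 5 * (dx B x y / N x y - B x y * dx N x y / N x y / N x y)) /\
  dy X x y = c * (((4 / 3 - 12 / 5 * L x y) * B x y + 12 / 5 * N x y * w2 x y) / La x y / La x y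
     * (-2 * dy La x y / La x y)
   + (- (12 / 5) * dy L x y * B x y + (4 / 3 - 12 / 5 * L x y) * dy B x y
      + 12 / 5 * (dy N x y * w2 x y + N x y * dy w2 x y)) / La x y / La x y
   + 18 / 5 * (dy B x y / N x y - B x y * dy N x y / N x y / N x y)) /\
  dx Y x y = - c * (((4 / 3 - 12 / 5 * L x y) * A x y + 12 / 5 * N x y * w1 x y) / La x y / La x y
     * (-2 * dx La x y / La x y)
   + (- (12 / 5) * dx L x y * A x y + (4 / 3 - 12 / 5 * L x y) * dx A x y
      + 12 / 5 * (dx N x y * w1 x y + N x y * dx w1 x y)) / La x y / La x y
   + 18 / 5 * (dx A x y / N x y - A x y * dx N x y / N x y / N x y)) /\
  dy Y x y = - c * (((4 / 3 - 12 / 5 * L x y) * A x y + 12 / 5 * N x y * w1 x y) / La x y / La x y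
     * (-2 * dy La x y / La x y)
   + (- (12 / 5) * dy L x y * A x y + (4 / 3 - 12 / 5 * L x y) * dy A x y
      + 12 / 5 * (dy N x y * w1 x y + N x y * dy w1 x y)) / La x y / La x y
   + 18 / 5 * (dy A x y / N x y - A x y * dy N x y / N x y / N x y)).
Proof.
intros Hxy.
(* Only [La] and [N] occur as denominators, as the division rule requires. *)
assert (HX : forall x y, O x y -> X x y =
  c * (((4 / 3 - 12 / 5 * L x y) * B x y + 12 / 5 * (N x y * w2 x y)) / La x y / La x y
       + 18 / 5 * (B x y / N x y))).
{ intros x' y' H'; rewrite hX by assumption; unfold field1; field; auto. }
assert (HY : forall x y, O x y -> Y x y =
  - c * (((4 / 3 - 12 / 5 * L x y) * A x y + 12 / 5 * (N x y * w1 x y)) / La x y / La x y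
       + 18 / 5 * (A x y / N x y))).
{ intros x' y' H'; rewrite hY by assumption; unfold field2; field; auto. }
diff_eq HO HX DX; diff_eq HO HY DY.
destruct (DX x y Hxy) as [E1 E2]; destruct (DY x y Hxy) as [E3 E4].
rewrite E1, E2, E3, E4.
repeat split; field; auto.
Qed.

Let eqXx x y Hxy := proj1 (field_derivs x y Hxy).
Let eqXy x y Hxy := proj1 (proj2 (field_derivs x y Hxy)).
Let eqYx x y Hxy := proj1 (proj2 (proj2 (field_derivs x y Hxy))).
Let eqYy x y Hxy := proj2 (proj2 (proj2 (field_derivs x y Hxy))).

(** The field l a + m w with constant coefficients; for suitable l and m it takes any prescribed
    value at a given point. *)
Definition frame1 l m x y := l * (B x y / N x y) + m * w2 x y.
Definition frame2 l m x y := - (l * (A x y / N x y) + m * w1 x y).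

Lemma frame_deriv l m x y : O x y ->
  dx (frame1 l m) x y = l * (dx B x y / N x y - B x y * dx N x y / N x y / N x y) + m * dx w2 x y /\
  dy (frame1 l m) x y = l * (dy B x y / N x y - B x y * dy N x y / N x y / N x y) + m * dy w2 x y /\
  dx (frame2 l m) x y = - (l * (dx A x y / N x y - A x y * dx N x y / N x y / N x y) + m * dx w1
    x y) /\
  dy (frame2 l m) x y = - (l * (dy A x y / N x y - A x y * dy N x y / N x y / N x y) + m * dy w1
    x y).
Proof.
intros Hxy.
split; [|split; [|split]].
1, 2: eval_pderiv Hxy (frame1 l m) ltac:(unfold frame1; pderiv_tac).
3, 4: eval_pderiv Hxy (frame2 l m) ltac:(unfold frame2; pderiv_tac).
all: field; auto.
Qed.

Lemma frame_commutes l m : commutes O X Y (frame1 l m) (frame2 l m).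
Proof.
split; intros x y Hxy; destruct (frame_deriv l m x y Hxy) as (E1 & E2 & E3 & E4);
  assert (N1 := N0 x y Hxy).
- rewrite E1, E2, eqXx, eqXy, hX, hY by assumption.
  unfold frame1, frame2, field1, field2; converse_field.
- rewrite E3, E4, eqYx, eqYy, hX, hY by assumption.
  unfold frame1, frame2, field1, field2; converse_field.
Qed.

(** The definition of [E] solved for [Z]: constancy of I_2 gives E N = c2 I^2, and constancy of I_1
    gives w(L) = -(3/4) m L. *)
Lemma NZ_formula x y : O x y ->
  N x y * Z x y =
  c2 * (La x y ^ 2 / N x y) ^ 2
  - 3 / 4 * L x y * (4 / 3 - 12 / 5 * L x y + 18 / 5 * (La x y ^ 2 / N x y))
  - 9 / 5 * L x y ^ 2 + 2 * L x y + 12 / 5 * L x y * (La x y ^ 2 / N x y)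
  - 7 / 3 * (La x y ^ 2 / N x y) - 5 / 9 - 63 / 20 * (La x y ^ 2 / N x y) ^ 2.
Proof.
intros Hxy; assert (N1 := N0 x y Hxy); assert (La1 := La0 x y Hxy).
assert (HW : w2 x y * dx L x y - w1 x y * dy L x y
  = - (3 / 4) * L x y * (4 / 3 - 12 / 5 * L x y + 18 / 5 * (La x y ^ 2 / N x y))).
{ converse_field. }
assert (HE := defE x y Hxy); rewrite HW in HE.
rewrite <- (hI2 x y Hxy); unfold inv2; rewrite HE; field; auto.
Qed.

(** The value is the area (6/5) Lambda/N spanned by a and w, times a function of I and [L]. The
    absence of l^3 reflects that the integral curves of a satisfy the equation. *)
Lemma theta_frame l m x y : O x y ->
  theta P Q R' S' (frame1 l m) (frame2 l m) x y =
  6 / 5 * (La x y / N x y) *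
   (9 / 5 * l ^ 2 * m
    + l * m ^ 2 * (9 / 5 * L x y - 24 / 5 * (La x y ^ 2 / N x y) - 2)
    - m ^ 3 * (c2 * (La x y ^ 2 / N x y) ^ 2
  - 3 / 4 * L x y * (4 / 3 - 12 / 5 * L x y + 18 / 5 * (La x y ^ 2 / N x y))
  - 9 / 5 * L x y ^ 2 + 2 * L x y + 12 / 5 * L x y * (La x y ^ 2 / N x y)
  - 7 / 3 * (La x y ^ 2 / N x y) - 5 / 9 - 63 / 20 * (La x y ^ 2 / N x y) ^ 2)).
Proof.
intros Hxy; assert (N1 := N0 x y Hxy); assert (La1 := La0 x y Hxy).
rewrite <- NZ_formula by assumption.
unfold theta; destruct (frame_deriv l m x y Hxy) as (E1 & E2 & E3 & E4).
rewrite E1, E2, E3, E4; unfold frame1, frame2.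
all_jets; rewrite K_of_L, La_alt by assumption; field; auto using al_w_neq0.
Qed.

Lemma smooth_frame l m : smooth_on O (frame1 l m) /\ smooth_on O (frame2 l m).
Proof.
assert (H : forall f, smooth_on O f -> smooth_on O (fun x y => f x y / N x y))
  by (intros; apply smooth_on_div; auto).
split; unfold frame1, frame2; auto 10 with smooth.
Qed.

(** I and [L] are annihilated by V, and the area of a and w grows by the divergence because V
    commutes with both. Thus [theta] changes by the divergence alone, and [theta_lie] leaves nothing
    for the cubic. *)
Lemma lie_vanishes_on_frame l m x y : O x y ->
  lie0 P Q X Y x y * frame1 l m x y ^ 3
  + lie1 P Q R' X Y x y * frame1 l m x y ^ 2 * frame2 l m x y
  + lie2 Q R' S' X Y x y * frame1 l m x y * frame2 l m x y ^ 2
  + lie3 R' S' X Y x y * frame2 l m x y ^ 3 = 0.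
Proof.
intros Hxy; assert (N1 := N0 x y Hxy); assert (La1 := La0 x y Hxy).
destruct (smooth_frame l m) as [S1 S2].
assert (T := theta_lie O HO P Q R' S' X Y SP SQ SR SS SX SY _ _ S1 S2 (frame_commutes l m) x y Hxy).
match type of T with ?t = _ =>
  assert (HT : t = (dx X x y + dy Y x y) * theta P Q R' S' (frame1 l m) (frame2 l m) x y) end.
{ eval_pderiv Hxy (theta P Q R' S' (frame1 l m) (frame2 l m)) ltac:(pderiv_by theta_frame).
  rewrite eqXx, eqYy, theta_frame, hX, hY by assumption; unfold field1, field2.
  converse_field. }
rewrite HT in T; lra.
Qed.

Theorem field_is_symmetric x y : O x y ->
  lie0 P Q X Y x y = 0 /\ lie1 P Q R' X Y x y = 0 /\
  lie2 Q R' S' X Y x y = 0 /\ lie3 R' S' X Y x y = 0.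
Proof.
intros Hxy; assert (N1 := N0 x y Hxy); assert (La1 := La0 x y Hxy).
assert (H : forall u1 u2, lie0 P Q X Y x y * u1 ^ 3 + lie1 P Q R' X Y x y * u1 ^ 2 * u2
  + lie2 Q R' S' X Y x y * u1 * u2 ^ 2 + lie3 R' S' X Y x y * u2 ^ 3 = 0).
{ intros u1 u2.
  (* The frame coefficients of (u1, u2), from alpha(a) = omega(w) = 0, alpha(w) = (6/5) Lambda and
     omega(a) = -(6/5) Lambda/N. *)
  assert (T := lie_vanishes_on_frame (- 5 * N x y * (w1 x y * u1 + w2 x y * u2) / (6 * La x y))
    (5 * (A x y * u1 + B x y * u2) / (6 * La x y)) x y Hxy).
  replace (frame1 (- 5 * N x y * (w1 x y * u1 + w2 x y * u2) / (6 * La x y))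
    (5 * (A x y * u1 + B x y * u2) / (6 * La x y)) x y) with u1 in T
    by (unfold frame1; rewrite La_alt by assumption; field; auto using al_w_neq0).
  replace (frame2 (- 5 * N x y * (w1 x y * u1 + w2 x y * u2) / (6 * La x y))
    (5 * (A x y * u1 + B x y * u2) / (6 * La x y)) x y) with u2 in T
    by (unfold frame2; rewrite La_alt by assumption; field; auto using al_w_neq0).
  exact T. }
(* A binary cubic form that vanishes in four distinct directions is zero. *)
assert (H1 := H 1 0); assert (H2 := H 0 1); assert (H3 := H 1 1); assert (H4 := H 1 (-1)).
repeat split; lra.
Qed.
End Converse.

(* Coefficients of the closed form dual to the field. *)
Definition pot1 x y := 25 / 72 * (La x y * A x y / N x y).
Definition pot2 x y := 25 / 72 * (La x y * B x y / N x y).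
Definition invI x y := La x y ^ 2 / N x y.

Lemma smooth_pot : smooth_on O pot1 /\ smooth_on O pot2 /\ smooth_on O invI.
Proof.
assert (H : forall f, smooth_on O f -> smooth_on O (fun x y => f x y / N x y))
  by (intros; apply smooth_on_div; auto).
unfold pot1, pot2, invI.
split; [|split].
- apply smooth_on_mult; auto with smooth; apply (H (fun x y => La x y * A x y)); auto with smooth.
- apply smooth_on_mult; auto with smooth; apply (H (fun x y => La x y * B x y)); auto with smooth.
- apply H; auto with smooth.
Qed.

Lemma pot_closed x y : O x y -> dy pot1 x y = dx pot2 x y.
Proof.
intros Hxy; assert (N1 := N0 x y Hxy).
eval_pderiv Hxy pot1 ltac:(unfold pot1; pderiv_tac); eval_pderiv Hxy pot2 ltac:(unfold pot2;
  pderiv_tac).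
all_jets; rewrite La_alt by assumption; field; auto.
Qed.

Lemma invI_deriv u v x y : O x y ->
  u * dx invI x y + v * dy invI x y
  = 2 * La x y * (u * dx La x y + v * dy La x y) / N x y
    - La x y ^ 2 * (u * dx N x y + v * dy N x y) / N x y ^ 2.
Proof.
intros Hxy; assert (N1 := N0 x y Hxy).
eval_pderiv Hxy invI ltac:(unfold invI; pderiv_tac); field; auto.
Qed.

(** The last claim makes I and a primitive of the form local coordinates: the form is a multiple of
    alpha, which kills a, whereas a(I) = (12/5) I is nonzero. *)
Lemma field_pot x y : O x y ->
  field1 x y * pot1 x y + field2 x y * pot2 x y = 1 /\
  field1 x y * dx invI x y + field2 x y * dy invI x y = 0 /\
  dx invI x y * pot2 x y - dy invI x y * pot1 x y <> 0.
Proof.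
intros Hxy; assert (N1 := N0 x y Hxy); assert (La1 := La0 x y Hxy).
split; [|split].
- unfold field1, field2, pot1, pot2; rewrite La_alt by assumption; field; auto using al_w_neq0.
- rewrite invI_deriv by assumption; unfold field1, field2; all_jets.
  rewrite K_of_L, La_alt by assumption; field; auto using al_w_neq0.
- assert (H : dx invI x y * pot2 x y - dy invI x y * pot1 x y
    = 25 / 72 * (La x y / N x y) * (B x y * dx invI x y + - A x y * dy invI x y))
    by (unfold pot1, pot2; field; auto).
  rewrite H, invI_deriv by assumption.
  match goal with |- ?g <> 0 => assert (H' : g = 5 / 6 * (La x y ^ 3 / N x y)) end.
  { all_jets; rewrite La_alt by assumption; field; auto using al_w_neq0. }
  rewrite H'; neq0.
Qed.

Lemma smooth_field : smooth_on O field1 /\ smooth_on O field2.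
Proof.
assert (HQ : forall x y, O x y -> La x y ^ 2 <> 0) by (intros; apply pow_nonzero; auto).
unfold field1, field2.
split; repeat first [assumption | apply smooth_on_const | apply smooth_on_minus | apply
  smooth_on_plus
  | apply smooth_on_div | apply smooth_on_mult | apply smooth_on_pow | apply smooth_on_opp].
Qed.

Lemma smooth_inv : smooth_on O inv1 /\ smooth_on O inv2.
Proof.
unfold inv1, inv2.
split; (apply smooth_on_div; [exact HO|intros; apply La_pow_neq0; assumption| |]); auto with smooth.
Qed.

(** a and X both annihilate the invariants, and they are independent exactly where alpha(X), hence
    the multiplier, is nonzero. *)
Lemma symmetry_invariants X Y : smooth_on O X -> smooth_on O Y ->
  (forall x y, O x y -> lie0 P Q X Y x y = 0 /\ lie1 P Q R' X Y x y = 0 /\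
     lie2 Q R' S' X Y x y = 0 /\ lie3 R' S' X Y x y = 0) ->
  smooth_on O (multiplier X Y) /\
  forall x y, O x y ->
    dx (multiplier X Y) x y = 0 /\ dy (multiplier X Y) x y = 0 /\
    X x y = multiplier X Y x y * field1 x y /\ Y x y = multiplier X Y x y * field2 x y /\
    (multiplier X Y x y <> 0 ->
       dx inv1 x y = 0 /\ dy inv1 x y = 0 /\ dx inv2 x y = 0 /\ dy inv2 x y = 0).
Proof.
intros SX SY H.
assert (H0 := fun x y h => proj1 (H x y h)).
assert (H1 := fun x y h => proj1 (proj2 (H x y h))).
assert (H2 := fun x y h => proj1 (proj2 (proj2 (H x y h)))).
assert (H3 := fun x y h => proj2 (proj2 (proj2 (H x y h)))).
split.
{ unfold multiplier.
  repeat first [assumption | apply smooth_on_const | apply smooth_on_div | apply smooth_on_plus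
    | apply smooth_on_mult]. }
intros x y Hxy.
destruct (multiplier_constant X Y SX SY H0 H1 H2 H3 x y Hxy) as [M1 M2].
destruct (symmetry_multiple X Y SX SY H0 H1 H2 H3 x y Hxy) as [M3 M4].
split; [exact M1|split; [exact M2|split; [exact M3|split; [exact M4|]]]].
intros Hm.
destruct (invariants_along_al x y Hxy) as [A1 A2].
destruct (invariants_along_symmetry X Y SX SY H0 H1 H2 H3 x y Hxy) as [B1 B2].
assert (N1 := N0 x y Hxy).
assert (D : A x y * X x y + B x y * Y x y <> 0).
{ intros D; apply Hm; unfold multiplier; rewrite D; field; exact N1. }
assert (Z0 : forall u v, B x y * u + - A x y * v = 0 -> X x y * u + Y x y * v = 0 -> u = 0 /\
  v = 0).
{ intros u v E1 E2; split; apply Rmult_eq_reg_l with (A x y * X x y + B x y * Y x y); auto;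
    rewrite Rmult_0_r.
  - transitivity (A x y * (X x y * u + Y x y * v) + Y x y * (B x y * u + - A x y * v)); [ring|].
    rewrite E1, E2; ring.
  - transitivity (B x y * (X x y * u + Y x y * v) - X x y * (B x y * u + - A x y * v)); [ring|].
    rewrite E1, E2; ring. }
destruct (Z0 _ _ A1 B1); destruct (Z0 _ _ A2 B2); auto.
Qed.

Theorem structure_summary :
  (smooth_on O field1 /\ smooth_on O field2 /\ smooth_on O pot1 /\ smooth_on O pot2 /\
    smooth_on O invI /\
   smooth_on O inv1 /\ smooth_on O inv2) /\
  (forall x y, O x y -> dy pot1 x y = dx pot2 x y /\
     field1 x y * pot1 x y + field2 x y * pot2 x y = 1 /\
       field1 x y * dx invI x y + field2 x y * dy invI x y = 0 /\
     dx invI x y * pot2 x y - dy invI x y * pot1 x y <> 0) /\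
  (forall X Y, smooth_on O X -> smooth_on O Y ->
    (forall x y, O x y -> lie0 P Q X Y x y = 0 /\ lie1 P Q R' X Y x y = 0 /\
       lie2 Q R' S' X Y x y = 0 /\ lie3 R' S' X Y x y = 0) ->
    exists mu, smooth_on O mu /\ forall x y, O x y ->
      dx mu x y = 0 /\ dy mu x y = 0 /\ X x y = mu x y * field1 x y /\
        Y x y = mu x y * field2 x y /\
      (mu x y <> 0 -> dx inv1 x y = 0 /\ dy inv1 x y = 0 /\ dx inv2 x y = 0 /\ dy inv2 x y = 0)) /\
  (forall c c1 c2 X Y, smooth_on O X -> smooth_on O Y ->
    (forall x y, O x y -> X x y = c * field1 x y) -> (forall x y, O x y ->
      Y x y = c * field2 x y) ->
    (forall x y, O x y -> inv1 x y = c1) -> (forall x y, O x y -> inv2 x y = c2) ->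
    forall x y, O x y -> lie0 P Q X Y x y = 0 /\ lie1 P Q R' X Y x y = 0 /\
       lie2 Q R' S' X Y x y = 0 /\ lie3 R' S' X Y x y = 0).
Proof.
destruct smooth_field as [S1 S2]; destruct smooth_pot as (S3 & S4 & S5);
  destruct smooth_inv as [S6 S7].
split; [tauto|split; [|split]].
- intros x y Hxy; split; [apply pot_closed, Hxy|apply field_pot, Hxy].
- intros X Y SX SY H; exists (multiplier X Y); apply symmetry_invariants; assumption.
- exact field_is_symmetric.
Qed.

End Structure.

(** * The invariants of an equation in the third case *)

Definition smooth_equation_on (O : R -> R -> Prop) (e : equation) : Prop :=
  smooth_on O (coP e) /\ smooth_on O (coQ e) /\ smooth_on O (coR e) /\ smooth_on O (coS e).

Definition lie_vanishes (e : equation) (X : vfield) (x y : R) : Prop :=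
  lie0 (coP e) (coQ e) (vx X) (vy X) x y = 0 /\
  lie1 (coP e) (coQ e) (coR e) (vx X) (vy X) x y = 0 /\
  lie2 (coQ e) (coR e) (coS e) (vx X) (vy X) x y = 0 /\
  lie3 (coR e) (coS e) (vx X) (vy X) x y = 0.

(** The alternative that [by_chart] decides at [p], made effective on all of [O]. *)
Definition chart_on (e : equation) (p : R * R) (O : R -> R -> Prop) : Prop :=
  (at_pt (cB e) p <> 0 /\ forall x y, O x y -> cB e x y <> 0) \/
  (at_pt (cB e) p = 0 /\ forall x y, O x y -> cA e x y <> 0).

Lemma root5_eq0 z : root5 z = 0 -> z = 0.
Proof.
unfold root5; intros H; apply Rmult_integral in H; destruct H as [H|H].
- destruct (Rtotal_order z 0) as [L|[L|L]]; auto; exfalso.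
  + rewrite sign_eq_m1 in H by exact L; lra.
  + rewrite sign_eq_1 in H by exact L; lra.
- exfalso; unfold Rpower in H; generalize (exp_pos (1 / 5 * ln (Rabs z))); lra.
Qed.

Ltac smooth_tac HO :=
  repeat first [assumption | apply smooth_on_const
    | apply (smooth_on_minus _ HO) | apply (smooth_on_plus _ HO)
    | apply (smooth_on_div _ HO) | apply (smooth_on_mult _ HO) | apply (smooth_on_pow _ HO)
    | apply (smooth_on_opp _ HO) | apply smooth_on_dx | apply smooth_on_dy].

(** This and the next four are the components of V, those of the closed form dual to it, and I,
    assembled from the equation. *)
Definition canon_field1 e p := field1 (cB e) (cN e p) (cLambda e p) (omega e p i2) (cL e p).
Definition canon_field2 e p := field2 (cA e) (cN e p) (cLambda e p) (omega e p i1) (cL e p).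
Definition canon_form1 e p := pot1 (cA e) (cN e p) (cLambda e p).
Definition canon_form2 e p := pot2 (cB e) (cN e p) (cLambda e p).
Definition canon_inv e p := invI (cN e p) (cLambda e p).

(** What the study of germs uses: smoothness, coordinates that straighten V, the rigidity of
    symmetries, and the converse for constant invariants. *)
Definition third_case_frame (e : equation) (p : R * R) (O : R -> R -> Prop) : Prop :=
  (smooth_on O (canon_field1 e p) /\ smooth_on O (canon_field2 e p) /\
    smooth_on O (canon_form1 e p) /\
   smooth_on O (canon_form2 e p) /\ smooth_on O (canon_inv e p) /\
   smooth_on O (I1 e p) /\ smooth_on O (I2 e p)) /\
  (forall x y, O x y -> dy (canon_form1 e p) x y = dx (canon_form2 e p) x y /\
     canon_field1 e p x y * canon_form1 e p x y + canon_field2 e p x y * canon_form2 e p x y = 1 /\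
     canon_field1 e p x y * dx (canon_inv e p) x y + canon_field2 e p x y * dy (canon_inv e p) x
       y = 0 /\
     dx (canon_inv e p) x y * canon_form2 e p x y - dy (canon_inv e p) x y * canon_form1 e p x y
       <> 0) /\
  (forall X Y, smooth_on O X -> smooth_on O Y ->
    (forall x y, O x y -> lie_vanishes e (VField X Y) x y) ->
    exists mu, smooth_on O mu /\ forall x y, O x y ->
      dx mu x y = 0 /\ dy mu x y = 0 /\
      X x y = mu x y * canon_field1 e p x y /\ Y x y = mu x y * canon_field2 e p x y /\
      (mu x y <> 0 -> dx (I1 e p) x y = 0 /\ dy (I1 e p) x y = 0 /\
                      dx (I2 e p) x y = 0 /\ dy (I2 e p) x y = 0)) /\
  (forall c c1 c2 X Y, smooth_on O X -> smooth_on O Y ->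
    (forall x y, O x y -> X x y = c * canon_field1 e p x y) ->
    (forall x y, O x y -> Y x y = c * canon_field2 e p x y) ->
    (forall x y, O x y -> I1 e p x y = c1) -> (forall x y, O x y -> I2 e p x y = c2) ->
    forall x y, O x y -> lie_vanishes e (VField X Y) x y).

(** * Verification of the structure equations in a chart *)

Section Chart.

Variables (e : equation) (p : R * R) (O : R -> R -> Prop).
Hypothesis HO : open_2d O.
Hypothesis Seq : smooth_equation_on O e.

Lemma smooth_AB : smooth_on O (cA e) /\ smooth_on O (cB e).
Proof.
destruct Seq as (SP & SQ & SR & SS).
unfold cA, cB; cbv zeta; split; smooth_tac HO.
Qed.

Hypothesis Hchart : chart_on e p O.

Lemma smooth_chart fB fA :
  ((forall x y, O x y -> cB e x y <> 0) -> smooth_on O fB) ->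
  ((forall x y, O x y -> cA e x y <> 0) -> smooth_on O fA) ->
  smooth_on O (by_chart e p fB fA).
Proof.
intros H1 H2; unfold by_chart; destruct (Req_EM_T (at_pt (cB e) p) 0) as [E|E];
  destruct Hchart as [[C1 C2]|[C1 C2]]; tauto.
Qed.

Lemma smooth_N : smooth_on O (cN e p).
Proof.
destruct smooth_AB as [SA SB]; destruct Seq as (SP & SQ & SR & SS).
unfold cN; apply smooth_chart; intros H0; unfold cG, cH; cbv zeta; smooth_tac HO;
  intros; neq0.
Qed.

Lemma smooth_phi i : smooth_on O (phi e p i).
Proof.
destruct smooth_AB as [SA SB]; destruct Seq as (SP & SQ & SR & SS).
destruct i; unfold phi; cbv zeta; apply smooth_chart; intros H0; smooth_tac HO;
  intros; neq0.
Qed.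

Lemma smooth_Omega_M : smooth_on O (cOmega e p) /\ smooth_on O (cM e p).
Proof.
destruct smooth_AB as [SA SB].
assert (SN := smooth_N); assert (S1 := smooth_phi i1); assert (S2 := smooth_phi i2).
unfold cOmega, cM; cbv zeta; split; smooth_tac HO.
Qed.

Lemma smooth_Lambda : smooth_on O (cLambda e p).
Proof.
destruct smooth_AB as [SA SB]; destruct smooth_Omega_M as [SO SM].
assert (SN := smooth_N); assert (S1 := smooth_phi i1); assert (S2 := smooth_phi i2).
unfold cLambda; apply smooth_chart; intros H0; unfold gamma; cbv zeta; smooth_tac HO; auto.
Qed.

Lemma smooth_Gam k i j : smooth_on O (Gam e p k i j).
Proof.
destruct Seq as (SP & SQ & SR & SS).
assert (S1 := smooth_phi i1); assert (S2 := smooth_phi i2).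
destruct k, i, j; unfold Gam; cbv zeta; smooth_tac HO.
Qed.

Lemma smooth_rho k q : smooth_on O (rho e p k q).
Proof.
assert (SG := smooth_Gam); unfold rho, sum_idx, pd; smooth_tac HO; apply SG.
Qed.

Lemma smooth_omega i : smooth_on O (omega e p i).
Proof.
destruct smooth_AB as [SA SB]; destruct smooth_Omega_M as [SO SM].
assert (SL := smooth_Lambda).
assert (S1 := smooth_rho i1 i1); assert (S2 := smooth_rho i1 i2).
assert (S3 := smooth_rho i2 i1); assert (S4 := smooth_rho i2 i2).
destruct i; unfold omega; apply smooth_chart; intros H0; unfold lambda2; smooth_tac HO; auto.
Qed.

Lemma smooth_K : smooth_on O (cK e p).
Proof.
destruct smooth_AB as [SA SB]; destruct smooth_Omega_M as [SO SM].
assert (SL := smooth_Lambda); assert (SN := smooth_N).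
assert (S1 := smooth_phi i1); assert (S2 := smooth_phi i2).
assert (S3 := smooth_omega i1); assert (S4 := smooth_omega i2).
unfold cK; apply smooth_chart; intros H0; unfold cw, pd; smooth_tac HO; auto.
Qed.

Hypotheses (N0 : forall x y, O x y -> cN e p x y <> 0)
  (La0 : forall x y, O x y -> cLambda e p x y <> 0).

Lemma smooth_ZLE : smooth_on O (cZ e p) /\ smooth_on O (cL e p) /\ smooth_on O (cE e p).
Proof.
destruct Seq as (SP & SQ & SR & SS).
assert (SLa := smooth_Lambda); assert (SN := smooth_N); assert (SK := smooth_K).
assert (S3 := smooth_omega i1); assert (S4 := smooth_omega i2).
assert (SC : smooth_on O (cC e p)) by exact S4.
assert (SD : smooth_on O (cD e p)) by (unfold cD; smooth_tac HO).
assert (SZ : smooth_on O (cZ e p)).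
{ unfold cZ; cbv zeta; smooth_tac HO; intros; neq0. }
assert (SL : smooth_on O (cL e p)) by (unfold cL; smooth_tac HO; exact N0).
split; [exact SZ|split; [exact SL|]].
unfold cE, nabla_omega; cbv zeta; smooth_tac HO; auto;
  intros; neq0.
Qed.

Hypotheses (F0 : forall x y, O x y -> cF e x y = 0) (M0 : forall x y, O x y -> cM e p x y = 0)
  (Om0 : forall x y, O x y -> cOmega e p x y = 0).

(** In each chart the definitions of phi_1, phi_2 and N give three of the equations, and F = 0 gives
    the remaining one. *)
Lemma first_order_equations x y : O x y ->
  dx (cA e) x y = coQ e x y * cA e x y - coP e x y * cB e x y - 5 / 3 * phi e p i1 x y * cA e x y /\
  dy (cB e) x y = coS e x y * cA e x y - coR e x y * cB e x y - 5 / 3 * phi e p i2 x y * cB e x y /\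
  dy (cA e) x y = 3 / 5 * cN e p x y + coR e x y * cA e x y - coQ e x y * cB e x y
             - 4 / 3 * phi e p i2 x y * cA e x y - 1 / 3 * phi e p i1 x y * cB e x y /\
  dx (cB e) x y = - (3 / 5) * cN e p x y + coR e x y * cA e x y - coQ e x y * cB e x y
             - 1 / 3 * phi e p i2 x y * cA e x y - 4 / 3 * phi e p i1 x y * cB e x y.
Proof.
intros Hxy; assert (HF := F0 x y Hxy); unfold cF in HF; cbv zeta in HF.
apply root5_eq0 in HF.
unfold phi, cN, by_chart; cbv zeta.
destruct (Req_EM_T (at_pt (cB e) p) 0) as [E|E]; destruct Hchart as [[C1 C2]|[C1 C2]];
  try contradiction; specialize (C2 x y Hxy).
- unfold cH; cbv zeta; split; [field; auto|split; [|split; field; auto]].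
  apply Rminus_diag_uniq; match type of HF with ?z = 0 => transitivity (- z / cA e x y ^ 2) end;
    [field; auto|rewrite HF; field; auto].
- unfold cG; cbv zeta; split; [|split; [field; auto|split; field; auto]].
  apply Rminus_diag_uniq; match type of HF with ?z = 0 => transitivity (- z / cB e x y ^ 2) end;
    [field; auto|rewrite HF; field; auto].
Qed.

(** The definition of Lambda gives one of the two equations, M = 0 the other. *)
Lemma N_equations x y : O x y ->
  dx (cN e p) x y = - 2 * phi e p i1 x y * cN e p x y - cLambda e p x y * cA e x y /\
  dy (cN e p) x y = - 2 * phi e p i2 x y * cN e p x y - cLambda e p x y * cB e x y.
Proof.
intros Hxy; assert (HM := M0 x y Hxy); assert (HOm := Om0 x y Hxy).
unfold cM in HM; cbv zeta in HM; unfold cLambda, by_chart.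
destruct (Req_EM_T (at_pt (cB e) p) 0) as [E|E]; destruct Hchart as [[C1 C2]|[C1 C2]];
  try contradiction; specialize (C2 x y Hxy); unfold gamma; cbv zeta; rewrite HOm.
- split; [field; auto|].
  apply Rminus_diag_uniq; match type of HM with ?z = 0 => transitivity (- z / cA e x y) end;
    [field; auto|rewrite HM; field; auto].
- split; [|field; auto].
  apply Rminus_diag_uniq; match type of HM with ?z = 0 => transitivity (z / cB e x y) end;
    [field; auto|rewrite HM; field; auto].
Qed.

Lemma phi_closed x y : O x y -> dx (phi e p i2) x y = dy (phi e p i1) x y.
Proof. intros Hxy; assert (H := Om0 x y Hxy); unfold cOmega in H; lra. Qed.

Ltac eval_Gam Hxy e p k i j :=
  eval_pderiv Hxy (Gam e p k i j) ltac:(unfold Gam; cbv zeta; pderiv_tac).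

Lemma rho_eq x y : O x y ->
  rho e p i1 i1 x y
    = curv11 (coP e) (coQ e) (coR e) (coS e) (phi e p i1) (phi e p i2) x y /\
  rho e p i1 i2 x y
    = curv12 (coQ e) (coR e) (coS e) (phi e p i1) (phi e p i2) x y /\
  rho e p i2 i1 x y
    = curv21 (coP e) (coQ e) (coR e) (phi e p i1) (phi e p i2) x y /\
  rho e p i2 i2 x y
    = curv22 (coP e) (coQ e) (coR e) (coS e) (phi e p i1) (phi e p i2) x y.
Proof.
intros Hxy; destruct Seq as (SP & SQ & SR & SS).
assert (S1 := smooth_phi i1); assert (S2 := smooth_phi i2).
unfold rho, sum_idx, pd.
eval_Gam Hxy e p i1 i1 i1; eval_Gam Hxy e p i1 i2 i1; eval_Gam Hxy e p i1 i1 i2.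
eval_Gam Hxy e p i1 i2 i2; eval_Gam Hxy e p i2 i1 i1; eval_Gam Hxy e p i2 i2 i1.
eval_Gam Hxy e p i2 i1 i2; eval_Gam Hxy e p i2 i2 i2.
unfold Gam, curv11, curv12, curv21, curv22, g111, g112, g122, g211, g212, g222.
repeat split; ring.
Qed.

Theorem third_case_geometry : third_case_frame e p O.
Proof.
destruct smooth_AB as [SA SB]; destruct smooth_Omega_M as [SO SM].
destruct smooth_ZLE as (SZ & SL & SE); destruct Seq as (SP & SQ & SR & SS).
refine (structure_summary O HO (coP e) (coQ e) (coR e) (coS e) (phi e p i1) (phi e p i2)
  (cA e) (cB e) (cN e p) (cLambda e p) (omega e p i1) (omega e p i2) (cK e p) (cZ e p)
  SP SQ SR SS (smooth_phi i1) (smooth_phi i2) SA SB smooth_N smooth_Lambda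
  (smooth_omega i1) (smooth_omega i2) smooth_K SZ N0 La0 _ _
  (fun x y H => proj1 (first_order_equations x y H))
  (fun x y H => proj1 (proj2 (first_order_equations x y H)))
  (fun x y H => proj1 (proj2 (proj2 (first_order_equations x y H))))
  (fun x y H => proj2 (proj2 (proj2 (first_order_equations x y H))))
  (fun x y H => proj1 (N_equations x y H)) (fun x y H => proj2 (N_equations x y H))
  phi_closed _ _ _ (cL e p) SL _ (cE e p) SE _).
- reflexivity.
- reflexivity.
- intros x y Hxy; destruct (rho_eq x y Hxy) as (E1 & E2 & E3 & E4).
  rewrite <- E1, <- E2, <- E3, <- E4.
  assert (HOm := Om0 x y Hxy).
  unfold omega, by_chart.
  destruct (Req_EM_T (at_pt (cB e) p) 0) as [E|E]; destruct Hchart as [[C1 C2]|[C1 C2]];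
    try contradiction; specialize (C2 x y Hxy); unfold lambda2; rewrite HOm.
  + right; split; [exact C2|split; field; exact C2].
  + left; split; [exact C2|split; field; exact C2].
- intros x y Hxy.
  assert (HOm := Om0 x y Hxy).
  (* Omega vanishes on an open set, so its partials in [cw] vanish as well. *)
  assert (HO0 := pderiv_eq O HO (cOmega e p) (fun _ _ => 0) _ _ _ _ Om0
    (smooth_on_pderiv O _ SO) (pderiv_const O 0) x y Hxy); cbv beta in HO0.
  destruct HO0 as [HOx HOy].
  unfold cK; unfold by_chart at 1 2.
  destruct (Req_EM_T (at_pt (cB e) p) 0) as [E|E]; destruct Hchart as [[C1 C2]|[C1 C2]];
    try contradiction; specialize (C2 x y Hxy).
  + right; split; [exact C2|].
    unfold cw, pd; rewrite HOx, HOm; field; exact C2.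
  + left; split; [exact C2|].
    unfold cw, pd; rewrite HOy, HOm; field; exact C2.
- intros x y Hxy; assert (L0 := La0 x y Hxy).
  unfold cZ, cD, cC; cbv zeta; rewrite dx_opp, dy_opp; field; exact L0.
- reflexivity.
- intros x y Hxy; assert (HN := N0 x y Hxy).
  unfold cE, nabla_omega, cC, cD; cbv zeta; field; exact HN.
Qed.

End Chart.

(** * Smooth functions of three variables *)

Definition d0 (f : R -> R -> R -> R) t x y := Derive (fun z => f z x y) t.
Definition d1 (f : R -> R -> R -> R) t x y := Derive (fun z => f t z y) x.
Definition d2 (f : R -> R -> R -> R) t x y := Derive (fun z => f t x z) y.

Definition locally_3d (A : R -> R -> R -> Prop) t x y : Prop :=
  exists d : posreal, forall t' x' y',
    Rabs (t' - t) < d -> Rabs (x' - x) < d -> Rabs (y' - y) < d -> A t' x' y'.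

Definition open_3d (O : R -> R -> R -> Prop) : Prop :=
  forall t x y, O t x y -> locally_3d O t x y.

Definition continuity_3d_pt (f : R -> R -> R -> R) t x y : Prop :=
  forall eps : posreal, locally_3d (fun t' x' y' => Rabs (f t' x' y' - f t x y) < eps) t x y.

Definition class3_on (O : R -> R -> R -> Prop) n f : Prop :=
  forall t x y, O t x y -> ex_diff3_n f n t x y.

Lemma continuity_3d_continuous f t x y :
  continuity_3d_pt f t x y <->
  continuous (fun q : R * (R * R) => f (fst q) (fst (snd q)) (snd (snd q))) (t, (x, y)).
Proof.
split.
- intros H; apply filterlim_locally; intros eps.
  destruct (H eps) as [d Hd]; exists d.
  intros [t' [x' y']] [H1 [H2 H3]]; apply Hd; assumption.
- intros H eps.
  assert (H' := proj1 (filterlim_locally _ _) H eps).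
  destruct H' as [d Hd]; exists d; intros t' x' y' H1 H2 H3.
  apply (Hd (t', (x', y'))); split; [exact H1|split; [exact H2|exact H3]].
Qed.

Lemma locally_3d_impl (A B : R -> R -> R -> Prop) t x y :
  (forall t x y, A t x y -> B t x y) -> locally_3d A t x y -> locally_3d B t x y.
Proof. intros H [d Hd]; exists d; auto. Qed.

Lemma locally_3d_and (A B : R -> R -> R -> Prop) t x y :
  locally_3d A t x y -> locally_3d B t x y ->
  locally_3d (fun t x y => A t x y /\ B t x y) t x y.
Proof.
intros [d Hd] [d' Hd'].
exists (mkposreal _ (Rmin_stable_in_posreal d d')); simpl; intros t' x' y' H1 H2 H3.
split; [apply Hd|apply Hd'];
  (eapply Rlt_le_trans; [eassumption|apply Rmin_l || apply Rmin_r]).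
Qed.

Lemma ex_diff3_n_cont f n t x y : ex_diff3_n f n t x y -> continuity_3d_pt f t x y.
Proof. intros H; apply continuity_3d_continuous; destruct n; apply H. Qed.

Lemma ex_diff3_n_0 f t x y : continuity_3d_pt f t x y -> ex_diff3_n f 0 t x y.
Proof. intros H; split; [apply continuity_3d_continuous, H|exact I]. Qed.

Lemma ex_diff3_n_le n m f t x y : (m <= n)%nat -> ex_diff3_n f n t x y -> ex_diff3_n f m t x y.
Proof.
revert m f; induction n as [|n IH]; intros m f Hm H.
- replace m with 0%nat by lia; exact H.
- destruct m as [|m]; [split; [apply H|exact I]|].
  destruct H as (H1 & H2 & H3 & H4 & H5 & H6 & H7).
  split; [exact H1|]; split; [exact H2|]; split; [exact H3|]; split; [exact H4|].
  split; [|split]; apply IH; try assumption; lia.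
Qed.

Lemma continuity_3d_ext_loc f g t x y :
  locally_3d (fun t x y => f t x y = g t x y) t x y ->
  continuity_3d_pt f t x y -> continuity_3d_pt g t x y.
Proof.
intros H Hf eps; generalize (locally_3d_and _ _ _ _ _ H (Hf eps)).
intros [d Hd]; exists d; intros t' x' y' H1 H2 H3.
assert (E0 : f t x y = g t x y).
{ apply (Hd t x y); rewrite Rabs_diag; apply cond_pos. }
destruct (Hd t' x' y' H1 H2 H3) as [E1 E2]; rewrite <- E1, <- E0; exact E2.
Qed.

Lemma locally_3d_self (A : R -> R -> R -> Prop) t x y :
  locally_3d A t x y ->
  locally t (fun z => A z x y) /\ locally x (fun z => A t z y) /\ locally y (fun z => A t x z).
Proof.
intros [d Hd].
assert (H0 : forall z, Rabs (z - z) < d)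
  by (intros; rewrite Rabs_diag; apply cond_pos).
split; [|split]; exists d; intros z Hz; apply Hd; auto.
Qed.

Section Calculus3.

Variable O : R -> R -> R -> Prop.
Hypothesis HO : open_3d O.

Lemma locally_3d_eq_on (f g : R -> R -> R -> R) :
  (forall t x y, O t x y -> f t x y = g t x y) ->
  forall t x y, O t x y -> locally_3d (fun t x y => f t x y = g t x y) t x y.
Proof. intros H t x y Ht; apply locally_3d_impl with (2 := HO t x y Ht); exact H. Qed.

Lemma Derive3_eq_on f g :
  (forall t x y, O t x y -> f t x y = g t x y) ->
  forall t x y, O t x y ->
  d0 f t x y = d0 g t x y /\ d1 f t x y = d1 g t x y /\ d2 f t x y = d2 g t x y.
Proof.
intros H t x y Ht.
destruct (locally_3d_self _ _ _ _ (locally_3d_eq_on f g H t x y Ht)) as (H1 & H2 & H3).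
split; [|split]; apply Derive_ext_loc; assumption.
Qed.

Lemma class3_on_ext n f g :
  (forall t x y, O t x y -> f t x y = g t x y) -> class3_on O n f -> class3_on O n g.
Proof.
revert f g; induction n as [|n IH]; intros f g H Hf t x y Ht;
  assert (L := locally_3d_eq_on f g H t x y Ht); assert (F := Hf t x y Ht).
- apply ex_diff3_n_0.
  apply continuity_3d_ext_loc with f; auto; apply ex_diff3_n_cont with 0%nat; exact F.
- destruct (locally_3d_self _ _ _ _ L) as (H1 & H2 & H3).
  assert (Hc : continuity_3d_pt g t x y).
  { apply continuity_3d_ext_loc with f; auto; apply ex_diff3_n_cont with (S n); exact F. }
  destruct F as (_ & F1 & F2 & F3 & _).
  split; [apply continuity_3d_continuous, Hc|].
  split; [eapply ex_derive_ext_loc; [exact H1|exact F1]|].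
  split; [eapply ex_derive_ext_loc; [exact H2|exact F2]|].
  split; [eapply ex_derive_ext_loc; [exact H3|exact F3]|].
  split; [|split]; [apply (IH (d0 f) (d0 g))|apply (IH (d1 f) (d1 g))|apply (IH (d2 f) (d2 g))];
    try assumption; try (intros; apply Derive3_eq_on; assumption);
    intros t' x' y' H'; apply (Hf t' x' y' H').
Qed.

Definition pderiv3 (f f0 f1 f2 : R -> R -> R -> R) : Prop :=
  forall t x y, O t x y ->
    is_derive (fun z => f z x y) t (f0 t x y) /\
    is_derive (fun z => f t z y) x (f1 t x y) /\
    is_derive (fun z => f t x z) y (f2 t x y).

Lemma class3_on_S n f f0 f1 f2 :
  (forall t x y, O t x y -> continuity_3d_pt f t x y) -> pderiv3 f f0 f1 f2 ->
  class3_on O n f0 -> class3_on O n f1 -> class3_on O n f2 -> class3_on O (S n) f.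
Proof.
intros Hc Hd H0 H1 H2 t x y Ht.
destruct (Hd t x y Ht) as (D0 & D1 & D2).
split; [apply continuity_3d_continuous; auto|].
split; [eexists; eassumption|]; split; [eexists; eassumption|]; split; [eexists; eassumption|].
split; [|split];
  [apply (class3_on_ext n f0 (d0 f))|apply (class3_on_ext n f1 (d1 f))|apply (class3_on_ext n f2
    (d2 f))];
  auto; intros t' x' y' H'; symmetry; apply is_derive_unique, Hd; auto.
Qed.

Lemma class3_on_pderiv3 n f : class3_on O (S n) f -> pderiv3 f (d0 f) (d1 f) (d2 f).
Proof.
intros H t x y Ht; destruct (H t x y Ht) as (_ & H0 & H1 & H2 & _).
split; [|split]; apply Derive_correct; assumption.
Qed.

Lemma class3_on_d n f : class3_on O (S n) f ->
  class3_on O n (d0 f) /\ class3_on O n (d1 f) /\ class3_on O n (d2 f).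
Proof.
intros H; split; [|split]; intros t x y Ht; apply (H t x y Ht).
Qed.

Lemma class3_on_le n m f : (m <= n)%nat -> class3_on O n f -> class3_on O m f.
Proof. intros H Hf t x y Ht; apply ex_diff3_n_le with n; auto. Qed.

Lemma continuity_3d_comp F u v t x y :
  continuity_2d_pt F (u t x y) (v t x y) -> continuity_3d_pt u t x y ->
  continuity_3d_pt v t x y -> continuity_3d_pt (fun t x y => F (u t x y) (v t x y)) t x y.
Proof.
intros HF Hu Hv eps; destruct (HF eps) as [d Hd].
apply locally_3d_impl with (2 := locally_3d_and _ _ _ _ _ (Hu d) (Hv d)).
intros t' x' y' [H1 H2]; apply Hd; assumption.
Qed.

Lemma class3_on_const n c : class3_on O n (fun _ _ _ => c).
Proof.
assert (Hc : forall c t x y, O t x y -> continuity_3d_pt (fun _ _ _ => c) t x y).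
{ intros c' t x y _ eps; exists eps; intros.
  rewrite Rabs_diag; apply cond_pos. }
revert c; induction n as [|n IH]; intros c.
- intros t x y Ht; apply ex_diff3_n_0; auto.
- apply class3_on_S with (fun _ _ _ => 0) (fun _ _ _ => 0) (fun _ _ _ => 0); auto.
  intros t x y _; split; [|split]; apply is_derive_constR.
Qed.

Lemma pderiv3_comp V F u u0 u1 u2 v v0 v1 v2 :
  open_2d V -> smooth_on V F -> (forall t x y, O t x y -> V (u t x y) (v t x y)) ->
  pderiv3 u u0 u1 u2 -> pderiv3 v v0 v1 v2 ->
  pderiv3 (fun t x y => F (u t x y) (v t x y))
    (fun t x y => dx F (u t x y) (v t x y) * u0 t x y + dy F (u t x y) (v t x y) * v0 t x y)
    (fun t x y => dx F (u t x y) (v t x y) * u1 t x y + dy F (u t x y) (v t x y) * v1 t x y)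
    (fun t x y => dx F (u t x y) (v t x y) * u2 t x y + dy F (u t x y) (v t x y) * v2 t x y).
Proof.
intros HV HF H Hu Hv t x y Ht.
destruct (Hu t x y Ht) as (U0 & U1 & U2); destruct (Hv t x y Ht) as (V0 & V1 & V2).
split; [|split].
- apply (is_derive_comp_2d V 0 F (fun z => u z x y) (fun z => v z x y)); auto.
- apply (is_derive_comp_2d V 0 F (fun z => u t z y) (fun z => v t z y)); auto.
- apply (is_derive_comp_2d V 0 F (fun z => u t x z) (fun z => v t x z)); auto.
Qed.

Lemma open_2d_full : open_2d (fun _ _ => True).
Proof. intros x y _; exists (mkposreal 1 Rlt_0_1); auto. Qed.

Lemma class3_on_plus n f g : class3_on O n f -> class3_on O n g ->
  class3_on O n (fun t x y => f t x y + g t x y).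
Proof.
revert f g; induction n as [|n IH]; intros f g Hf Hg.
- intros t x y Ht; apply ex_diff3_n_0.
  apply (continuity_3d_comp Rplus); try (eapply ex_diff3_n_cont; eauto).
  apply continuity_2d_pt_plus; [apply continuity_2d_pt_id1|apply continuity_2d_pt_id2].
- destruct (class3_on_d n f Hf) as (F0 & F1 & F2); destruct (class3_on_d n g Hg) as (G0 & G1 & G2).
  assert (Df := class3_on_pderiv3 n f Hf); assert (Dg := class3_on_pderiv3 n g Hg).
  apply class3_on_S with (fun t x y => d0 f t x y + d0 g t x y)
    (fun t x y => d1 f t x y + d1 g t x y) (fun t x y => d2 f t x y + d2 g t x y); auto.
  + intros t x y Ht; apply (continuity_3d_comp Rplus); try (eapply ex_diff3_n_cont; eauto).
    apply continuity_2d_pt_plus; [apply continuity_2d_pt_id1|apply continuity_2d_pt_id2].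
  + intros t x y Ht; destruct (Df t x y Ht) as (A0 & A1 & A2);
      destruct (Dg t x y Ht) as (B0 & B1 & B2).
    split; [|split]; apply (is_derive_plusR); assumption.
Qed.

Lemma class3_on_mult n f g : class3_on O n f -> class3_on O n g ->
  class3_on O n (fun t x y => f t x y * g t x y).
Proof.
revert f g; induction n as [|n IH]; intros f g Hf Hg.
- intros t x y Ht; apply ex_diff3_n_0.
  apply (continuity_3d_comp Rmult); try (eapply ex_diff3_n_cont; eauto).
  apply continuity_2d_pt_mult; [apply continuity_2d_pt_id1|apply continuity_2d_pt_id2].
- destruct (class3_on_d n f Hf) as (F0 & F1 & F2); destruct (class3_on_d n g Hg) as (G0 & G1 & G2).
  assert (Df := class3_on_pderiv3 n f Hf); assert (Dg := class3_on_pderiv3 n g Hg).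
  assert (Hf' := class3_on_le _ n _ (Nat.le_succ_diag_r n) Hf).
  assert (Hg' := class3_on_le _ n _ (Nat.le_succ_diag_r n) Hg).
  apply class3_on_S with (fun t x y => d0 f t x y * g t x y + f t x y * d0 g t x y)
    (fun t x y => d1 f t x y * g t x y + f t x y * d1 g t x y)
    (fun t x y => d2 f t x y * g t x y + f t x y * d2 g t x y); auto using class3_on_plus.
  + intros t x y Ht; apply (continuity_3d_comp Rmult); try (eapply ex_diff3_n_cont; eauto).
    apply continuity_2d_pt_mult; [apply continuity_2d_pt_id1|apply continuity_2d_pt_id2].
  + intros t x y Ht; destruct (Df t x y Ht) as (A0 & A1 & A2);
      destruct (Dg t x y Ht) as (B0 & B1 & B2).
    split; [|split];
      [apply (is_derive_multR (fun z => f z x y) (fun z => g z x y))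
      |apply (is_derive_multR (fun z => f t z y) (fun z => g t z y))
      |apply (is_derive_multR (fun z => f t x z) (fun z => g t x z))];
      auto using Rmult_comm.
Qed.

Lemma class3_on_comp V n F u v :
  open_2d V -> smooth_on V F -> (forall t x y, O t x y -> V (u t x y) (v t x y)) ->
  class3_on O n u -> class3_on O n v -> class3_on O n (fun t x y => F (u t x y) (v t x y)).
Proof.
intros HV HF H; revert F HF; induction n as [|n IH]; intros F HF Hu Hv.
- intros t x y Ht; apply ex_diff3_n_0.
  apply continuity_3d_comp; try (eapply ex_diff3_n_cont; eauto).
  apply (HF 0%nat); auto.
- destruct (class3_on_d n u Hu) as (U0 & U1 & U2); destruct (class3_on_d n v Hv) as (V0 & V1 & V2).
  assert (Du := class3_on_pderiv3 n u Hu); assert (Dv := class3_on_pderiv3 n v Hv).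
  assert (Hu' := class3_on_le _ n _ (Nat.le_succ_diag_r n) Hu).
  assert (Hv' := class3_on_le _ n _ (Nat.le_succ_diag_r n) Hv).
  eapply class3_on_S; [|apply pderiv3_comp with V; eassumption| | |].
  1: { intros t x y Ht; apply continuity_3d_comp; try (eapply ex_diff3_n_cont; eauto).
    apply (HF 0%nat); auto. }
  all: apply class3_on_plus; apply class3_on_mult; auto; apply IH;
    auto using smooth_on_dx, smooth_on_dy.
Qed.

End Calculus3.

Lemma class3_on_t O n : open_3d O -> class3_on O n (fun t _ _ => t).
Proof.
intros HO.
assert (Hc : forall t x y, O t x y -> continuity_3d_pt (fun t _ _ => t) t x y)
  by (intros t x y _ eps; exists eps; auto).
destruct n as [|n].
- intros t x y Ht; apply ex_diff3_n_0; auto.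
- apply class3_on_S with (fun _ _ _ => 1) (fun _ _ _ => 0) (fun _ _ _ => 0);
    auto using class3_on_const.
  intros t x y _; split; [apply is_derive_idR|].
  split; apply is_derive_constR.
Qed.

Lemma class3_on_xy O n : open_3d O ->
  class3_on O n (fun _ x _ => x) /\ class3_on O n (fun _ _ y => y).
Proof.
intros HO.
assert (Hc : forall t x y, continuity_3d_pt (fun _ x _ => x) t x y)
  by (intros t x y eps; exists eps; auto).
assert (Hc' : forall t x y, continuity_3d_pt (fun _ _ y => y) t x y)
  by (intros t x y eps; exists eps; auto).
destruct n as [|n].
- split; intros t x y Ht; apply ex_diff3_n_0; auto.
- split.
  + apply class3_on_S with (fun _ _ _ => 0) (fun _ _ _ => 1) (fun _ _ _ => 0);
      auto using class3_on_const.
    intros t x y _; split; [apply is_derive_constR|].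
    split; [apply is_derive_idR|apply is_derive_constR].
  + apply class3_on_S with (fun _ _ _ => 0) (fun _ _ _ => 0) (fun _ _ _ => 1);
      auto using class3_on_const.
    intros t x y _; split; [apply is_derive_constR|].
    split; [apply is_derive_constR|apply is_derive_idR].
Qed.

Lemma ex_diff3_n_slice n f t x y : ex_diff3_n f n t x y -> ex_diff_n (f t) n x y.
Proof.
revert f; induction n as [|n IH]; intros f H; assert (C := ex_diff3_n_cont _ _ _ _ _ H).
- split; [|exact I].
  intros eps; destruct (C eps) as [d Hd]; exists d; intros u v Hu Hv; apply Hd; auto.
  rewrite Rabs_diag; apply cond_pos.
- destruct H as (_ & H0 & H1 & H2 & H3 & H4 & H5).
  split; [|split; [exact H1|split; [exact H2|split]]].
  + intros eps; destruct (C eps) as [d Hd]; exists d; intros u v Hu Hv; apply Hd; auto.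
    rewrite Rabs_diag; apply cond_pos.
  + exact (IH (d1 f) H4).
  + exact (IH (d2 f) H5).
Qed.

Lemma open_3d_slice W t : open_3d W -> open_2d (W t).
Proof.
intros HW x y H; destruct (HW t x y H) as [d Hd]; exists d; intros u v Hu Hv.
apply Hd; auto; rewrite Rabs_diag; apply cond_pos.
Qed.

Lemma is_derive_comp_3d W f t u v s u' v' :
  open_3d W -> class3_on W 1 f -> W t (u s) (v s) ->
  is_derive u s u' -> is_derive v s v' ->
  is_derive (fun z => f t (u z) (v z)) s
    (d1 f t (u s) (v s) * u' + d2 f t (u s) (v s) * v').
Proof.
intros HW Hf H Hu Hv.
apply (is_derive_comp_2d (W t) 0 (f t) u v); auto using open_3d_slice.
intros x y Hxy; apply ex_diff3_n_slice; apply Hf; exact Hxy.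
Qed.

(** A fixed curve transported by a flow, as a function of time t and parameter s. The curve carries
    the dummy argument t so that the calculus of two variables applies to it. *)
Lemma class_on_curve O W n f (c1 c2 : R -> R -> R) :
  open_2d O -> open_3d W -> (forall t s, O t s -> W t (c1 t s) (c2 t s)) ->
  (forall t t' s, c1 t s = c1 t' s) -> (forall t t' s, c2 t s = c2 t' s) ->
  smooth_on O c1 -> smooth_on O c2 -> class3_on W n f ->
  class_on O n (fun t s => f t (c1 t s) (c2 t s)).
Proof.
intros HO HW H I1' I2' S1 S2; revert f; induction n as [|n IH]; intros f Hf;
  assert (Hc : forall t s, O t s -> continuity_2d_pt (fun t s => f t (c1 t s) (c2 t s)) t s).
1, 3: intros t s Ht eps;
  destruct (ex_diff3_n_cont _ _ _ _ _ (Hf _ _ _ (H t s Ht)) eps) as [d Hd];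
  destruct (locally_2d_and _ _ t s (class_on_cont O 0 c1 (S1 0%nat) t s Ht d)
    (class_on_cont O 0 c2 (S2 0%nat) t s Ht d)) as [d' Hd'];
  exists (mkposreal _ (Rmin_stable_in_posreal d d')); simpl; intros t' s' H1 H2;
  apply Hd; [eapply Rlt_le_trans; [exact H1|apply Rmin_l]|apply Hd'|apply Hd'];
  (eapply Rlt_le_trans; [eassumption|apply Rmin_r]).
- intros t s Ht; split; [auto|exact I].
- assert (Hf1 : class3_on W 1 f) by (apply class3_on_le with (S n); auto; lia).
  destruct (class3_on_d W n f Hf) as (F0 & F1 & F2).
  apply class_on_S with (fun t s => d0 f t (c1 t s) (c2 t s))
    (fun t s => d1 f t (c1 t s) (c2 t s) * dy c1 t s + d2 f t (c1 t s) (c2 t s) * dy c2 t s); auto.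
  + apply pderiv_intro; intros t s Ht; split.
    * apply is_derive_ext with (fun z => f z (c1 t s) (c2 t s)).
      { intros z; rewrite (I1' z t), (I2' z t); reflexivity. }
      apply (class3_on_pderiv3 W n f Hf t _ _ (H t s Ht)).
    * apply (is_derive_comp_3d W f t (c1 t) (c2 t)); auto.
      -- apply (pderiv_elim O _ _ _ t s (smooth_on_pderiv O c1 S1)); auto.
      -- apply (pderiv_elim O _ _ _ t s (smooth_on_pderiv O c2 S2)); auto.
  + apply class_on_plus; auto; apply class_on_mult; auto; apply smooth_on_dy; auto.
Qed.

(** * Transported jets and their residual *)

Definition jet1 (f : R -> R -> R -> R) (m t x y : R) : R := d1 f t x y + d2 f t x y * m.
(** [jet1] and [jet2] are the first and second derivative of [f t] along a graph that has slope m
    and second derivative n at (x, y). *)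
Definition jet2 (f : R -> R -> R -> R) (m n t x y : R) : R :=
  d1 (d1 f) t x y + d2 (d1 f) t x y * m
  + (d1 (d2 f) t x y + d2 (d2 f) t x y * m) * m + d2 f t x y * n.

Definition cubic (P Q R' S' : R -> R -> R) (x y v1 v2 : R) : R :=
  P x y * v1 ^ 3 + 3 * Q x y * v1 ^ 2 * v2 + 3 * R' x y * v1 * v2 ^ 2 + S' x y * v2 ^ 3.

(* It vanishes iff the image under (f t, g t) of a curve with 2-jet (m, n) at (x, y)
   satisfies the equation to second order. *)
Definition residual (P Q R' S' : R -> R -> R) (f g : R -> R -> R -> R) (m n t x y : R) : R :=
  jet1 f m t x y * jet2 g m n t x y - jet1 g m t x y * jet2 f m n t x y
  - cubic P Q R' S' (f t x y) (g t x y) (jet1 f m t x y) (jet1 g m t x y).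

Definition lie_cubic (P Q R' S' X Y : R -> R -> R) (x y v1 v2 : R) : R :=
  lie0 P Q X Y x y * v1 ^ 3 + lie1 P Q R' X Y x y * v1 ^ 2 * v2
  + lie2 Q R' S' X Y x y * v1 * v2 ^ 2 + lie3 R' S' X Y x y * v2 ^ 3.

(** Finds the function whose smoothness hypothesis covers an iterated derivative of it. *)
Ltac strip_derivatives F :=
  lazymatch F with dx ?G => strip_derivatives G | dy ?G => strip_derivatives G | _ => F end.

Ltac pderiv_comp_tac :=
  first [eapply pderiv_const | eapply pderiv_x | eapply pderiv_y |
  lazymatch goal with
  | |- pderiv _ (fun x y => @?f x y + @?g x y) _ _ => eapply pderiv_plus; pderiv_comp_tac
  | |- pderiv _ (fun x y => @?f x y - @?g x y) _ _ => eapply pderiv_minus; pderiv_comp_tac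
  | |- pderiv _ (fun x y => @?f x y * @?g x y) _ _ => eapply pderiv_mult; pderiv_comp_tac
  | |- pderiv _ (fun x y => @?f x y ^ _) _ _ => eapply pderiv_pow; pderiv_comp_tac
  | |- pderiv _ (fun x y => ?f x y) _ _ => pderiv_atom
  | |- pderiv _ (fun x y => ?F (@?u x y) (@?v x y)) _ _ =>
      let G := strip_derivatives F in
      match goal with
      | SG : smooth_on ?V G, HV : open_2d ?V |- _ =>
          eapply (pderiv_comp _ V F u v);
          [exact HV | solve [auto 10 with smooth] | assumption | pderiv_comp_tac | pderiv_comp_tac]
      end
  | |- _ => pderiv_atom
  end].

Ltac diff_comp_eq HO H H' :=
  lazymatch type of H with
  | forall x y, ?O x y -> @?f x y = @?g x y =>
      unshelve epose proof (pderiv_eq O HO f g _ _ _ _ H _ _) as H';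
      [ | | | | pderiv_comp_tac | pderiv_comp_tac | ];
      cbv beta in H'; cbn [INR Init.Nat.pred] in H'
  end.

Section ResidualAlongFlow.

Variables O U : R -> R -> Prop.
Hypotheses (HO : open_2d O) (HU : open_2d U).
Variables P Q R' S' X Y h k : R -> R -> R.
Hypotheses (SP : smooth_on U P) (SQ : smooth_on U Q) (SR : smooth_on U R')
  (SS : smooth_on U S') (SX : smooth_on U X) (SY : smooth_on U Y)
  (Sh : smooth_on O h) (Sk : smooth_on O k).
Hypothesis HOU : forall t s, O t s -> U (h t s) (k t s).
Hypothesis flow_h : forall t s, O t s -> dx h t s = X (h t s) (k t s).
Hypothesis flow_k : forall t s, O t s -> dx k t s = Y (h t s) (k t s).

(** The analogue of [theta_lie] on the surface swept by a curve: the residual is a bivector built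
    from the curve's jet, so it grows with the divergence, and the Lie derivative of the connection
    is the source term. *)
Lemma residual_flow_eq t s : O t s ->
  is_derive (fun t => dy h t s * dy (dy k) t s - dy k t s * dy (dy h) t s
     - cubic P Q R' S' (h t s) (k t s) (dy h t s) (dy k t s)) t
   ((dx X (h t s) (k t s) + dy Y (h t s) (k t s))
     * (dy h t s * dy (dy k) t s - dy k t s * dy (dy h) t s
     - cubic P Q R' S' (h t s) (k t s) (dy h t s) (dy k t s))
    + lie_cubic P Q R' S' X Y (h t s) (k t s) (dy h t s) (dy k t s)).
Proof.
intros Ht.
assert (D : exists ex ey, pderiv O (fun t s =>
     dy h t s * dy (dy k) t s - dy k t s * dy (dy h) t s
     - (P (h t s) (k t s) * dy h t s ^ 3 + 3 * Q (h t s) (k t s) * dy h t s ^ 2 * dy k t s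
        + 3 * R' (h t s) (k t s) * dy h t s * dy k t s ^ 2 + S' (h t s) (k t s) * dy k t s ^ 3))
     ex ey /\
   ex t s = (dx X (h t s) (k t s) + dy Y (h t s) (k t s))
     * (dy h t s * dy (dy k) t s - dy k t s * dy (dy h) t s
     - cubic P Q R' S' (h t s) (k t s) (dy h t s) (dy k t s))
    + lie_cubic P Q R' S' X Y (h t s) (k t s) (dy h t s) (dy k t s)).
{ eexists; eexists; split; [pderiv_comp_tac|].
  cbv beta; cbn [INR Init.Nat.pred].
  (* Differentiating the flow equations once and twice in s gives the time derivatives of the jet of
     the curve. *)
  diff_comp_eq HO flow_h Dh; diff_comp_eq HO flow_k Dk.
  assert (Hh := fun t s H => proj2 (Dh t s H)); assert (Hk := fun t s H => proj2 (Dk t s H)).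
  cbv beta in Hh, Hk; clear Dh Dk.
  diff_comp_eq HO Hh Dh; diff_comp_eq HO Hk Dk.
  destruct (Dh t s Ht) as [_ Eh]; destruct (Dk t s Ht) as [_ Ek]; clear Dh Dk.
  rewrite Eh, Ek, (Hh t s Ht), (Hk t s Ht), (flow_h t s Ht), (flow_k t s Ht).
  unfold cubic, lie_cubic, lie0, lie1, lie2, lie3.
  assert (MX := dx_dy U HU X SX _ _ (HOU t s Ht)); assert (MY := dx_dy U HU Y SY _ _ (HOU t s Ht)).
  rewrite MX, MY; ring. }
destruct D as (ex & ey & D & <-).
exact (proj1 (pderiv_elim O _ _ _ t s D Ht)).
Qed.

End ResidualAlongFlow.

(** * The residual along a flow *)

Lemma Rabs_lt_open (a eps : R) : Rabs a < eps ->
  exists d : posreal, forall b, Rabs (b - a) < d -> Rabs b < eps.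
Proof.
intros H; assert (Hd : 0 < eps - Rabs a) by lra.
exists (mkposreal _ Hd); simpl; intros b Hb.
replace b with ((b - a) + a) by ring; generalize (Rabs_triang (b - a) a); lra.
Qed.

Lemma open_2d_preimage_3d W (c1 c2 : R -> R -> R) :
  open_3d W -> (forall t s, continuity_2d_pt c1 t s) -> (forall t s, continuity_2d_pt c2 t s) ->
  open_2d (fun t s => W t (c1 t s) (c2 t s)).
Proof.
intros HW H1 H2 t s H.
destruct (HW _ _ _ H) as [d Hd].
destruct (locally_2d_and _ _ t s (H1 t s d) (H2 t s d)) as [d' Hd'].
exists (mkposreal _ (Rmin_stable_in_posreal d d')); simpl; intros t' s' K1 K2.
apply Hd; [eapply Rlt_le_trans; [exact K1|apply Rmin_l]|apply Hd'|apply Hd'];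
  (eapply Rlt_le_trans; [eassumption|apply Rmin_r]).
Qed.

Section Flow.

Variables (U : R -> R -> Prop) (W : R -> R -> R -> Prop).
Hypotheses (HU : open_2d U) (HW : open_3d W).
Variables P Q R' S' X Y : R -> R -> R.
Hypotheses (SP : smooth_on U P) (SQ : smooth_on U Q) (SR : smooth_on U R')
  (SS : smooth_on U S') (SX : smooth_on U X) (SY : smooth_on U Y).
Variables f g : R -> R -> R -> R.
Hypotheses (Sf : forall n, class3_on W n f) (Sg : forall n, class3_on W n g).
Hypothesis HWU : forall t x y, W t x y -> U (f t x y) (g t x y).
Hypothesis flow_f : forall t x y, W t x y -> d0 f t x y = X (f t x y) (g t x y).
Hypothesis flow_g : forall t x y, W t x y -> d0 g t x y = Y (f t x y) (g t x y).

Section Curve.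

Variables (x0 y0 m n : R).

(** The curve is the parabola through (x0, y0) with slope m and second derivative n there. *)
Let c1 (t s : R) : R := x0 + s.
Let c2 (t s : R) : R := y0 + m * s + n / 2 * s ^ 2.
Let O t s := W t (c1 t s) (c2 t s).

Lemma smooth_c V : open_2d V -> smooth_on V c1 /\ smooth_on V c2.
Proof.
intros HV; assert (Sy : smooth_on V (fun _ s => s)) by (intros k; apply class_on_y; auto).
unfold c1, c2; split; auto 10 with smooth.
Qed.

Lemma open_O : open_2d O.
Proof.
assert (HF : open_2d (fun _ _ => True)) by apply open_2d_full.
destruct (smooth_c _ HF) as [S1 S2].
apply (open_2d_preimage_3d W c1 c2); auto; intros t s;
  [exact (class_on_cont (fun _ _ => True) 0 c1 (S1 0%nat) t s I)
  |exact (class_on_cont (fun _ _ => True) 0 c2 (S2 0%nat) t s I)].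
Qed.

Lemma c_derive s : is_derive (fun z => c1 0 z) s 1 /\ is_derive (fun z => c2 0 z) s (m + n * s).
Proof.
unfold c1, c2; split; auto_derive; auto; field.
Qed.

Lemma curve_smooth F : (forall k, class3_on W k F) ->
  smooth_on O (fun t s => F t (c1 t s) (c2 t s)).
Proof.
intros HF k; destruct (smooth_c O open_O) as [S1 S2].
apply class_on_curve with W; auto using open_O.
Qed.

Lemma curve_derive F : class3_on W 1 F -> forall t s, O t s ->
  is_derive (fun z => F t (c1 t z) (c2 t z)) s
    (d1 F t (c1 t s) (c2 t s) + d2 F t (c1 t s) (c2 t s) * (m + n * s)).
Proof.
intros HF t s Ht; destruct (c_derive s) as [C1 C2].
replace (d1 F t (c1 t s) (c2 t s)) with (d1 F t (c1 t s) (c2 t s) * 1) by ring.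
apply is_derive_comp_3d with W; auto.
Qed.

Lemma curve_dy F : (forall k, class3_on W k F) -> forall t, W t x0 y0 ->
  dy (fun t s => F t (c1 t s) (c2 t s)) t 0 = jet1 F m t x0 y0 /\
  dy (dy (fun t s => F t (c1 t s) (c2 t s))) t 0 = jet2 F m n t x0 y0.
Proof.
intros HF t Ht.
assert (E1 : c1 t 0 = x0) by (unfold c1; ring).
assert (E2 : c2 t 0 = y0) by (unfold c2; field).
assert (H0 : O t 0) by (unfold O; rewrite E1, E2; exact Ht).
destruct (class3_on_d W 1 F (HF 2%nat)) as (_ & F1 & F2).
assert (D : forall s, O t s -> dy (fun t s => F t (c1 t s) (c2 t s)) t s
  = d1 F t (c1 t s) (c2 t s) + d2 F t (c1 t s) (c2 t s) * (m + n * s)).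
{ intros s Hs; apply is_derive_unique, curve_derive; auto. }
split.
- rewrite D by assumption; rewrite E1, E2; unfold jet1; ring.
- transitivity (Derive (fun s => d1 F t (c1 t s) (c2 t s) + d2 F t (c1 t s) (c2 t s) * (m + n *
    s)) 0).
  + apply Derive_ext_loc.
    apply (filter_imp (fun s => O t s)); [exact D|].
    apply (locally_2d_locally_y O), open_O, H0.
  + apply is_derive_unique.
    assert (K1 := curve_derive (d1 F) F1 t 0 H0); assert (K2 := curve_derive (d2 F) F2 t 0 H0).
    assert (K3 : is_derive (fun s => m + n * s) 0 n) by (auto_derive; auto; ring).
    replace (jet2 F m n t x0 y0) with
     (d1 (d1 F) t (c1 t 0) (c2 t 0) + d2 (d1 F) t (c1 t 0) (c2 t 0) * (m + n * 0)
      + ((d1 (d2 F) t (c1 t 0) (c2 t 0) + d2 (d2 F) t (c1 t 0) (c2 t 0) * (m + n * 0)) * (m + n * 0)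
         + d2 F t (c1 t 0) (c2 t 0) * n))
      by (rewrite E1, E2; unfold jet2; ring).
    apply (is_derive_plusR); [exact K1|].
    apply (is_derive_multR (fun s => d2 F t (c1 t s) (c2 t s)) (fun s => m + n * s));
      auto; intros; apply Rmult_comm.
Qed.

Lemma residual_derive t : W t x0 y0 ->
  is_derive (fun t => residual P Q R' S' f g m n t x0 y0) t
    ((dx X (f t x0 y0) (g t x0 y0) + dy Y (f t x0 y0) (g t x0 y0))
       * residual P Q R' S' f g m n t x0 y0
     + lie_cubic P Q R' S' X Y (f t x0 y0) (g t x0 y0) (jet1 f m t x0 y0) (jet1 g m t x0 y0)).
Proof.
intros Ht.
set (h := fun t s => f t (c1 t s) (c2 t s)); set (k := fun t s => g t (c1 t s) (c2 t s)).
assert (E1 : forall t, c1 t 0 = x0) by (intros; unfold c1; ring).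
assert (E2 : forall t, c2 t 0 = y0) by (intros; unfold c2; field).
assert (EO : forall t, W t x0 y0 -> O t 0) by (intros; unfold O; rewrite E1, E2; assumption).
assert (Eh : forall t, h t 0 = f t x0 y0) by (intros; unfold h; rewrite E1, E2; reflexivity).
assert (Ek : forall t, k t 0 = g t x0 y0) by (intros; unfold k; rewrite E1, E2; reflexivity).
assert (D := residual_flow_eq O U open_O HU P Q R' S' X Y h k SP SQ SR SS SX SY
  (curve_smooth f Sf) (curve_smooth g Sg) (fun t s H => HWU _ _ _ H)
  (fun t s H => flow_f _ _ _ H) (fun t s H => flow_g _ _ _ H) t 0 (EO t Ht)).
destruct (curve_dy f Sf t Ht) as [F1 F2]; destruct (curve_dy g Sg t Ht) as [G1 G2].
fold h in F1, F2; fold k in G1, G2.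
rewrite F1, F2, G1, G2, Eh, Ek in D.
apply is_derive_ext_loc with (2 := D).
destruct (locally_3d_self _ _ _ _ (HW _ _ _ Ht)) as (L & _).
apply (filter_imp (fun t => W t x0 y0)); [intros t' H|exact L].
destruct (curve_dy f Sf t' H) as [F1' F2']; destruct (curve_dy g Sg t' H) as [G1' G2'].
fold h in F1', F2'; fold k in G1', G2'.
unfold residual; rewrite F1', F2', G1', G2', Eh, Ek; reflexivity.
Qed.

End Curve.

End Flow.

(** * Potentials, implicit functions and flows *)

Lemma pderiv_continuity O f fx fy x y : open_2d O -> pderiv O f fx fy -> O x y ->
  continuity_2d_pt fx x y -> continuity_2d_pt f x y.
Proof.
intros HO D Hxy Hc.
apply differentiable_continuity_pt; exists (fx x y), (fy x y).
apply filterdiff_differentiable_pt_lim.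
apply (is_derive_filterdiff f x y fx (fy x y)).
- apply (locally_2d_locally (fun u v => is_derive (fun z => f z v) u (fx u v))).
  apply locally_2d_impl with (2 := HO x y Hxy), locally_2d_forall.
  intros u v Huv; apply (pderiv_elim O f fx fy u v D Huv).
- apply (pderiv_elim O f fx fy x y D Hxy).
- apply (continuity_2d_pt_filterlim fx); exact Hc.
Qed.

(** Continuity of [f] is drawn from its partials, so a primitive is smooth as soon as they are. *)
Lemma smooth_on_of_pderiv O f fx fy : open_2d O -> pderiv O f fx fy ->
  smooth_on O fx -> smooth_on O fy -> smooth_on O f.
Proof.
intros HO D Sx Sy n.
assert (H : class_on O (S n) f).
{ apply class_on_S with fx fy; auto.
  intros x y Hxy; apply pderiv_continuity with O fx fy; auto.
  apply (class_on_cont O 0 fx (Sx 0%nat)); auto. }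
apply class_on_le with (S n); auto.
Qed.

(** * Potentials of closed forms *)

Lemma in_box_segment p d x y z : in_box p d x y ->
  (Rmin (fst p) x <= z <= Rmax (fst p) x -> in_box p d z y) /\
  (Rmin (snd p) y <= z <= Rmax (snd p) y -> in_box p d x z).
Proof.
intros [H1 H2]; apply Rabs_def2 in H1; apply Rabs_def2 in H2.
unfold in_box; revert H1 H2; unfold Rmin, Rmax.
split; intros H; split; apply Rabs_def1; destruct (Rle_dec _ _); lra.
Qed.

Lemma in_box_center p d : 0 < d -> in_box p d (fst p) (snd p).
Proof. intros H; unfold in_box, Rminus; rewrite !Rplus_opp_r, Rabs_R0; auto. Qed.

Lemma continuity_2d_slices f x y : continuity_2d_pt f x y ->
  continuous (fun z => f z y) x /\ continuous (fun z => f x z) y.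
Proof.
intros H; split; apply filterlim_locally; intros eps.
- exact (locally_2d_locally_x (fun u v => Rabs (f u v - f x y) < eps) x y (H eps)).
- exact (locally_2d_locally_y (fun u v => Rabs (f u v - f x y) < eps) x y (H eps)).
Qed.

(** Integration along a horizontal and then a vertical segment from the centre. The vertical part is
    differentiated in x under the integral sign, and closedness turns the result into a difference
    of values of u. *)
Lemma potential p d (u v : R -> R -> R) : 0 < d ->
  smooth_on (in_box p d) u -> smooth_on (in_box p d) v ->
  (forall x y, in_box p d x y -> dy u x y = dx v x y) ->
  exists s, pderiv (in_box p d) s u v.
Proof.
intros Hd Su Sv E; set (O := in_box p d) in *.
assert (HO : open_2d O) by apply open_2d_in_box.
assert (Cu : forall x y, O x y -> continuity_2d_pt u x y)
  by (intros; apply (class_on_cont O 0 u (Su 0%nat)); auto).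
assert (Cv : forall x y, O x y -> continuity_2d_pt v x y)
  by (intros; apply (class_on_cont O 0 v (Sv 0%nat)); auto).
assert (Cvx : forall x y, O x y -> continuity_2d_pt (dx v) x y)
  by (intros; apply (class_on_cont O 0 (dx v) (smooth_on_dx O v Sv 0%nat)); auto).
assert (Dv := smooth_on_pderiv O v Sv); assert (Du := smooth_on_pderiv O u Su).
assert (Hp : forall x y, O x y -> O x (snd p)).
{ intros x y [H1 H2]; split; auto; rewrite Rabs_diag; exact Hd. }
assert (Iv : forall x y, O x y -> ex_RInt (fun t => v x t) (snd p) y).
{ intros x y Hxy; apply (ex_RInt_continuous (V := R_CompleteNormedModule)).
  intros z Hz; apply continuity_2d_slices, Cv, (in_box_segment p d x y z Hxy), Hz. }
assert (Iu : forall x y, O x y -> ex_RInt (fun t => u t (snd p)) (fst p) x).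
{ intros x y Hxy; apply (ex_RInt_continuous (V := R_CompleteNormedModule)).
  intros z Hz; apply continuity_2d_slices, Cu, (in_box_segment p d x _ z (Hp x y Hxy)), Hz. }
exists (fun x y => RInt (fun t => u t (snd p)) (fst p) x + RInt (fun t => v x t) (snd p) y).
apply pderiv_intro; intros x y Hxy; split.
- assert (D1 : is_derive (fun x => RInt (fun t => u t (snd p)) (fst p) x) x (u x (snd p))).
  { apply (is_derive_RInt (fun t => u t (snd p)) _ (fst p)).
    - apply (filter_imp (fun x => O x y)); [|apply (locally_2d_locally_x O), HO, Hxy].
      intros z Hz; apply (RInt_correct (V := R_CompleteNormedModule)), (Iu z y Hz).
    - apply (continuity_2d_slices u x (snd p)), Cu, (Hp x y Hxy). }
  assert (D2 : is_derive (fun x => RInt (fun t => v x t) (snd p) y) x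
    (RInt (fun t => dx v x t) (snd p) y)).
  { apply is_derive_RInt_param.
    - apply (filter_imp (fun x => O x y)); [|apply (locally_2d_locally_x O), HO, Hxy].
      intros z Hz t Ht; exists (dx v z t).
      apply (pderiv_elim O _ _ _ z t Dv), (in_box_segment p d z y t Hz), Ht.
    - intros t Ht; apply Cvx, (in_box_segment p d x y t Hxy), Ht.
    - apply (filter_imp (fun x => O x y)); [|apply (locally_2d_locally_x O), HO, Hxy].
      intros z Hz; apply (Iv z y Hz). }
  assert (E2 : RInt (fun t => dx v x t) (snd p) y = u x y - u x (snd p)).
  { apply (is_RInt_unique (V := R_CompleteNormedModule)).
    apply (is_RInt_derive (V := R_CompleteNormedModule) (fun t => u x t) (fun t => dx v x t)).
    - intros t Ht; rewrite <- E by (apply (in_box_segment p d x y t Hxy), Ht).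
      apply (pderiv_elim O _ _ _ x t Du), (in_box_segment p d x y t Hxy), Ht.
    - intros t Ht; apply (continuity_2d_slices (dx v) x t), Cvx, (in_box_segment p d x y t Hxy),
        Ht. }
  replace (u x y) with (u x (snd p) + RInt (fun t => dx v x t) (snd p) y) by (rewrite E2; ring).
  apply (is_derive_plusR); assumption.
- replace (v x y) with (0 + v x y) by ring.
  apply (is_derive_plusR);
    [apply is_derive_constR|].
  apply (is_derive_RInt (fun t => v x t) _ (snd p)).
  + apply (filter_imp (fun y => O x y)); [|apply (locally_2d_locally_y O), HO, Hxy].
    intros z Hz; apply (RInt_correct (V := R_CompleteNormedModule)), (Iv x z Hz).
  + apply (continuity_2d_slices v x y), Cv, Hxy.
Qed.

(* A difference quotient that is a quotient of values near (a, b) of continuous functions. *)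
Lemma is_derive_quotient (Y : R -> R) z (u v : R) :
  v <> 0 ->
  (forall eps : posreal, locally z (fun z' => exists u' v',
     Rabs (u' - u) < eps /\ Rabs (v' - v) < eps /\ v' * (Y z' - Y z) = u' * (z' - z))) ->
  is_derive Y z (u / v).
Proof.
intros Hv H; apply is_derive_Reals; intros eps Heps.
assert (C : continuity_2d_pt (fun a b => a * / b) u v).
{ apply continuity_2d_pt_mult; [apply continuity_2d_pt_id1|].
  apply continuity_2d_pt_inv; [apply continuity_2d_pt_id2|exact Hv]. }
destruct (locally_2d_and _ _ u v (C (mkposreal _ Heps))
  (continuity_2d_pt_neq_0 (fun _ b => b) u v (continuity_2d_pt_id2 u v) Hv)) as [d Hd].
destruct (H d) as [d' Hd']; exists d'; intros h Hh0 Hh.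
destruct (Hd' (z + h)) as (u' & v' & Hu & Hv' & Eq).
{ change (Rabs (z + h - z) < d'); replace (z + h - z) with h by ring; exact Hh. }
destruct (Hd u' v' Hu Hv') as [Q Q0]; simpl in Q.
replace ((Y (z + h) - Y z) / h) with (u' * / v'); [exact Q|].
apply Rmult_eq_reg_l with (v' * h); [|apply Rmult_integral_contrapositive_currified; auto].
transitivity (u' * h); [field; auto|].
transitivity (v' * (Y (z + h) - Y z)); [rewrite Eq; ring|field; auto].
Qed.

Lemma continuity_pt_slices f x y : continuity_2d_pt f x y ->
  continuity_pt (fun z => f z y) x /\ continuity_pt (fun z => f x z) y.
Proof.
intros H; split; apply continuity_pt_filterlim; apply (continuity_2d_slices f x y H).
Qed.

(** * Implicit functions *)

Section Implicit.

Variables (O : R -> R -> Prop) (F : R -> R -> R) (x0 y0 : R).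
Hypotheses (HO : open_2d O) (SF : smooth_on O F).

Lemma cont_F x y : O x y -> continuity_2d_pt F x y.
Proof. intros; apply (class_on_cont O 0 F (SF 0%nat)); auto. Qed.

Lemma cont_dyF x y : O x y -> continuity_2d_pt (dy F) x y.
Proof. intros; apply (class_on_cont O 0 (dy F) (smooth_on_dy O F SF 0%nat)); auto. Qed.

Lemma cont_dxF x y : O x y -> continuity_2d_pt (dx F) x y.
Proof. intros; apply (class_on_cont O 0 (dx F) (smooth_on_dx O F SF 0%nat)); auto. Qed.

Variable b : R.
Hypothesis Hb : 0 < b.
Hypothesis Hbox : forall x y, Rabs (x - x0) < b -> Rabs (y - y0) < b -> O x y /\ 0 < dy F x y.

Lemma mvt_y x y1 y2 : Rabs (x - x0) < b -> Rabs (y1 - y0) < b -> Rabs (y2 - y0) < b ->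
  exists z, Rmin y1 y2 <= z <= Rmax y1 y2 /\ Rabs (z - y0) < b /\
    F x y2 - F x y1 = dy F x z * (y2 - y1).
Proof.
intros Hx H1 H2; apply Rabs_def2 in H1; apply Rabs_def2 in H2.
assert (Hz : forall z, Rmin y1 y2 <= z <= Rmax y1 y2 -> Rabs (z - y0) < b).
{ intros z; unfold Rmin, Rmax; destruct (Rle_dec _ _); intros; apply Rabs_def1; lra. }
destruct (MVT_gen (fun z => F x z) y1 y2 (fun z => dy F x z)) as (z & Z1 & Z2).
- intros z Z; apply (pderiv_elim O _ _ _ x z (smooth_on_pderiv O F SF)).
  apply Hbox; auto; apply Hz; lra.
- intros z Z; apply (continuity_pt_slices F x z), cont_F, Hbox; auto.
- exists z; auto.
Qed.

Lemma mvt_x x1 x2 y : Rabs (x1 - x0) < b -> Rabs (x2 - x0) < b -> Rabs (y - y0) < b ->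
  exists z, Rmin x1 x2 <= z <= Rmax x1 x2 /\ F x2 y - F x1 y = dx F z y * (x2 - x1).
Proof.
intros H1 H2 Hy; apply Rabs_def2 in H1; apply Rabs_def2 in H2.
assert (Hz : forall z, Rmin x1 x2 <= z <= Rmax x1 x2 -> Rabs (z - x0) < b).
{ intros z; unfold Rmin, Rmax; destruct (Rle_dec _ _); intros; apply Rabs_def1; lra. }
destruct (MVT_gen (fun z => F z y) x1 x2 (fun z => dx F z y)) as (z & Z1 & Z2).
- intros z Z; apply (pderiv_elim O _ _ _ z y (smooth_on_pderiv O F SF)).
  apply Hbox; auto; apply Hz; lra.
- intros z Z; apply (continuity_pt_slices F z y), cont_F, Hbox; auto.
- exists z; auto.
Qed.

Lemma F_increasing x y1 y2 : Rabs (x - x0) < b -> Rabs (y1 - y0) < b -> Rabs (y2 - y0) < b ->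
  y1 < y2 -> F x y1 < F x y2.
Proof.
intros Hx H1 H2; destruct (mvt_y x y1 y2 Hx H1 H2) as (z & _ & Hz & E).
assert (P := proj2 (Hbox x z Hx Hz)); intros H; nra.
Qed.

Lemma F_reflects_lt x y1 y2 : Rabs (x - x0) < b -> Rabs (y1 - y0) < b -> Rabs (y2 - y0) < b ->
  F x y1 < F x y2 -> y1 < y2.
Proof.
intros Hx H1 H2; destruct (mvt_y x y1 y2 Hx H1 H2) as (z & _ & Hz & E).
assert (P := proj2 (Hbox x z Hx Hz)); intros H; nra.
Qed.

Variable a : R.
Hypothesis Ha : 0 < a <= b.
Hypothesis Hends : forall x s, Rabs (x - x0) < a -> Rabs (s - F x0 y0) < a ->
  F x (y0 - b / 2) < s < F x (y0 + b / 2).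

(** A root picked by [epsilon]; F is strictly increasing in y on the box, so a root there is the
    only one. *)
Definition impl (x s : R) : R :=
  epsilon (inhabits 0) (fun y => Rabs (y - y0) < b /\ F x y = s).

Let V := in_box (x0, F x0 y0) a.

Lemma impl_spec x s : V x s -> Rabs (x - x0) < b /\ Rabs (impl x s - y0) < b /\ F x (impl x s) = s.
Proof.
intros [Hx Hs]; simpl in Hx, Hs.
assert (Hx' : Rabs (x - x0) < b) by lra.
split; [exact Hx'|].
unfold impl; apply epsilon_spec.
destruct (Hends x s Hx Hs) as [E1 E2].
assert (HB : forall z, y0 - b / 2 <= z <= y0 + b / 2 -> Rabs (z - y0) < b)
  by (intros; apply Rabs_def1; lra).
destruct (Ranalysis5.IVT_interv (fun z => F x z - s) (y0 - b / 2) (y0 + b / 2)) as (z & Z1 & Z2).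
- intros z Hz; apply continuity_pt_minus.
  + apply (continuity_pt_slices F x z), cont_F, Hbox; auto.
  + apply continuity_pt_const; intros ? ?; reflexivity.
- lra.
- lra.
- lra.
- exists z; split; [auto|lra].
Qed.

Lemma impl_unique x y : Rabs (y - y0) < b -> V x (F x y) -> impl x (F x y) = y.
Proof.
intros Hy HV; destruct (impl_spec x _ HV) as (H1 & H2 & H3).
destruct (Rtotal_order (impl x (F x y)) y) as [L|[L|L]]; auto; exfalso;
  apply (F_increasing x) in L; auto; lra.
Qed.

Lemma impl_continuous x s : V x s -> continuity_2d_pt impl x s.
Proof.
intros HV eps; destruct (impl_spec x s HV) as (H1 & H2 & H3).
set (y := impl x s) in *.
assert (He : 0 < Rmin (eps / 2) ((b - Rabs (y - y0)) / 2)).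
{ apply Rmin_glb_lt; [generalize (cond_pos eps); lra|lra]. }
set (e := Rmin (eps / 2) ((b - Rabs (y - y0)) / 2)) in *.
assert (He1 : e <= eps / 2) by apply Rmin_l.
assert (He2 : e <= (b - Rabs (y - y0)) / 2) by apply Rmin_r.
assert (Hr : forall z, Rabs z <= e -> Rabs (y + z - y0) < b).
{ intros z Hz; replace (y + z - y0) with (z + (y - y0)) by ring.
  generalize (Rabs_triang z (y - y0)); lra. }
assert (Y1 : Rabs (y - e - y0) < b) by (apply (Hr (- e)); rewrite Rabs_Ropp, Rabs_right; lra).
assert (Y2 : Rabs (y + e - y0) < b) by (apply (Hr e); rewrite Rabs_right; lra).
assert (L1 : F x (y - e) < s) by (rewrite <- H3; apply (F_increasing x); auto; lra).
assert (L2 : s < F x (y + e)) by (rewrite <- H3; apply (F_increasing x); auto; lra).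
set (k := Rmin (s - F x (y - e)) (F x (y + e) - s) / 2).
assert (Hk : 0 < k) by (unfold k; apply Rdiv_lt_0_compat; [apply Rmin_glb_lt; lra|lra]).
assert (K1 : 2 * k <= s - F x (y - e)) by (unfold k;
  generalize (Rmin_l (s - F x (y - e)) (F x (y + e) - s)); lra).
assert (K2 : 2 * k <= F x (y + e) - s) by (unfold k;
  generalize (Rmin_r (s - F x (y - e)) (F x (y + e) - s)); lra).
assert (C1 := cont_F x (y - e) (proj1 (Hbox _ _ H1 Y1)) (mkposreal _ Hk)).
assert (C2 := cont_F x (y + e) (proj1 (Hbox _ _ H1 Y2)) (mkposreal _ Hk)).
destruct C1 as [d1 C1]; destruct C2 as [d2 C2]; simpl in C1, C2.
destruct (open_2d_in_box (x0, F x0 y0) a x s HV) as [d3 C3].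
assert (Hd : 0 < Rmin (Rmin d1 d2) (Rmin d3 k)).
{ repeat apply Rmin_glb_lt; auto using cond_pos. }
exists (mkposreal _ Hd); simpl; intros x' s' Hx' Hs'.
Rmin_bounds (Rmin (Rmin d1 d2) (Rmin d3 k)).
assert (HV' : V x' s') by (apply C3; lra).
destruct (impl_spec x' s' HV') as (G1 & G2 & G3).
assert (Z0 : forall z (d : posreal), Rabs (z - z) < d)
  by (intros; rewrite Rabs_diag; apply cond_pos).
assert (B1 := C1 x' (y - e) ltac:(lra) (Z0 _ _)); assert (B2 := C2 x' (y + e) ltac:(lra) (Z0 _ _)).
apply Rabs_def2 in B1; apply Rabs_def2 in B2.
assert (Hs2 : Rabs (s' - s) < k) by lra; apply Rabs_def2 in Hs2.
assert (I1' : y - e < impl x' s') by (apply (F_reflects_lt x'); auto; lra).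
assert (I2' : impl x' s' < y + e) by (apply (F_reflects_lt x'); auto; lra).
generalize (cond_pos eps); intros; apply Rabs_def1; lra.
Qed.

Lemma impl_pderiv : pderiv V impl
  (fun x s => - dx F x (impl x s) / dy F x (impl x s)) (fun x s => 1 / dy F x (impl x s)).
Proof.
apply pderiv_intro; intros x s HV.
destruct (impl_spec x s HV) as (H1 & H2 & H3); set (y := impl x s) in *.
destruct (Hbox x y H1 H2) as [Oxy Dpos].
assert (Z0 : forall z (d : posreal), Rabs (z - z) < d)
  by (intros; rewrite Rabs_diag; apply cond_pos).
assert (Bt : forall u v z (d : posreal), Rabs (v - u) < d -> Rmin u v <= z <= Rmax u v ->
  Rabs (z - u) < d).
{ intros u v z d Hd; apply Rabs_def2 in Hd; unfold Rmin, Rmax; destruct (Rle_dec _ _);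
    intros; apply Rabs_def1; lra. }
split.
- apply (is_derive_quotient (fun x => impl x s)); [lra|]; intros eps.
  destruct (cont_dxF x y Oxy eps) as [d1 C1]; destruct (cont_dyF x y Oxy eps) as [d2 C2].
  assert (Cy := locally_2d_locally_x _ x s (impl_continuous x s HV
    (mkposreal _ (Rmin_stable_in_posreal d1 d2)))).
  destruct Cy as [d3 C3];
    destruct (locally_2d_locally_x V x s (open_2d_in_box _ _ x s HV)) as [d4 C4].
  assert (Hd : 0 < Rmin d1 (Rmin d3 d4)) by (repeat apply Rmin_glb_lt; apply cond_pos).
  exists (mkposreal _ Hd); simpl; intros x' Hx';
    change (Rabs (x' - x) < Rmin d1 (Rmin d3 d4)) in Hx'.
  assert (M1 := Rmin_l d1 (Rmin d3 d4)); assert (M2 := Rmin_r d1 (Rmin d3 d4)).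
  assert (M3 := Rmin_l d3 d4); assert (M4 := Rmin_r d3 d4).
  assert (HV' : V x' s) by (apply C4; change (Rabs (x' - x) < d4); lra).
  assert (Hy' := C3 x' ltac:(change (Rabs (x' - x) < d3); lra)); simpl in Hy'; fold y in Hy'.
  Rmin_bounds (Rmin d1 d2).
  destruct (impl_spec x' s HV') as (G1 & G2 & G3); set (y' := impl x' s) in *.
  (* As F takes the value s at (x, y) and at (x', y'), a mean value in y at abscissa x and one in x
     at height y' express the difference quotient. *)
  destruct (mvt_y x y y' H1 H2 G2) as (z & Z1 & Z2 & Z3).
  destruct (mvt_x x x' y' H1 G1 G2) as (w & W1 & W2).
  exists (- dx F w y'), (dy F x z); split; [|split].
  + replace (- dx F w y' - - dx F x y) with (- (dx F w y' - dx F x y)) by ring.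
    rewrite Rabs_Ropp; apply C1; [|lra].
    apply Bt with x'; [lra|exact W1].
  + apply C2; [apply Z0|]; apply Bt with y'; [lra|exact Z1].
  + change (dy F x z * (y' - y) = - dx F w y' * (x' - x)); lra.
- apply (is_derive_quotient (fun s => impl x s)); [lra|]; intros eps.
  destruct (cont_dyF x y Oxy eps) as [d2 C2].
  assert (Cy := locally_2d_locally_y _ x s (impl_continuous x s HV d2)).
  destruct Cy as [d3 C3];
    destruct (locally_2d_locally_y V x s (open_2d_in_box _ _ x s HV)) as [d4 C4].
  exists (mkposreal _ (Rmin_stable_in_posreal d3 d4)); simpl; intros s' Hs'.
  change (Rabs (s' - s) < Rmin d3 d4) in Hs'.
  Rmin_bounds (Rmin d3 d4).
  assert (HV' : V x s') by (apply C4; change (Rabs (s' - s) < d4); lra).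
  assert (Hy' := C3 s' ltac:(change (Rabs (s' - s) < d3); lra)); fold y in Hy'.
  destruct (impl_spec x s' HV') as (G1 & G2 & G3); set (y' := impl x s') in *.
  destruct (mvt_y x y y' H1 H2 G2) as (z & Z1 & Z2 & Z3).
  exists 1, (dy F x z); split; [|split].
  + apply Z0.
  + apply C2; [apply Z0|]; apply Bt with y'; [lra|exact Z1].
  + change (dy F x z * (y' - y) = 1 * (s' - s)); lra.
Qed.

(** Bootstrap: the partials are smooth functions of x and of [impl] itself, so class n implies class
    n + 1. *)
Lemma impl_smooth : smooth_on V impl.
Proof.
assert (HV : open_2d V) by apply open_2d_in_box.
set (O' := in_box (x0, y0) b).
assert (HO' : open_2d O') by apply open_2d_in_box.
assert (SF' : smooth_on O' F).
{ apply smooth_on_incl with O; auto; intros x y [H1 H2]; apply Hbox; auto. }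
assert (D0 : forall x y, O' x y -> dy F x y <> 0).
{ intros x y [H1 H2]; apply Rgt_not_eq, Hbox; auto. }
assert (HVO : forall x s, V x s -> O' x (impl x s)).
{ intros x s H; destruct (impl_spec x s H) as (H1 & H2 & _); split; assumption. }
intros n; induction n as [|n IH].
- intros x s H; split; [apply impl_continuous; exact H|exact I].
- eapply class_on_S; [exact HV|intros; apply impl_continuous; assumption|exact impl_pderiv| |].
  + apply (class_on_comp V O' n (fun x y => - dx F x y / dy F x y) (fun x _ => x) impl);
      auto using class_on_x.
    apply smooth_on_div; auto with smooth.
  + apply (class_on_comp V O' n (fun x y => 1 / dy F x y) (fun x _ => x) impl);
      auto using class_on_x.
    apply smooth_on_div; auto with smooth.
Qed.

End Implicit.

(** The last clause records uniqueness from the (x, y) side, which later makes the inverse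
    two-sided. *)
Definition solves (O : R -> R -> Prop) (F : R -> R -> R) (x0 y0 a : R) (Y : R -> R -> R) : Prop :=
  smooth_on (in_box (x0, F x0 y0) a) Y /\
  (forall x s, in_box (x0, F x0 y0) a x s -> O x (Y x s) /\ F x (Y x s) = s) /\
  (exists r, 0 < r /\ forall x y, in_box (x0, y0) r x y ->
     in_box (x0, F x0 y0) a x (F x y) /\ Y x (F x y) = y).

Lemma implicit_function_pos O F x0 y0 : open_2d O -> smooth_on O F -> O x0 y0 ->
  0 < dy F x0 y0 -> exists a Y, 0 < a /\ solves O F x0 y0 a Y.
Proof.
intros HO SF H0 Hpos.
assert (Hloc : locally_2d (fun x y => O x y /\ 0 < dy F x y) x0 y0).
{ apply locally_2d_and; [apply HO, H0|].
  destruct (cont_dyF O F SF x0 y0 H0 (mkposreal _ Hpos)) as [d Hd]; simpl in Hd.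
  exists d; intros u v Hu Hv; specialize (Hd u v Hu Hv); apply Rabs_def2 in Hd; lra. }
destruct Hloc as [[b Hb] Hbox]; simpl in Hbox.
assert (Bb : forall z, Rabs z < b -> Rabs (y0 + z - y0) < b)
  by (intros z; replace (y0 + z - y0) with z by ring; auto).
assert (Zx : Rabs (x0 - x0) < b) by (rewrite Rabs_diag; exact Hb).
assert (Zy : Rabs (y0 - y0) < b) by (rewrite Rabs_diag; exact Hb).
assert (Y1 : Rabs (y0 - b / 2 - y0) < b) by (apply Rabs_def1; lra).
assert (Y2 : Rabs (y0 + b / 2 - y0) < b) by (apply Rabs_def1; lra).
assert (Inc := F_increasing O F x0 y0 SF b Hbox).
assert (L1 : F x0 (y0 - b / 2) < F x0 y0) by (apply Inc; auto; lra).
assert (L2 : F x0 y0 < F x0 (y0 + b / 2)) by (apply Inc; auto; lra).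
set (k := Rmin (F x0 y0 - F x0 (y0 - b / 2)) (F x0 (y0 + b / 2) - F x0 y0) / 2).
assert (Hk : 0 < k) by (unfold k; apply Rdiv_lt_0_compat; [apply Rmin_glb_lt; lra|lra]).
assert (K1 : 2 * k <= F x0 y0 - F x0 (y0 - b / 2))
  by (unfold k; generalize (Rmin_l (F x0 y0 - F x0 (y0 - b / 2)) (F x0 (y0 + b / 2) - F x0 y0));
    lra).
assert (K2 : 2 * k <= F x0 (y0 + b / 2) - F x0 y0)
  by (unfold k; generalize (Rmin_r (F x0 y0 - F x0 (y0 - b / 2)) (F x0 (y0 + b / 2) - F x0 y0));
    lra).
destruct (cont_F O F SF _ _ (proj1 (Hbox _ _ Zx Y1)) (mkposreal _ Hk)) as [d1 C1].
destruct (cont_F O F SF _ _ (proj1 (Hbox _ _ Zx Y2)) (mkposreal _ Hk)) as [d2 C2].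
simpl in C1, C2.
assert (Hd : 0 < Rmin (Rmin d1 d2) (Rmin b k)) by (repeat apply Rmin_glb_lt; auto using cond_pos).
(* With this size the end values of F in y move by less than k, and so does s, while they were at
   least 2 k apart from F(x0, y0): the root stays bracketed. *)
set (a := Rmin (Rmin d1 d2) (Rmin b k)) in *.
assert (M1 : a <= Rmin d1 d2) by apply Rmin_l; assert (M2 : a <= Rmin b k) by apply Rmin_r.
Rmin_bounds (Rmin d1 d2); Rmin_bounds (Rmin b k).
assert (Ha : 0 < a <= b) by lra.
assert (Z0 : forall z (d : posreal), Rabs (z - z) < d)
  by (intros; rewrite Rabs_diag; apply cond_pos).
assert (Hends : forall x s, Rabs (x - x0) < a -> Rabs (s - F x0 y0) < a ->
  F x (y0 - b / 2) < s < F x (y0 + b / 2)).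
{ intros x s Hx Hs.
  assert (B1 := C1 x (y0 - b / 2) ltac:(lra) (Z0 _ _)).
  assert (B2 := C2 x (y0 + b / 2) ltac:(lra) (Z0 _ _)).
  apply Rabs_def2 in B1; apply Rabs_def2 in B2; apply Rabs_def2 in Hs; lra. }
exists a, (impl F y0 b); split; [lra|split; [|split]].
- apply (impl_smooth O F x0 y0 SF b Hb Hbox a Ha Hends).
- intros x s H.
  destruct (impl_spec O F x0 y0 SF b Hb Hbox a Ha Hends x s H) as (G1 & G2 & G3).
  split; [apply Hbox; auto|exact G3].
- destruct (cont_F O F SF x0 y0 H0 (mkposreal a Hd)) as [d3 C3]; simpl in C3.
  assert (Hr : 0 < Rmin d3 a) by (apply Rmin_glb_lt; auto using cond_pos).
  exists (Rmin d3 a); split; [exact Hr|].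
  intros x y [Hx Hy]; simpl in Hx, Hy.
  Rmin_bounds (Rmin d3 a).
  assert (HV : in_box (x0, F x0 y0) a x (F x y)).
  { split; simpl; [lra|]; apply C3; lra. }
  split; [exact HV|].
  apply (impl_unique O F x0 y0 SF b Hb Hbox a Ha Hends); auto; lra.
Qed.

Lemma implicit_function O F x0 y0 : open_2d O -> smooth_on O F -> O x0 y0 ->
  dy F x0 y0 <> 0 -> exists a Y, 0 < a /\ solves O F x0 y0 a Y.
Proof.
intros HO SF H0 Hne.
destruct (Rtotal_order (dy F x0 y0) 0) as [L|[L|L]]; [|contradiction|].
- destruct (implicit_function_pos O (fun x y => - F x y) x0 y0) as (a & Y & Ha & S1 & S2 & r & Hr
    & S3);
    auto with smooth.
  { unfold dy; rewrite (Derive_opp (fun z => F x0 z)); unfold dy in L; lra. }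
  assert (B : forall x s, in_box (x0, F x0 y0) a x s -> in_box (x0, - F x0 y0) a x (- s)).
  { intros x s [H1 H2]; split; simpl in *; auto.
    replace (- s - - F x0 y0) with (- (s - F x0 y0)) by ring; rewrite Rabs_Ropp; auto. }
  exists a, (fun x s => Y x (- s)); split; [exact Ha|split; [|split]].
  + apply (smooth_on_comp _ (in_box (x0, - F x0 y0) a) Y (fun x _ => x) (fun _ s => - s));
      auto using open_2d_in_box.
    * intros n; apply class_on_x, open_2d_in_box.
    * apply smooth_on_opp; [apply open_2d_in_box|]; intros n; apply class_on_y, open_2d_in_box.
  + intros x s H; destruct (S2 x (- s) (B x s H)) as [G1 G2]; split; [exact G1|lra].
  + exists r; split; [exact Hr|]; intros x y H; destruct (S3 x y H) as [G1 G2].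
    split; [|exact G2].
    destruct G1 as [G1 G3]; split; simpl in *; [exact G1|].
    replace (- F x y - - F x0 y0) with (- (F x y - F x0 y0)) in G3 by ring.
    rewrite Rabs_Ropp in G3; exact G3.
- apply implicit_function_pos; auto.
Qed.

(** * Local inverses and flows *)

Lemma smooth_on_swap O F : smooth_on O F -> smooth_on (fun x y => O y x) (fun x y => F y x).
Proof.
intros H n x y Hxy.
assert (G : forall n F x y, ex_diff_n F n y x -> ex_diff_n (fun x y => F y x) n x y).
{ clear; induction n as [|n IH]; intros F x y H; destruct H as [Hc H];
    (split; [intros eps; destruct (Hc eps) as [d Hd]; exists d; auto|]); auto.
  destruct H as (H1 & H2 & H3 & H4).
  split; [exact H2|]; split; [exact H1|]; split;
    [exact (IH (dy F) x y H4)|exact (IH (dx F) x y H3)]. }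
apply G, H, Hxy.
Qed.

Lemma open_2d_swap O : open_2d O -> open_2d (fun x y => O y x).
Proof. intros H x y Hxy; destruct (H y x Hxy) as [d Hd]; exists d; auto. Qed.

Lemma continuous_near_box O (u v : R -> R -> R) x0 y0 a : smooth_on O u -> smooth_on O v ->
  open_2d O -> O x0 y0 -> 0 < a ->
  exists r, 0 < r /\ forall x y, in_box (x0, y0) r x y ->
    O x y /\ in_box (u x0 y0, v x0 y0) a (u x y) (v x y).
Proof.
intros Su Sv HO H0 Ha.
destruct (locally_2d_and _ _ _ _ (HO x0 y0 H0) (locally_2d_and _ _ _ _
  (class_on_cont O 0 u (Su 0%nat) x0 y0 H0 (mkposreal a Ha))
  (class_on_cont O 0 v (Sv 0%nat) x0 y0 H0 (mkposreal a Ha)))) as [d Hd].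
exists d; split; [apply cond_pos|]; intros x y [Hx Hy].
destruct (Hd x y Hx Hy) as (G1 & G2 & G3); split; [exact G1|split; assumption].
Qed.

Definition inverse_pair (O : R -> R -> Prop) (u v : R -> R -> R) (x0 y0 a : R)
    (F G : R -> R -> R) : Prop :=
  smooth_on (in_box (u x0 y0, v x0 y0) a) F /\ smooth_on (in_box (u x0 y0, v x0 y0) a) G /\
  (forall i s, in_box (u x0 y0, v x0 y0) a i s ->
     O (F i s) (G i s) /\ u (F i s) (G i s) = i /\ v (F i s) (G i s) = s) /\
  (exists r, 0 < r /\ forall x y, in_box (x0, y0) r x y ->
     O x y /\ in_box (u x0 y0, v x0 y0) a (u x y) (v x y) /\
     F (u x y) (v x y) = x /\ G (u x y) (v x y) = y).

(** v = s is solved for y, the result is substituted into u, and the resulting equation J(x, s) = i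
    is solved for x; the x-derivative of J times [dy v] is the Jacobian. *)
Lemma local_inverse_y O u v x0 y0 : open_2d O -> smooth_on O u -> smooth_on O v -> O x0 y0 ->
  dy v x0 y0 <> 0 -> dx u x0 y0 * dy v x0 y0 - dy u x0 y0 * dx v x0 y0 <> 0 ->
  exists a F G, 0 < a /\ inverse_pair O u v x0 y0 a F G.
Proof.
intros HO Su Sv H0 Hv Hj.
destruct (implicit_function O v x0 y0 HO Sv H0 Hv) as (a1 & Y & Ha1 & SY & Y1 & r1 & Hr1 & Y2).
set (V := in_box (x0, v x0 y0) a1) in *.
assert (HV : open_2d V) by apply open_2d_in_box.
assert (Y0 : V x0 (v x0 y0) /\ Y x0 (v x0 y0) = y0).
{ apply Y2; apply (in_box_center (x0, y0)); exact Hr1. }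
destruct Y0 as [V0 Y0].
set (J := fun x s => u x (Y x s)).
assert (Sx : smooth_on V (fun x _ => x)) by (intros n; apply class_on_x; exact HV).
assert (SJ : smooth_on V J).
{ apply (smooth_on_comp V O u (fun x _ => x) Y); auto; intros; apply Y1; assumption. }
assert (DY := smooth_on_pderiv V Y SY).
assert (DJ := pderiv_comp V O u (fun x _ => x) Y _ _ _ _ HO Su
  (fun x s H => proj1 (Y1 x s H)) (pderiv_x V) DY).
assert (Dv := pderiv_comp V O v (fun x _ => x) Y _ _ _ _ HO Sv
  (fun x s H => proj1 (Y1 x s H)) (pderiv_x V) DY).
assert (Hdv := pderiv_eq V HV _ _ _ _ _ _ (fun x s H => proj2 (Y1 x s H)) Dv (pderiv_y V)
  x0 (v x0 y0) V0).
cbv beta in Hdv; rewrite Y0 in Hdv; destruct Hdv as [Hdv _].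
assert (HJx : dx J x0 (v x0 y0) <> 0).
{ unfold J; rewrite (pderiv_dx V _ _ _ DJ x0 (v x0 y0) V0); rewrite Y0.
  intros E; apply Hj.
  transitivity (dy v x0 y0 * (dx u x0 y0 * 1 + dy u x0 y0 * dx Y x0 (v x0 y0))
    - dy u x0 y0 * (dx v x0 y0 * 1 + dy v x0 y0 * dx Y x0 (v x0 y0))); [ring|].
  rewrite E, Hdv; ring. }
destruct (implicit_function (fun s x => V x s) (fun s x => J x s) (v x0 y0) x0)
  as (a2 & X & Ha2 & SX & X1 & r2 & Hr2 & X2); auto using open_2d_swap, smooth_on_swap.
cbv beta in X1, X2, SX.
assert (EJ : J x0 (v x0 y0) = u x0 y0) by (unfold J; rewrite Y0; reflexivity).
rewrite EJ in X1, X2, SX.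
set (B := in_box (u x0 y0, v x0 y0) a2).
assert (HB : open_2d B) by apply open_2d_in_box.
assert (SXs : smooth_on B (fun i s => X s i)).
{ apply smooth_on_incl with (2 := smooth_on_swap _ _ SX); intros i s [G1 G2]; split; assumption. }
assert (BX : forall i s, B i s -> V (X s i) s /\ J (X s i) s = i).
{ intros i s [G1 G2]; apply X1; split; assumption. }
exists a2, (fun i s => X s i), (fun i s => Y (X s i) s); split; [exact Ha2|].
split; [exact SXs|split; [|split]].
- apply (smooth_on_comp B V Y (fun i s => X s i) (fun _ s => s)); auto.
  + intros i s H; apply BX; exact H.
  + intros n; apply class_on_y; exact HB.
- intros i s H; destruct (BX i s H) as [G1 G2]; destruct (Y1 _ _ G1) as [G3 G4].
  split; [exact G3|split; [exact G2|exact G4]].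
- destruct (continuous_near_box O (fun x _ => x) v x0 y0 r2) as (r3 & Hr3 & C3); auto.
  { intros n; apply class_on_x; exact HO. }
  exists (Rmin r1 r3); split; [apply Rmin_glb_lt; assumption|].
  intros x y [Hx Hy]; simpl in Hx, Hy.
  Rmin_bounds (Rmin r1 r3).
  destruct (Y2 x y) as [G1 G2]; [split; simpl; lra|].
  destruct (C3 x y) as [G3 [G4 G5]]; [split; simpl; lra|]; simpl in G4, G5.
  destruct (X2 (v x y) x) as [G6 G7]; [split; simpl; assumption|].
  assert (E : J x (v x y) = u x y) by (unfold J; rewrite G2; reflexivity).
  rewrite E in G6, G7; destruct G6 as [G6 G8].
  split; [exact G3|split; [split; assumption|]].
  rewrite G7; split; [reflexivity|exact G2].
Qed.

(** If [dy v] vanishes at the point then [dx v] does not, and x and y exchange roles. *)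
Lemma local_inverse O u v x0 y0 : open_2d O -> smooth_on O u -> smooth_on O v -> O x0 y0 ->
  dx u x0 y0 * dy v x0 y0 - dy u x0 y0 * dx v x0 y0 <> 0 ->
  exists a F G, 0 < a /\ inverse_pair O u v x0 y0 a F G.
Proof.
intros HO Su Sv H0 Hj.
destruct (Req_dec (dy v x0 y0) 0) as [E|E]; [|apply local_inverse_y; auto].
destruct (local_inverse_y (fun x y => O y x) (fun x y => u y x) (fun x y => v y x) y0 x0)
  as (a & F & G & Ha & S1 & S2 & I1' & r & Hr & I2');
  auto using open_2d_swap, smooth_on_swap.
- change (dx v x0 y0 <> 0); intros E'; apply Hj; rewrite E, E'; ring.
- change (dy u x0 y0 * dx v x0 y0 - dx u x0 y0 * dy v x0 y0 <> 0); lra.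
- exists a, G, F; split; [exact Ha|split; [exact S2|split; [exact S1|split]]].
  + intros i s H; apply I1'; exact H.
  + exists r; split; [exact Hr|]; intros x y [Hx Hy].
    destruct (I2' y x) as (G1 & G2 & G3 & G4); [split; assumption|]; auto.
Qed.

Lemma cramer_unique a b c d p q p' q' : a * d - b * c <> 0 ->
  a * p + b * q = a * p' + b * q' -> c * p + d * q = c * p' + d * q' -> p = p' /\ q = q'.
Proof.
intros Hd E1 E2; split; apply Rmult_eq_reg_l with (a * d - b * c); auto.
- lincomb (d * diff E1 - b * diff E2).
- lincomb (a * diff E2 - c * diff E1).
Qed.

(* In the coordinates (u, v) the field is c d/dv, so its flow is a translation. *)
Lemma flow_exists O (X Y u v : R -> R -> R) c p : open_2d O -> smooth_on O u -> smooth_on O v ->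
  O (fst p) (snd p) ->
  (forall x y, O x y -> dx u x y * dy v x y - dy u x y * dx v x y <> 0) ->
  (forall x y, O x y -> X x y * dx u x y + Y x y * dy u x y = 0) ->
  (forall x y, O x y -> X x y * dx v x y + Y x y * dy v x y = c) ->
  exists eps f g, 0 < eps /\ is_local_flow (VField X Y) p eps f g /\
    forall t x y, Rabs t < eps -> in_box p eps x y -> O (f t x y) (g t x y).
Proof.
destruct p as [x0 y0]; simpl; intros HO Su Sv H0 Hj HX1 HX2.
destruct (local_inverse O u v x0 y0 HO Su Sv H0 (Hj x0 y0 H0))
  as (a & F & G & Ha & SF & SG & I1' & r & Hr & I2').
set (B := in_box (u x0 y0, v x0 y0) a) in *.
assert (HB : open_2d B) by apply open_2d_in_box.
assert (Ha2 : 0 < a / 2) by lra.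
destruct (continuous_near_box O u v x0 y0 (a / 2) Su Sv HO H0 Ha2) as (r' & Hr' & C).
(* A time bound under which the translation by c t is at most a/2. *)
set (k := a / 2 / (Rabs c + 1)).
assert (Hc : 0 < Rabs c + 1) by (generalize (Rabs_pos c); lra).
assert (Hk : 0 < k) by (apply Rdiv_lt_0_compat; lra).
assert (Heps : 0 < Rmin (Rmin r r') k) by (repeat apply Rmin_glb_lt; assumption).
set (eps := Rmin (Rmin r r') k) in *.
assert (M1 : eps <= Rmin r r') by apply Rmin_l; assert (M2 : eps <= k) by apply Rmin_r.
Rmin_bounds (Rmin r r').
set (W := fun t x y => Rabs t < eps /\ in_box (x0, y0) eps x y).
assert (HW : open_3d W).
{ intros t x y [Ht Hxy].
  destruct (Rabs_lt_open t eps Ht) as [d1 D1]; destruct (open_2d_in_box _ _ x y Hxy) as [d2 D2].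
  exists (mkposreal _ (Rmin_stable_in_posreal d1 d2)); simpl; intros t' x' y' K1 K2 K3.
  Rmin_bounds (Rmin d1 d2).
  split; [apply D1; lra|apply D2; lra]. }
assert (WB : forall t x y, W t x y -> O x y /\ B (u x y) (v x y + c * t)).
{ intros t x y [Ht [Hx Hy]]; simpl in Hx, Hy.
  destruct (C x y) as [C1 [C2 C3]]; [split; simpl; lra|]; simpl in C2, C3.
  split; [exact C1|split; simpl; [lra|]].
  replace (v x y + c * t - v x0 y0) with ((v x y - v x0 y0) + c * t) by ring.
  eapply Rle_lt_trans; [apply Rabs_triang|].
  assert (Rabs (c * t) <= a / 2); [|lra].
  rewrite Rabs_mult.
  assert (Rabs t <= k) by lra.
  apply Rle_trans with ((Rabs c + 1) * k); [|unfold k; right; field; lra].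
  generalize (Rabs_pos c) (Rabs_pos t); intros; apply Rmult_le_compat; lra. }
assert (Sub : forall n, class3_on W n (fun t x y => u x y) /\
  class3_on W n (fun t x y => v x y + c * t)).
{ intros n; destruct (class3_on_xy W n HW) as [S1 S2].
  assert (WO : forall t x y, W t x y -> O x y) by (intros t x y H; apply (WB t x y H)).
  split; [|apply class3_on_plus; auto].
  - apply (class3_on_comp W HW O n u (fun _ x _ => x) (fun _ _ y => y)); auto.
  - apply (class3_on_comp W HW O n v (fun _ x _ => x) (fun _ _ y => y)); auto.
  - apply class3_on_mult; auto using class3_on_const, class3_on_t. }
exists eps, (fun t x y => F (u x y) (v x y + c * t)), (fun t x y => G (u x y) (v x y + c * t)).
split; [exact Heps|split].
- intros x y Hxy.
  destruct (I2' x y) as (_ & _ & E1 & E2); [destruct Hxy as [Hx Hy]; simpl in Hx, Hy; split;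
    simpl; lra|].
  replace (v x y + c * 0) with (v x y) by ring.
  split; [exact E1|split; [exact E2|]]; intros t Ht.
  assert (Hw : W t x y) by (split; assumption).
  destruct (WB t x y Hw) as [_ HBt].
  split; [|split].
  + intros n; apply (class3_on_comp W HW B n F (fun t x y => u x y) (fun t x y => v x y + c * t));
      auto; try apply Sub; intros; apply WB; assumption.
  + intros n; apply (class3_on_comp W HW B n G (fun t x y => u x y) (fun t x y => v x y + c * t));
      auto; try apply Sub; intros; apply WB; assumption.
  + destruct (I1' _ _ HBt) as (HO1 & _ & _).
    assert (DF := smooth_on_pderiv B F SF); assert (DG := smooth_on_pderiv B G SG).
    assert (Du := pderiv_comp B O u F G _ _ _ _ HO Su (fun i s H => proj1 (I1' i s H)) DF DG).
    assert (Dv := pderiv_comp B O v F G _ _ _ _ HO Sv (fun i s H => proj1 (I1' i s H)) DF DG).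
    assert (Hdu := proj2 (pderiv_eq B HB _ _ _ _ _ _ (fun i s H => proj1 (proj2 (I1' i s H)))
      Du (pderiv_x B) _ _ HBt)).
    assert (Hdv := proj2 (pderiv_eq B HB _ _ _ _ _ _ (fun i s H => proj2 (proj2 (I1' i s H)))
      Dv (pderiv_y B) _ _ HBt)).
    cbv beta in Hdu, Hdv.
    assert (L : is_derive (fun s => v x y + c * s) t c) by (auto_derive; auto; ring).
    assert (K0 : is_derive (fun _ : R => u x y) t 0)
      by apply is_derive_constR.
    assert (DFt := is_derive_comp_2d B 0 F (fun _ => u x y) (fun s => v x y + c * s) t 0 c HB
      (SF 1%nat) HBt K0 L).
    assert (DGt := is_derive_comp_2d B 0 G (fun _ => u x y) (fun s => v x y + c * s) t 0 c HB
      (SG 1%nat) HBt K0 L).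
    set (x' := F (u x y) (v x y + c * t)) in *; set (y' := G (u x y) (v x y + c * t)) in *.
    assert (E3 := HX1 x' y' HO1); assert (E4 := HX2 x' y' HO1).
    (* The velocity of the flow and the field have the same pairings with du and dv, which are
       independent. *)
    destruct (cramer_unique _ _ _ _ (dx F (u x y) (v x y + c * t) * 0 + dy F (u x y) (v x y + c *
      t) * c)
      (dx G (u x y) (v x y + c * t) * 0 + dy G (u x y) (v x y + c * t) * c) (X x' y') (Y x' y')
      (Hj x' y' HO1)) as [EX EY]; [| |cbn; rewrite <- EX, <- EY; split; assumption].
    * lincomb (c * diff Hdu - diff E3).
    * lincomb (c * diff Hdv - diff E4).
- intros t x y Ht Hxy; apply I1', (WB t x y); split; assumption.
Qed.

(** * Existence of solutions *)

Lemma plus_minus_cancel (a b : R) : a + b - a = b.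
Proof. ring. Qed.

Lemma plus_minus_plus (a b c : R) : a + b - (a + c) = b - c.
Proof. ring. Qed.

Lemma minus_plus_split (u c a b : R) : u - (c + a) = (u - (c + b)) + - (a - b).
Proof. ring. Qed.

Section Picard.

Variables (F : R -> R -> R -> R) (G : R -> R) (x0 y0 m K M h : R).
Hypothesis cont_F3 : forall (y z : R -> R) s, continuous y s -> continuous z s ->
  continuous (fun s => F s (y s) (z s)) s.
Hypothesis F_lipschitz : forall s y z y' z',
  Rabs (F s y z - F s y' z') <= K * (Rabs (y - y') + Rabs (z - z')).
Hypothesis G_lipschitz : forall z z', Rabs (G z - G z') <= Rabs (z - z').
Hypothesis F_bound : forall s y z, Rabs (F s y z) <= M.
Hypothesis G_bound : forall z, Rabs (G z) <= M.
Hypotheses (K0 : 0 <= K) (h0 : 0 < h) (hK : h * (K + 1) <= 1 / 2).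

(** Successive approximations for y' = G(z), z' = F(s, y, z). [G] will be a truncation of the
    identity, so that all bounds are global. *)
Fixpoint iter (n : nat) : (R -> R) * (R -> R) :=
  match n with
  | O => (fun _ => y0, fun _ => m)
  | S n => (fun x => y0 + RInt (fun s => G (snd (iter n) s)) x0 x,
            fun x => m + RInt (fun s => F s (fst (iter n) s) (snd (iter n) s)) x0 x)
  end.

Lemma cont_G (z : R -> R) s : continuous z s -> continuous (fun s => G (z s)) s.
Proof.
intros Hz; apply filterlim_locally; intros eps.
apply (filter_imp (fun s' => Rabs (z s' - z s) < eps)).
- intros s' H; change (Rabs (G (z s') - G (z s)) < eps).
  eapply Rle_lt_trans; [apply G_lipschitz|exact H].
- exact (proj1 (filterlim_locally _ _) Hz eps).
Qed.

Lemma RInt_const_plus_cont (c : R) (g : R -> R) (x : R) : (forall s, continuous g s) ->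
  is_derive (fun x => c + RInt g x0 x) x (g x).
Proof.
intros Hg; replace (g x) with (0 + g x) by ring.
apply (is_derive_plusR);
  [apply is_derive_constR|].
apply (is_derive_RInt g _ x0); [|apply Hg].
apply filter_forall; intros z; apply (RInt_correct (V := R_CompleteNormedModule)).
apply (ex_RInt_continuous (V := R_CompleteNormedModule)); intros; apply Hg.
Qed.

Lemma iter_cont n s : continuous (fst (iter n)) s /\ continuous (snd (iter n)) s.
Proof.
revert s; induction n as [|n IH]; intros s; simpl.
- split; apply continuous_const.
- split; apply (ex_derive_continuousR); eexists;
    apply RInt_const_plus_cont; intros s'.
  + apply cont_G, IH.
  + apply cont_F3; apply IH.
Qed.

Lemma segment_lt x s : Rabs (x - x0) < h -> Rmin x0 x <= s <= Rmax x0 x -> Rabs (s - x0) < h.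
Proof.
intros Hx; apply Rabs_def2 in Hx; unfold Rmin, Rmax; destruct (Rle_dec x0 x);
  intros; apply Rabs_def1; lra.
Qed.

Lemma ex_RInt_segment (g : R -> R) x : (forall s, Rabs (s - x0) < h -> continuous g s) ->
  Rabs (x - x0) < h -> ex_RInt g x0 x.
Proof.
intros Hg Hx; apply (ex_RInt_continuous (V := R_CompleteNormedModule)).
intros s Hs; apply Hg, (segment_lt x); assumption.
Qed.

Lemma RInt_bound (g : R -> R) x c : (forall s, Rabs (s - x0) < h -> continuous g s) ->
  0 <= c -> Rabs (x - x0) < h ->
  (forall s, Rabs (s - x0) < h -> Rabs (g s) <= c) -> Rabs (RInt g x0 x) <= h * c.
Proof.
intros Hg Hc Hx Hb.
assert (Hex := ex_RInt_segment g x Hg Hx).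
assert (Hin : forall s, Rmin x0 x <= s <= Rmax x0 x -> Rabs (g s) <= c).
{ intros s Hs; apply Hb, (segment_lt x); assumption. }
assert (Hgen : forall a b, a <= b -> Rabs (b - a) < h -> ex_RInt g a b ->
  (forall s, a <= s <= b -> Rabs (g s) <= c) -> Rabs (RInt g a b) <= h * c).
{ intros a b Hab Hh He Hs.
  eapply Rle_trans; [apply (abs_RInt_le_const g a b c Hab He Hs)|].
  rewrite Rabs_right in Hh by lra; apply Rmult_le_compat_r; lra. }
destruct (Rle_dec x0 x) as [L|L].
- apply Hgen; auto; intros; apply Hin; rewrite Rmin_left, Rmax_right; lra.
- rewrite <- (opp_RInt_swap (V := R_CompleteNormedModule)) by (apply ex_RInt_swap, Hex).
  change (Rabs (- RInt g x x0) <= h * c); rewrite Rabs_Ropp.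
  apply Hgen; [lra| |apply ex_RInt_swap, Hex|
    intros; apply Hin; rewrite Rmin_right, Rmax_left; lra].
  rewrite Rabs_minus_sym; exact Hx.
Qed.

Lemma RInt_diff_bound (g g' : R -> R) x c : (forall s, Rabs (s - x0) < h -> continuous g s) ->
  (forall s, Rabs (s - x0) < h -> continuous g' s) -> 0 <= c -> Rabs (x - x0) < h ->
  (forall s, Rabs (s - x0) < h -> Rabs (g s - g' s) <= c) ->
  Rabs (RInt g x0 x - RInt g' x0 x) <= h * c.
Proof.
intros Hg Hg' Hc Hx Hb.
rewrite <- (RInt_minus (V := R_CompleteNormedModule) g g') by (apply ex_RInt_segment; auto).
apply RInt_bound; auto.
intros s Hs; apply (continuous_minus (V := R_NormedModule)); auto.
Qed.

Definition gap n x := Rabs (fst (iter (S n)) x - fst (iter n) x)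
  + Rabs (snd (iter (S n)) x - snd (iter n) x).

Lemma M0 : 0 <= M.
Proof. eapply Rle_trans; [apply Rabs_pos|apply (G_bound 0)]. Qed.

(** The condition h (K + 1) <= 1/2 halves the bound on the gap at each step. *)
Lemma gap_bound n x : Rabs (x - x0) < h -> gap n x <= 2 * h * M * (1 / 2) ^ n.
Proof.
assert (HM := M0).
revert x; induction n as [|n IH]; intros x Hx.
- unfold gap; simpl.
  rewrite !plus_minus_cancel.
  assert (B1 : Rabs (RInt (fun _ => G m) x0 x) <= h * M).
  { apply RInt_bound; auto; intros; apply continuous_const. }
  assert (B2 : Rabs (RInt (fun s => F s y0 m) x0 x) <= h * M).
  { apply RInt_bound; auto; intros s _.
    apply (cont_F3 (fun _ => y0) (fun _ => m)); apply continuous_const. }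
  lra.
- set (c := 2 * h * M * (1 / 2) ^ n) in *.
  assert (Hc : 0 <= c).
  { unfold c; repeat apply Rmult_le_pos; try lra; apply pow_le; lra. }
  assert (Cy := fun n s => proj1 (iter_cont n s)); assert (Cz := fun n s => proj2 (iter_cont n s)).
  assert (B1 : Rabs (fst (iter (S (S n))) x - fst (iter (S n)) x) <= h * c).
  { change (Rabs (y0 + RInt (fun s => G (snd (iter (S n)) s)) x0 x
      - (y0 + RInt (fun s => G (snd (iter n) s)) x0 x)) <= h * c).
    rewrite plus_minus_plus.
    apply RInt_diff_bound; auto using cont_G.
    intros s Hs; eapply Rle_trans; [apply G_lipschitz|].
    eapply Rle_trans; [|apply (IH s Hs)]; unfold gap.
    generalize (Rabs_pos (fst (iter (S n)) s - fst (iter n) s)); lra. }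
  assert (B2 : Rabs (snd (iter (S (S n))) x - snd (iter (S n)) x) <= h * (K * c)).
  { change (Rabs (m + RInt (fun s => F s (fst (iter (S n)) s) (snd (iter (S n)) s)) x0 x
      - (m + RInt (fun s => F s (fst (iter n) s) (snd (iter n) s)) x0 x)) <= h * (K * c)).
    rewrite plus_minus_plus.
    apply RInt_diff_bound; auto; [apply Rmult_le_pos; auto|].
    intros s Hs; eapply Rle_trans; [apply F_lipschitz|].
    apply Rmult_le_compat_l; [exact K0|apply (IH s Hs)]. }
  unfold gap; apply Rle_trans with (h * (K + 1) * c); [lra|].
  apply Rle_trans with (1 / 2 * c); [apply Rmult_le_compat_r; lra|unfold c; simpl; lra].
Qed.

(** The sum of the gap bounds from index n on, so that estimates telescope. *)
Definition rate n := 4 * h * M * (1 / 2) ^ n.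

Lemma rate_pos n : 0 <= rate n.
Proof.
assert (HM := M0); unfold rate; repeat apply Rmult_le_pos; try lra; apply pow_le; lra.
Qed.

Lemma rate_lim : is_lim_seq rate 0.
Proof.
replace (Finite 0) with (Rbar_mult (4 * h * M) 0) by (simpl; f_equal; ring).
apply is_lim_seq_scal_l, is_lim_seq_geom; rewrite Rabs_right; lra.
Qed.

Lemma iter_cauchy n k x : Rabs (x - x0) < h ->
  Rabs (fst (iter (n + k)) x - fst (iter n) x) <= rate n - rate (n + k) /\
  Rabs (snd (iter (n + k)) x - snd (iter n) x) <= rate n - rate (n + k).
Proof.
intros Hx; induction k as [|k [IH1 IH2]].
- rewrite Nat.add_0_r; rewrite !Rabs_diag; lra.
- rewrite Nat.add_succ_r.
  assert (B := gap_bound (n + k) x Hx); unfold gap in B.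
  assert (Er : rate (n + k) - rate (S (n + k)) = 2 * h * M * (1 / 2) ^ (n + k))
    by (unfold rate; simpl; field).
  assert (P1 := Rabs_pos (fst (iter (S (n + k))) x - fst (iter (n + k)) x)).
  assert (P2 := Rabs_pos (snd (iter (S (n + k))) x - snd (iter (n + k)) x)).
  split.
  + replace (fst (iter (S (n + k))) x - fst (iter n) x)
      with ((fst (iter (S (n + k))) x - fst (iter (n + k)) x) + (fst (iter (n + k)) x - fst (iter
        n) x))
      by ring.
    eapply Rle_trans; [apply Rabs_triang|]; lra.
  + replace (snd (iter (S (n + k))) x - snd (iter n) x)
      with ((snd (iter (S (n + k))) x - snd (iter (n + k)) x) + (snd (iter (n + k)) x - snd (iter
        n) x))
      by ring.
    eapply Rle_trans; [apply Rabs_triang|]; lra.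
Qed.

Lemma limit_bound (u : nat -> R) : (forall n k, Rabs (u (n + k)%nat - u n) <= rate n) ->
  forall n, Rabs (real (Lim_seq u) - u n) <= rate n.
Proof.
intros Hu.
assert (Hc : ex_finite_lim_seq u).
{ apply ex_lim_seq_cauchy_corr; intros eps.
  assert (Heps : 0 < eps / 2) by (generalize (cond_pos eps); lra).
  destruct (proj2 (is_lim_seq_spec rate 0) rate_lim (mkposreal _ Heps)) as [N HN]; simpl in HN.
  specialize (HN N (le_n N)); rewrite Rminus_0_r, Rabs_right in HN by (apply Rle_ge, rate_pos).
  assert (Hk : forall n, (N <= n)%nat -> Rabs (u n - u N) <= rate N).
  { intros n Hn; replace n with (N + (n - N))%nat by lia; apply Hu. }
  exists N; intros p q Hp Hq.
  replace (u p - u q) with ((u p - u N) + - (u q - u N)) by ring.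
  eapply Rle_lt_trans; [apply Rabs_triang|]; rewrite Rabs_Ropp.
  generalize (Hk p Hp) (Hk q Hq); lra. }
destruct Hc as [l Hl]; rewrite (is_lim_seq_unique _ _ Hl); simpl; intros n.
assert (Hl' : is_lim_seq (fun k => u (k + n)%nat - u n) (l - u n)).
{ apply (is_lim_seq_minus' (fun k => u (k + n)%nat) (fun _ => u n)).
  - apply (is_lim_seq_incr_n u n), Hl.
  - apply is_lim_seq_const. }
apply is_lim_seq_abs in Hl'.
apply (is_lim_seq_le _ (fun _ => rate n) _ (rate n) (fun k => eq_ind_r (fun i => Rabs (u i - u n)
  <= rate n)
  (Hu n k) (Nat.add_comm k n)) Hl').
apply is_lim_seq_const.
Qed.

Definition ysol x := real (Lim_seq (fun n => fst (iter n) x)).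
Definition zsol x := real (Lim_seq (fun n => snd (iter n) x)).

Lemma sol_bound n x : Rabs (x - x0) < h ->
  Rabs (ysol x - fst (iter n) x) <= rate n /\ Rabs (zsol x - snd (iter n) x) <= rate n.
Proof.
intros Hx; split.
- apply (limit_bound (fun n => fst (iter n) x)); intros p k.
  destruct (iter_cauchy p k x Hx) as [H _]; generalize (rate_pos (p + k)); lra.
- apply (limit_bound (fun n => snd (iter n) x)); intros p k.
  destruct (iter_cauchy p k x Hx) as [_ H]; generalize (rate_pos (p + k)); lra.
Qed.

Lemma rate_small (eps : R) : 0 < eps -> exists n, rate n < eps.
Proof.
intros He; destruct (proj2 (is_lim_seq_spec rate 0) rate_lim (mkposreal _ He)) as [N HN].
specialize (HN N (le_n N)); simpl in HN.
rewrite Rminus_0_r, Rabs_right in HN by (apply Rle_ge, rate_pos); exists N; exact HN.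
Qed.

Lemma uniform_limit_cont (u : nat -> R -> R) (l : R -> R) x : Rabs (x - x0) < h ->
  (forall n s, continuous (u n) s) ->
  (forall n s, Rabs (s - x0) < h -> Rabs (l s - u n s) <= rate n) -> continuous l x.
Proof.
intros Hx Hu Hl; apply filterlim_locally; intros eps.
assert (He : 0 < eps / 3) by (generalize (cond_pos eps); lra).
destruct (rate_small _ He) as [n Hn].
assert (Hd : 0 < h - Rabs (x - x0)) by lra.
assert (C := proj1 (filterlim_locally _ _) (Hu n x) (mkposreal _ He)).
apply (filter_imp (fun s => ball (u n x) (mkposreal _ He) (u n s) /\
  Rabs (s - x) < h - Rabs (x - x0))).
- intros s [H1 H2]; change (Rabs (l s - l x) < eps).
  change (Rabs (u n s - u n x) < eps / 3) in H1.
  assert (Hs : Rabs (s - x0) < h).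
  { replace (s - x0) with ((s - x) + (x - x0)) by ring.
    generalize (Rabs_triang (s - x) (x - x0)); lra. }
  assert (B1 := Hl n s Hs); assert (B2 := Hl n x Hx).
  replace (l s - l x) with ((l s - u n s) + ((u n s - u n x) + - (l x - u n x))) by ring.
  assert (T1 := Rabs_triang (l s - u n s) ((u n s - u n x) + - (l x - u n x))).
  assert (T2 := Rabs_triang (u n s - u n x) (- (l x - u n x))).
  rewrite Rabs_Ropp in T2; lra.
- apply filter_and; [exact C|].
  exists (mkposreal _ Hd); intros s Hs; exact Hs.
Qed.

Lemma sol_cont x : Rabs (x - x0) < h -> continuous ysol x /\ continuous zsol x.
Proof.
intros Hx; split.
- apply (uniform_limit_cont (fun n => fst (iter n))); auto; intros.
  + apply iter_cont.
  + apply sol_bound; assumption.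
- apply (uniform_limit_cont (fun n => snd (iter n))); auto; intros.
  + apply iter_cont.
  + apply sol_bound; assumption.
Qed.

Lemma vanishes_of_rate (a c : R) : (forall n, Rabs a <= c * rate n) -> 0 <= c -> a = 0.
Proof.
intros H Hc; destruct (Req_dec a 0) as [E|E]; [exact E|exfalso].
assert (Ha := Rabs_pos_lt a E).
destruct (rate_small (Rabs a / (c + 1))) as [n Hn]; [apply Rdiv_lt_0_compat; lra|].
specialize (H n); assert (P := rate_pos n).
apply (Rmult_lt_compat_l (c + 1)) in Hn; [|lra].
replace ((c + 1) * (Rabs a / (c + 1))) with (Rabs a) in Hn by (field; lra); nra.
Qed.

(** For every n both sides are within a fixed multiple of [rate n] of each other, by comparison with
    the iterates. *)
Lemma sol_integral x : Rabs (x - x0) < h ->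
  ysol x = y0 + RInt (fun s => G (zsol s)) x0 x /\
  zsol x = m + RInt (fun s => F s (ysol s) (zsol s)) x0 x.
Proof.
intros Hx.
assert (Cy := fun n s (_ : Rabs (s - x0) < h) => proj1 (iter_cont n s)).
assert (Cz := fun n s (_ : Rabs (s - x0) < h) => proj2 (iter_cont n s)).
split; apply Rminus_diag_uniq.
- apply vanishes_of_rate with (1 + h); [|lra]; intros n.
  destruct (sol_bound (S n) x Hx) as [B _].
  assert (B' : Rabs (RInt (fun s => G (zsol s)) x0 x - RInt (fun s => G (snd (iter n) s)) x0 x)
    <= h * rate n).
  { apply RInt_diff_bound; [| |apply rate_pos|exact Hx|].
    - intros s Hs; apply cont_G, (sol_cont s Hs).
    - intros s Hs; apply cont_G, (Cz n s Hs).
    - intros s Hs; eapply Rle_trans; [apply G_lipschitz|apply (sol_bound n s Hs)]. }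
  simpl in B.
  assert (R1 : rate (S n) <= rate n)
    by (unfold rate; simpl; assert (P := rate_pos n); unfold rate in P; lra).
  set (a := RInt (fun s => G (zsol s)) x0 x) in *.
  set (b := RInt (fun s => G (snd (iter n) s)) x0 x) in *.
  rewrite (minus_plus_split _ y0 a b).
  eapply Rle_trans; [apply Rabs_triang|]; rewrite Rabs_Ropp; lra.
- apply vanishes_of_rate with (1 + h * (2 * K)); [|nra]; intros n.
  destruct (sol_bound (S n) x Hx) as [_ B].
  assert (B' : Rabs (RInt (fun s => F s (ysol s) (zsol s)) x0 x
    - RInt (fun s => F s (fst (iter n) s) (snd (iter n) s)) x0 x) <= h * (K * (2 * rate n))).
  { apply RInt_diff_bound; [| | |exact Hx|].
    - intros s Hs; apply cont_F3; apply (sol_cont s Hs).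
    - intros s Hs; apply cont_F3; [apply (Cy n s Hs)|apply (Cz n s Hs)].
    - assert (P := rate_pos n); apply Rmult_le_pos; lra.
    - intros s Hs; eapply Rle_trans; [apply F_lipschitz|].
      destruct (sol_bound n s Hs) as [B1 B2]; apply Rmult_le_compat_l; lra. }
  simpl in B.
  assert (R1 : rate (S n) <= rate n)
    by (unfold rate; simpl; assert (P := rate_pos n); unfold rate in P; lra).
  set (a := RInt (fun s => F s (ysol s) (zsol s)) x0 x) in *.
  set (b := RInt (fun s => F s (fst (iter n) s) (snd (iter n) s)) x0 x) in *.
  rewrite (minus_plus_split _ m a b).
  eapply Rle_trans; [apply Rabs_triang|]; rewrite Rabs_Ropp; lra.
Qed.

Theorem picard : exists y z : R -> R, y x0 = y0 /\ z x0 = m /\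
  forall x, Rabs (x - x0) < h ->
    is_derive y x (G (z x)) /\ is_derive z x (F x (y x) (z x)) /\
    Rabs (y x - y0) <= h * M /\ Rabs (z x - m) <= h * M.
Proof.
assert (HM := M0).
assert (Hopen : forall x, Rabs (x - x0) < h -> locally x (fun x => Rabs (x - x0) < h)).
{ intros x Hx; assert (Hd : 0 < h - Rabs (x - x0)) by lra.
  exists (mkposreal _ Hd); intros s Hs; change (Rabs (s - x) < h - Rabs (x - x0)) in Hs.
  replace (s - x0) with ((s - x) + (x - x0)) by ring.
  generalize (Rabs_triang (s - x) (x - x0)); lra. }
assert (D : forall (u g : R -> R) c, (forall s, Rabs (s - x0) < h -> continuous g s) ->
  (forall x, Rabs (x - x0) < h -> u x = c + RInt g x0 x) ->
  forall x, Rabs (x - x0) < h -> is_derive u x (g x)).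
{ intros u g c Hg Hu x Hx.
  apply is_derive_ext_loc with (fun x => c + RInt g x0 x).
  { apply (filter_imp (fun x => Rabs (x - x0) < h)); [intros; symmetry; apply Hu;
      assumption|auto]. }
  replace (g x) with (0 + g x) by ring.
  apply (is_derive_plusR);
    [apply is_derive_constR|].
  apply (is_derive_RInt g _ x0); [|apply Hg, Hx].
  apply (filter_imp (fun x => Rabs (x - x0) < h)); [|auto].
  intros s Hs; apply (RInt_correct (V := R_CompleteNormedModule)), ex_RInt_segment; auto. }
assert (CG : forall s, Rabs (s - x0) < h -> continuous (fun s => G (zsol s)) s)
  by (intros s Hs; apply cont_G, (sol_cont s Hs)).
assert (CF : forall s, Rabs (s - x0) < h -> continuous (fun s => F s (ysol s) (zsol s)) s)
  by (intros s Hs; apply cont_F3; apply (sol_cont s Hs)).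
assert (Z0 : Rabs (x0 - x0) < h) by (rewrite Rabs_diag; exact h0).
exists ysol, zsol.
destruct (sol_integral x0 Z0) as [E1 E2].
rewrite (RInt_point (V := R_CompleteNormedModule)) in E1, E2.
split; [rewrite E1; apply Rplus_0_r|]; split; [rewrite E2; apply Rplus_0_r|].
intros x Hx; split; [|split; [|split]].
- apply (D ysol (fun s => G (zsol s)) y0); auto; intros; apply sol_integral; assumption.
- apply (D zsol (fun s => F s (ysol s) (zsol s)) m); auto; intros; apply sol_integral; assumption.
- rewrite (proj1 (sol_integral x Hx)).
  rewrite plus_minus_cancel.
  apply RInt_bound; auto.
- rewrite (proj2 (sol_integral x Hx)).
  rewrite plus_minus_cancel.
  apply RInt_bound; auto.
Qed.

End Picard.

(** * Truncation and local existence for the equation *)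

Definition clamp (a r x : R) : R := Rmax (a - r) (Rmin (a + r) x).

Lemma clamp_near a r x : 0 <= r -> Rabs (clamp a r x - a) <= r.
Proof.
intros Hr; unfold clamp, Rmax, Rmin; apply Rabs_le;
  destruct (Rle_dec (a + r) x); destruct (Rle_dec _ _); lra.
Qed.

Lemma clamp_id a r x : Rabs (x - a) <= r -> clamp a r x = x.
Proof.
intros H; apply Rabs_le_between in H; unfold clamp, Rmax, Rmin.
destruct (Rle_dec (a + r) x); destruct (Rle_dec _ _); lra.
Qed.

Lemma clamp_lipschitz a r x x' : 0 <= r -> Rabs (clamp a r x - clamp a r x') <= Rabs (x - x').
Proof.
intros Hr; assert (H := Rle_abs (x - x')); assert (H' := Rle_abs (- (x - x'))).
rewrite Rabs_Ropp in H'; unfold clamp, Rmax, Rmin; apply Rabs_le.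
destruct (Rle_dec (a + r) x); destruct (Rle_dec (a + r) x');
  repeat match goal with |- context [Rle_dec ?u ?v] => destruct (Rle_dec u v) end; lra.
Qed.

Lemma clamp_continuous a r (y : R -> R) s : 0 <= r -> continuous y s ->
  continuous (fun s => clamp a r (y s)) s.
Proof.
intros Hr Hy; apply filterlim_locally; intros eps.
apply (filter_imp (fun s' => Rabs (y s' - y s) < eps)).
- intros s' H; change (Rabs (clamp a r (y s') - clamp a r (y s)) < eps).
  eapply Rle_lt_trans; [apply clamp_lipschitz, Hr|exact H].
- exact (proj1 (filterlim_locally _ _) Hy eps).
Qed.

(** The global hypotheses of [picard], in a form stable under sums and products. Boundedness travels
    with the Lipschitz condition because the Lipschitz constant of a product involves the bounds. *)
Definition tame (f : R -> R -> R -> R) : Prop :=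
  (exists M K, 0 <= K /\ (forall s y z, Rabs (f s y z) <= M) /\
    forall s y z y' z', Rabs (f s y z - f s y' z') <= K * (Rabs (y - y') + Rabs (z - z'))) /\
  (forall (y z : R -> R) s, continuous y s -> continuous z s ->
    continuous (fun s => f s (y s) (z s)) s).

Lemma tame_const c : tame (fun _ _ _ => c).
Proof.
split; [|intros; apply continuous_const].
exists (Rabs c), 0; split; [lra|split; [intros; lra|]].
intros; rewrite Rabs_diag; lra.
Qed.

Lemma tame_plus f g : tame f -> tame g -> tame (fun s y z => f s y z + g s y z).
Proof.
intros [(M & K & K0 & B & L) C] [(M' & K' & K0' & B' & L') C']; split.
- exists (M + M'), (K + K'); split; [lra|split].
  + intros; eapply Rle_trans; [apply Rabs_triang|]; apply Rplus_le_compat; auto.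
  + intros s y z y' z'; specialize (L s y z y' z'); specialize (L' s y z y' z').
    replace (f s y z + g s y z - (f s y' z' + g s y' z'))
      with ((f s y z - f s y' z') + (g s y z - g s y' z')) by ring.
    eapply Rle_trans; [apply Rabs_triang|]; lra.
- intros; apply (continuous_plus (V := R_NormedModule)); auto.
Qed.

Lemma tame_mult f g : tame f -> tame g -> tame (fun s y z => f s y z * g s y z).
Proof.
intros [(M & K & K0 & B & L) C] [(M' & K' & K0' & B' & L') C']; split.
- assert (HM : 0 <= M) by (eapply Rle_trans; [apply Rabs_pos|apply (B 0 0 0)]).
  assert (HM' : 0 <= M') by (eapply Rle_trans; [apply Rabs_pos|apply (B' 0 0 0)]).
  exists (M * M'), (K * M' + M * K'); split; [nra|split].
  + intros; rewrite Rabs_mult; apply Rmult_le_compat; auto using Rabs_pos.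
  + intros s y z y' z'; specialize (L s y z y' z'); specialize (L' s y z y' z').
    replace (f s y z * g s y z - f s y' z' * g s y' z')
      with ((f s y z - f s y' z') * g s y z + f s y' z' * (g s y z - g s y' z')) by ring.
    eapply Rle_trans; [apply Rabs_triang|]; rewrite !Rabs_mult.
    set (d := Rabs (y - y') + Rabs (z - z')) in *.
    assert (H1 : Rabs (f s y z - f s y' z') * Rabs (g s y z) <= K * d * M')
      by (apply Rmult_le_compat; auto using Rabs_pos).
    assert (H2 : Rabs (f s y' z') * Rabs (g s y z - g s y' z') <= M * (K' * d))
      by (apply Rmult_le_compat; auto using Rabs_pos).
    lra.
- intros; apply (continuous_mult (K := R_AbsRing)); auto.
Qed.

Lemma tame_clamp a r : 0 <= r -> tame (fun _ _ z => clamp a r z).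
Proof.
intros Hr; split.
- exists (Rabs a + r), 1; split; [lra|split].
  + intros _ _ z; assert (H := clamp_near a r z Hr).
    replace (clamp a r z) with ((clamp a r z - a) + a) by ring.
    generalize (Rabs_triang (clamp a r z - a) a); lra.
  + intros _ y z y' z'; generalize (clamp_lipschitz a r z z' Hr) (Rabs_pos (y - y')); lra.
- intros; apply clamp_continuous; assumption.
Qed.

(** Truncation confines the arguments to a box where f and [dy f] are bounded; the mean value
    theorem then gives the Lipschitz constant. *)
Lemma tame_smooth O f x0 y0 : open_2d O -> smooth_on O f -> O x0 y0 ->
  exists r0, 0 < r0 /\ forall r, 0 < r < r0 ->
    tame (fun s y _ => f (clamp x0 r s) (clamp y0 r y)).
Proof.
intros HO Sf H0.
destruct (continuous_near_box O f (dy f) x0 y0 1) as (r0 & Hr0 & H);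
  auto using smooth_on_dy, Rlt_0_1.
exists r0; split; [exact Hr0|]; intros r Hr.
assert (Hcl : forall s y, in_box (x0, y0) r0 (clamp x0 r s) (clamp y0 r y)).
{ intros s y; split; simpl; (eapply Rle_lt_trans; [apply clamp_near|]); lra. }
split.
- exists (Rabs (f x0 y0) + 1), (Rabs (dy f x0 y0) + 1).
  split; [generalize (Rabs_pos (dy f x0 y0)); lra|split].
  + intros s y _; destruct (H _ _ (Hcl s y)) as [_ [H1 _]]; simpl in H1.
    generalize (Rabs_triang (f (clamp x0 r s) (clamp y0 r y) - f x0 y0) (f x0 y0)).
    replace (f (clamp x0 r s) (clamp y0 r y) - f x0 y0 + f x0 y0)
      with (f (clamp x0 r s) (clamp y0 r y)) by ring; lra.
  + intros s y z y' z'.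
    destruct (MVT_gen (fun v => f (clamp x0 r s) v) (clamp y0 r y') (clamp y0 r y)
      (fun v => dy f (clamp x0 r s) v)) as (v & V1 & V2).
    * intros v Hv; apply (pderiv_elim O f _ _ _ v (smooth_on_pderiv O f Sf)), H.
      assert (G1 := clamp_near y0 r y' ltac:(lra)); assert (G2 := clamp_near y0 r y ltac:(lra)).
      apply Rabs_le_between in G1; apply Rabs_le_between in G2.
      destruct (Hcl s y) as [G3 _]; split; [exact G3|]; simpl.
      revert Hv; unfold Rmin, Rmax; destruct (Rle_dec _ _); intros; apply Rabs_def1; lra.
    * intros v Hv; apply (continuity_pt_slices f), (class_on_cont O 0 f (Sf 0%nat)), H.
      assert (G1 := clamp_near y0 r y' ltac:(lra)); assert (G2 := clamp_near y0 r y ltac:(lra)).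
      apply Rabs_le_between in G1; apply Rabs_le_between in G2.
      destruct (Hcl s y) as [G3 _]; split; [exact G3|]; simpl.
      revert Hv; unfold Rmin, Rmax; destruct (Rle_dec _ _); intros; apply Rabs_def1; lra.
    * rewrite V2, Rabs_mult; apply Rmult_le_compat; auto using Rabs_pos.
      -- assert (G : in_box (x0, y0) r0 (clamp x0 r s) v).
         { assert (G1 := clamp_near y0 r y' ltac:(lra));
             assert (G2 := clamp_near y0 r y ltac:(lra)).
           apply Rabs_le_between in G1; apply Rabs_le_between in G2.
           destruct (Hcl s y) as [G3 _]; split; [exact G3|]; simpl.
           revert V1; unfold Rmin, Rmax; destruct (Rle_dec _ _); intros; apply Rabs_def1; lra. }
         destruct (H _ _ G) as [_ [_ H2]]; simpl in H2.
         generalize (Rabs_triang (dy f (clamp x0 r s) v - dy f x0 y0) (dy f x0 y0)).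
         replace (dy f (clamp x0 r s) v - dy f x0 y0 + dy f x0 y0)
           with (dy f (clamp x0 r s) v) by ring; lra.
      -- generalize (clamp_lipschitz y0 r y y' ltac:(lra)) (Rabs_pos (z - z')); lra.
- intros y z s Hy _.
  assert (C := class_on_cont O 0 f (Sf 0%nat) _ _ (proj1 (H _ _ (Hcl s (y s))))).
  apply (continuous_comp_2 (fun s => clamp x0 r s) (fun s => clamp y0 r (y s)) f).
  + apply (clamp_continuous x0 r (fun s => s)); [lra|apply continuous_id].
  + apply clamp_continuous; [lra|exact Hy].
  + apply (continuity_2d_pt_filterlim f); exact C.
Qed.

(** The truncated equation meets the hypotheses of [picard]. On a short interval its solution stays
    where every truncation is the identity, and there it solves the given equation. *)
Lemma solution_exists e O x0 y0 m rho : open_2d O -> O x0 y0 -> 0 < rho ->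
  smooth_on O (coP e) -> smooth_on O (coQ e) -> smooth_on O (coR e) -> smooth_on O (coS e) ->
  exists h u, 0 < h <= rho /\ is_solution e (x0 - h) (x0 + h) u /\
    u x0 = y0 /\ Derive u x0 = m /\
    forall x, x0 - h < x < x0 + h -> Rabs (u x - y0) < rho.
Proof.
intros HO H0 Hrho SP SQ SR SS.
destruct (tame_smooth O (coP e) x0 y0 HO SP H0) as (r1 & Hr1 & T1).
destruct (tame_smooth O (coQ e) x0 y0 HO SQ H0) as (r2 & Hr2 & T2).
destruct (tame_smooth O (coR e) x0 y0 HO SR H0) as (r3 & Hr3 & T3).
destruct (tame_smooth O (coS e) x0 y0 HO SS H0) as (r4 & Hr4 & T4).
set (r := Rmin (Rmin (Rmin r1 r2) (Rmin r3 r4)) rho / 2).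
Rmin_bounds (Rmin (Rmin (Rmin r1 r2) (Rmin r3 r4)) rho).
assert (Hr : 0 < r).
{ unfold r; apply Rdiv_lt_0_compat; [repeat apply Rmin_glb_lt; assumption|lra]. }
assert (Hr' : 2 * r = Rmin (Rmin (Rmin r1 r2) (Rmin r3 r4)) rho) by (unfold r; field).
set (F := fun s y z =>
  coP e (clamp x0 r s) (clamp y0 r y)
  + 3 * coQ e (clamp x0 r s) (clamp y0 r y) * clamp m r z
  + 3 * coR e (clamp x0 r s) (clamp y0 r y) * (clamp m r z * clamp m r z)
  + coS e (clamp x0 r s) (clamp y0 r y) * (clamp m r z * (clamp m r z * clamp m r z))).
assert (Tz : tame (fun _ _ z => clamp m r z)) by (apply tame_clamp; lra).
assert (TF : tame F).
{ unfold F; repeat first [apply tame_plus | apply tame_mult with (g := fun _ _ z => clamp m r z)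
    | apply tame_mult with (g := fun _ _ z => clamp m r z * clamp m r z)
    | apply tame_mult with (g := fun _ _ z => clamp m r z * (clamp m r z * clamp m r z))
    | apply tame_mult with (f := fun _ _ z => clamp m r z) | apply tame_mult with (f := fun _ _ _
      => 3)];
    first [apply Tz | apply tame_const | apply T1; lra | apply T2; lra | apply T3;
      lra | apply T4; lra | idtac]. }
destruct TF as [(MF & K & K0 & BF & LF) CF].
destruct Tz as [(MG & _ & _ & BG & _) _].
assert (HM : 0 <= MF) by (eapply Rle_trans; [apply Rabs_pos|apply (BF 0 0 0)]).
assert (HM' : 0 <= MG) by (eapply Rle_trans; [apply Rabs_pos|apply (BG 0 0 0)]).
set (M := MF + MG + 1).
(* The three bounds keep x inside the truncation, make the iteration contract, and let y and z move
   by at most r. *)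
set (h := Rmin (Rmin r (1 / 2 / (K + 1))) (r / M)).
assert (Hh : 0 < h).
{ unfold h; repeat apply Rmin_glb_lt; auto; unfold M; repeat apply Rdiv_lt_0_compat; lra. }
assert (N1 : h <= Rmin r (1 / 2 / (K + 1))) by apply Rmin_l;
  assert (N2 : h <= r / M) by apply Rmin_r.
Rmin_bounds (Rmin r (1 / 2 / (K + 1))).
assert (HhM : h * M <= r).
{ replace r with (r / M * M) by (field; unfold M; lra); apply Rmult_le_compat_r; [unfold M;
    lra|exact N2]. }
assert (HhK : h * (K + 1) <= 1 / 2).
{ replace (1 / 2) with (1 / 2 / (K + 1) * (K + 1)) by (field; lra); apply Rmult_le_compat_r; lra. }
destruct (picard F (clamp m r) x0 y0 m K M h) as (u & z & U0 & Z0 & D); auto.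
- intros; apply clamp_lipschitz; lra.
- intros; eapply Rle_trans; [apply BF|unfold M; lra].
- intros; eapply Rle_trans; [apply (BG 0 0)|unfold M; lra].
- assert (Hin : forall x, x0 - h < x < x0 + h -> Rabs (x - x0) < h)
    by (intros; apply Rabs_def1; lra).
  assert (Du : forall x, Rabs (x - x0) < h -> is_derive u x (z x)).
  { intros x Hx; destruct (D x Hx) as (D1 & _ & _ & D4).
    rewrite clamp_id in D1 by lra; exact D1. }
  assert (DDu : forall x, Rabs (x - x0) < h -> locally x (fun s => Derive u s = z s)).
  { intros x Hx; assert (Hd : 0 < h - Rabs (x - x0)) by lra.
    exists (mkposreal _ Hd); intros s Hs; change (Rabs (s - x) < h - Rabs (x - x0)) in Hs.
    apply is_derive_unique, Du.
    replace (s - x0) with ((s - x) + (x - x0)) by ring.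
    generalize (Rabs_triang (s - x) (x - x0)); lra. }
  assert (Zx : Rabs (x0 - x0) < h) by (rewrite Rabs_diag; exact Hh).
  exists h, u; split; [lra|split; [|split; [exact U0|split]]].
  + intros x Hx; apply Hin in Hx; split; [eexists; apply Du, Hx|].
    apply is_derive_ext_loc with z.
    { apply (filter_imp (fun s => Derive u s = z s)); [intros; symmetry;
        assumption|apply DDu, Hx]. }
    rewrite (is_derive_unique _ _ _ (Du x Hx)).
    destruct (D x Hx) as (_ & D2 & D3 & D4).
    unfold F in D2; rewrite !clamp_id in D2 by lra.
    match goal with |- is_derive _ _ ?g => match type of D2 with is_derive _ _ ?g' =>
      replace g with g' by ring end end; exact D2.
  + rewrite (is_derive_unique _ _ _ (Du x0 Zx)); exact Z0.
  + intros x Hx; apply Hin in Hx; destruct (D x Hx) as (_ & _ & D3 & _); lra.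
Qed.

(** * Point symmetries and the Lie derivative *)

Lemma graph_jet1 W F t s (u : R -> R) m : open_3d W -> class3_on W 1 F -> W t s (u s) ->
  is_derive u s m -> is_derive (fun s => F t s (u s)) s (jet1 F m t s (u s)).
Proof.
intros HW HF Ht Hu; unfold jet1.
replace (d1 F t s (u s)) with (d1 F t s (u s) * 1) by ring.
apply (is_derive_comp_3d W F t (fun s => s) u); auto.
apply is_derive_idR.
Qed.

Lemma graph_jet2 W F t s (u u1 : R -> R) n : open_3d W -> (forall k, class3_on W k F) ->
  W t s (u s) -> is_derive u s (u1 s) -> is_derive u1 s n ->
  is_derive (fun s => jet1 F (u1 s) t s (u s)) s (jet2 F (u1 s) n t s (u s)).
Proof.
intros HW HF Ht Hu Hu1.
destruct (class3_on_d W 1 F (HF 2%nat)) as (_ & F1 & F2).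
assert (D1 := graph_jet1 W (d1 F) t s u (u1 s) HW F1 Ht Hu).
assert (D2 := graph_jet1 W (d2 F) t s u (u1 s) HW F2 Ht Hu).
replace (jet2 F (u1 s) n t s (u s)) with (jet1 (d1 F) (u1 s) t s (u s)
  + (jet1 (d2 F) (u1 s) t s (u s) * u1 s + d2 F t s (u s) * n)) by (unfold jet2, jet1; ring).
apply (is_derive_plusR); [exact D1|].
apply (is_derive_multR (fun s => d2 F t s (u s)) u1); auto.
intros; apply Rmult_comm.
Qed.

Lemma jets_at_0 W (f : R -> R -> R -> R) (l : R -> R -> R) m n x y : open_3d W ->
  (forall k, class3_on W k f) -> (forall x y, W 0 x y -> f 0 x y = l x y) -> W 0 x y ->
  smooth_on (W 0) l ->
  jet1 f m 0 x y = dx l x y + dy l x y * m /\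
  jet2 f m n 0 x y = dx (dx l) x y + dy (dx l) x y * m + (dx (dy l) x y + dy (dy l) x y * m) * m
    + dy l x y * n.
Proof.
intros HW Sf E H0 Sl.
assert (HO := open_3d_slice W 0 HW).
assert (E1 : forall (F G : R -> R -> R), (forall x y, W 0 x y -> F x y = G x y) ->
  forall x y, W 0 x y -> dx F x y = dx G x y /\ dy F x y = dy G x y).
{ intros F G H x' y' H'; assert (L := locally_2d_eq_on (W 0) F G HO H x' y' H'); split.
  - apply Derive_ext_loc, (locally_2d_locally_x (fun u v => F u v = G u v)), L.
  - apply Derive_ext_loc, (locally_2d_locally_y (fun u v => F u v = G u v)), L. }
assert (E2 := E1 (f 0) l E).
assert (X1 := E1 (d1 f 0) (dx l) (fun x y H => proj1 (E2 x y H)) x y H0).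
assert (X2 := E1 (d2 f 0) (dy l) (fun x y H => proj2 (E2 x y H)) x y H0).
destruct (E2 x y H0) as [G1 G2]; destruct X1 as [G3 G4]; destruct X2 as [G5 G6].
unfold jet1, jet2.
change (d1 f 0 x y) with (dx (f 0) x y); change (d2 f 0 x y) with (dy (f 0) x y).
change (d1 (d1 f) 0 x y) with (dx (d1 f 0) x y); change (d2 (d1 f) 0 x y) with (dy (d1 f 0) x y).
change (d1 (d2 f) 0 x y) with (dx (d2 f 0) x y); change (d2 (d2 f) 0 x y) with (dy (d2 f 0) x y).
rewrite G1, G2, G3, G4, G5, G6; split; reflexivity.
Qed.

Lemma flow_jets_at_0 W f g m n x y : open_3d W ->
  (forall k, class3_on W k f) -> (forall k, class3_on W k g) ->
  (forall x y, W 0 x y -> f 0 x y = x /\ g 0 x y = y) -> W 0 x y ->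
  jet1 f m 0 x y = 1 /\ jet2 f m n 0 x y = 0 /\ jet1 g m 0 x y = m /\ jet2 g m n 0 x y = n.
Proof.
intros HW Sf Sg E H0.
assert (HO := open_3d_slice W 0 HW).
destruct (jets_at_0 W f (fun x _ => x) m n x y HW Sf (fun x y H => proj1 (E x y H)) H0)
  as [E1 E2]; [intros k; apply class_on_x, HO|].
destruct (jets_at_0 W g (fun _ y => y) m n x y HW Sg (fun x y H => proj2 (E x y H)) H0)
  as [E3 E4]; [intros k; apply class_on_y, HO|].
rewrite E1, E2, E3, E4.
assert (D1 : forall x y, dx (fun x _ : R => x) x y = 1) by (intros a b; exact (Derive_id a)).
assert (D2 : forall x y, dy (fun x _ : R => x) x y = 0) by (intros a b; exact (Derive_const a b)).
assert (D3 : forall x y, dx (fun _ y : R => y) x y = 0) by (intros a b; exact (Derive_const b a)).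
assert (D4 : forall x y, dy (fun _ y : R => y) x y = 1) by (intros a b; exact (Derive_id b)).
assert (C : forall (F : R -> R -> R) c, (forall x y, F x y = c) ->
  forall x y, dx F x y = 0 /\ dy F x y = 0).
{ intros F c H x' y'; split; unfold dx, dy.
  - rewrite (Derive_ext _ (fun _ => c)); [apply Derive_const|intros; apply H].
  - rewrite (Derive_ext _ (fun _ => c)); [apply Derive_const|intros; apply H]. }
destruct (C _ _ D1 x y) as [-> ->]; destruct (C _ _ D2 x y) as [-> ->].
destruct (C _ _ D3 x y) as [-> ->]; destruct (C _ _ D4 x y) as [-> ->].
rewrite D1, D2, D3, D4; repeat split; ring.
Qed.

Definition rhs (e : equation) (x y m : R) : R :=
  coP e x y + 3 * coQ e x y * m + 3 * coR e x y * m ^ 2 + coS e x y * m ^ 3.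

(** [is_local_flow] restricts the starting points only; the last condition keeps the images in the
    box where the equation and the field are smooth. *)
Definition flow_domain (p : R * R) (d eps : R) (f g : R -> R -> R -> R) (t x y : R) : Prop :=
  Rabs t < eps /\ in_box p eps x y /\ in_box p d (f t x y) (g t x y).

Lemma flow_on_domain X p d eps f g : is_local_flow X p eps f g ->
  let W := flow_domain p d eps f g in
  open_3d W /\ (forall n, class3_on W n f) /\ (forall n, class3_on W n g) /\
  (forall t x y, W t x y -> d0 f t x y = vx X (f t x y) (g t x y)) /\
  (forall t x y, W t x y -> d0 g t x y = vy X (f t x y) (g t x y)) /\
  (forall x y, W 0 x y -> f 0 x y = x /\ g 0 x y = y).
Proof.
intros Hflow W.
assert (H : forall t x y, Rabs t < eps -> in_box p eps x y ->
  (forall n, ex_diff3_n f n t x y) /\ (forall n, ex_diff3_n g n t x y) /\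
  d0 f t x y = vx X (f t x y) (g t x y) /\ d0 g t x y = vy X (f t x y) (g t x y)).
{ intros t x y Ht Hxy; destruct (Hflow x y Hxy) as (_ & _ & H);
    destruct (H t Ht) as (H1 & H2 & H3 & H4).
  split; [exact H1|split; [exact H2|]]; split; apply is_derive_unique; assumption. }
split; [|repeat split; repeat intro; destruct H0 as (Ht & Hxy & _)].
2-5: apply H; assumption.
2, 3: apply Hflow; assumption.
intros t x y (Ht & Hxy & Hfg); destruct (H t x y Ht Hxy) as (Cf & Cg & _).
destruct (Rabs_lt_open t eps Ht) as [e1 E1]; destruct (open_2d_in_box p eps x y Hxy) as [e2 E2].
destruct (open_2d_in_box p d _ _ Hfg) as [e3 E3].
destruct (locally_3d_and _ _ _ _ _ (ex_diff3_n_cont _ _ _ _ _ (Cf 0%nat) e3)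
  (ex_diff3_n_cont _ _ _ _ _ (Cg 0%nat) e3)) as [e4 E4].
assert (He : 0 < Rmin (Rmin e1 e2) e4) by (repeat apply Rmin_glb_lt; apply cond_pos).
exists (mkposreal _ He); simpl; intros t' x' y' K1 K2 K3.
Rmin_bounds (Rmin (Rmin e1 e2) e4).
destruct (E4 t' x' y') as [G1 G2]; try lra.
split; [apply E1; lra|split; [apply E2; lra|apply E3; assumption]].
Qed.

(** Through each point of a small box passes a solution of any slope m. The symmetry carries it to
    solutions, so its residual vanishes for small t; the time derivative at t = 0 is the Lie
    derivative cubic at (1, m). *)
Lemma symmetry_lie e p X d : 0 < d -> smooth_equation_on (in_box p d) e ->
  smooth_on (in_box p d) (vx X) -> smooth_on (in_box p d) (vy X) ->
  point_symmetry e p X -> exists d', 0 < d' <= d /\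
    forall x y, in_box p d' x y -> lie_vanishes e X x y.
Proof.
intros Hd (SP & SQ & SR & SS) SX SY (_ & eps & f & g & Heps & Hflow & Hsym).
exists (Rmin d eps); split; [split; [apply Rmin_glb_lt; assumption|apply Rmin_l]|].
intros x0 y0 Hbox.
Rmin_bounds (Rmin d eps).
destruct (flow_on_domain X p d eps f g Hflow) as (HW & Sf & Sg & Ff & Fg & F0).
set (W := flow_domain p d eps f g) in *.
assert (Hb : in_box p eps x0 y0 /\ in_box p d x0 y0).
{ destruct Hbox; split; split; lra. }
destruct Hb as [Hbe Hbd].
assert (W0 : W 0 x0 y0).
{ split; [rewrite Rabs_R0; exact Heps|split; [exact Hbe|]].
  destruct (Hflow x0 y0 Hbe) as (-> & -> & _); exact Hbd. }
assert (HU : open_2d (in_box p d)) by apply open_2d_in_box.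
assert (main : forall m, lie_cubic (coP e) (coQ e) (coR e) (coS e) (vx X) (vy X) x0 y0 1 m = 0).
{ intros m.
  assert (Hrho : 0 < Rmin (eps - Rabs (x0 - fst p)) (eps - Rabs (y0 - snd p))).
  { destruct Hbe; apply Rmin_glb_lt; lra. }
  set (rho := Rmin (eps - Rabs (x0 - fst p)) (eps - Rabs (y0 - snd p))) in *.
  assert (N1 : rho <= eps - Rabs (x0 - fst p)) by apply Rmin_l.
  assert (N2 : rho <= eps - Rabs (y0 - snd p)) by apply Rmin_r.
  destruct (solution_exists e (in_box p d) x0 y0 m rho HU Hbd Hrho SP SQ SR SS)
    as (h & u & Hh & Hsol & U0 & U1 & Urho).
  set (n := rhs e x0 y0 m).
  assert (Hin : forall x, x0 - h < x < x0 + h -> in_box p eps x (u x)).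
  { intros x Hx; assert (Hx' : Rabs (x - x0) < h) by (apply Rabs_def1; lra).
    specialize (Urho x Hx); split.
    - replace (x - fst p) with ((x - x0) + (x0 - fst p)) by ring.
      generalize (Rabs_triang (x - x0) (x0 - fst p)); lra.
    - replace (u x - snd p) with ((u x - y0) + (y0 - snd p)) by ring.
      generalize (Rabs_triang (u x - y0) (y0 - snd p)); lra. }
  destruct (Hsym _ _ u Hsol Hin x0 ltac:(lra)) as (tau & eta & Htau & Heta & He1 & He2 & Hmap).
  assert (DU : forall x, x0 - h < x < x0 + h -> is_derive u x (Derive u x)).
  { intros x Hx; apply Derive_correct, (Hsol x Hx). }
  assert (DDU : is_derive (Derive u) x0 n).
  { destruct (Hsol x0 ltac:(lra)) as [_ H]; rewrite U0, U1 in H; exact H. }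
  assert (Rz : forall t, Rabs t < tau -> W t x0 y0 ->
    residual (coP e) (coQ e) (coR e) (coS e) f g m n t x0 y0 = 0).
  { intros t Ht HWt.
    destruct (Hmap t Ht) as (c & d' & v & Hcd & Hv & Hiff).
    assert (Hloc : locally x0 (fun s => x0 - eta < s < x0 + eta /\ W t s (u s))).
    { assert (Cu : continuous u x0) by (apply (ex_derive_continuousR); eexists; apply DU; lra).
      rewrite <- U0 in HWt; destruct (HW _ _ _ HWt) as [e1 E1].
      assert (Cu' := proj1 (filterlim_locally _ _) Cu e1).
      apply (filter_imp (fun s => Rabs (u s - u x0) < e1 /\ Rabs (s - x0) < Rmin e1 eta)).
      - intros s [H1 H2]; Rmin_bounds (Rmin e1 eta).
        split; [assert (H3 : Rabs (s - x0) < eta) by lra; apply Rabs_def2 in H3; lra|].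
        apply E1; [rewrite Rabs_diag; apply cond_pos|lra|exact H1].
      - apply filter_and; [exact Cu'|].
        assert (Q : 0 < Rmin e1 eta) by (apply Rmin_glb_lt; [apply cond_pos|exact Heta]).
        exists (mkposreal _ Q); intros s Hs; exact Hs. }
    assert (Hh' : forall s, x0 - eta < s < x0 + eta -> c < f t s (u s) < d' /\
      g t s (u s) = v (f t s (u s))).
    { intros s Hs; apply Hiff; exists s; auto. }
    assert (J1 : forall F, (forall k, class3_on W k F) -> locally x0 (fun s =>
      is_derive (fun s => F t s (u s)) s (jet1 F (Derive u s) t s (u s)))).
    { intros F HF; apply filter_imp with (2 := Hloc); intros s [Hs Hws].
      apply graph_jet1 with W; auto; apply DU; lra. }
    assert (J2 : forall F, (forall k, class3_on W k F) ->
      is_derive (fun s => jet1 F (Derive u s) t s (u s)) x0 (jet2 F m n t x0 y0)).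
    { intros F HF; rewrite <- U1, <- U0; apply graph_jet2 with W; auto.
      - rewrite U0; exact HWt.
      - apply DU; lra. }
    assert (Hx0 : x0 - eta < x0 < x0 + eta) by lra.
    destruct (Hh' x0 Hx0) as [Hc Hg]; rewrite U0 in Hc, Hg.
    (* The chain rule along the image graph, kept as a product instead of a quotient of
       velocities. *)
    assert (Kv : locally x0 (fun s => jet1 g (Derive u s) t s (u s)
      = Derive v (f t s (u s)) * jet1 f (Derive u s) t s (u s))).
    { apply (filter_imp (fun s => (locally s (fun s => x0 - eta < s < x0 + eta)) /\
        is_derive (fun s => f t s (u s)) s (jet1 f (Derive u s) t s (u s)) /\
        is_derive (fun s => g t s (u s)) s (jet1 g (Derive u s) t s (u s)))).
      - intros s (Hs & Df & Dg).
        assert (Hs' : x0 - eta < s < x0 + eta) by (apply locally_singleton in Hs; exact Hs).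
        destruct (Hh' s Hs') as [Hcs _].
        assert (Dv : is_derive v (f t s (u s)) (Derive v (f t s (u s))))
          by (apply Derive_correct, (Hv _ Hcs)).
        rewrite <- (is_derive_unique _ _ _ Dg), Rmult_comm.
        rewrite (Derive_ext_loc _ (fun s => v (f t s (u s)))).
        + apply is_derive_unique.
          apply (is_derive_compR v (fun s => f t s (u s)));
            assumption.
        + apply filter_imp with (2 := Hs); intros z Hz; apply Hh'; exact Hz.
      - apply filter_and; [|apply filter_and; [apply (J1 f Sf)|apply (J1 g Sg)]].
        assert (Hl : locally x0 (fun s => x0 - eta < s < x0 + eta))
          by (apply filter_imp with (2 := Hloc); intros s [H _]; exact H).
        apply locally_locally; exact Hl. }
    assert (K1 := locally_singleton _ _ Kv); cbv beta in K1; rewrite U0, U1 in K1.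
    assert (Dv2 : is_derive (Derive v) (f t x0 y0)
      (rhs e (f t x0 y0) (g t x0 y0) (Derive v (f t x0 y0)))).
    { destruct (Hv _ Hc) as [_ H]; rewrite <- Hg in H; exact H. }
    assert (Df1 := locally_singleton _ _ (J1 f Sf)); cbv beta in Df1; rewrite U1 in Df1.
    assert (K2 : jet2 g m n t x0 y0 =
      (rhs e (f t x0 y0) (g t x0 y0) (Derive v (f t x0 y0))) * jet1 f m t x0 y0
        * jet1 f m t x0 y0
      + Derive v (f t x0 y0) * jet2 f m n t x0 y0).
    { rewrite <- (is_derive_unique _ _ _ (J2 g Sg)).
      transitivity (Derive (fun s => Derive v (f t s (u s)) * jet1 f (Derive u s) t s (u s)) x0);
        [apply Derive_ext_loc, Kv|apply is_derive_unique].
      assert (Dc : is_derive (fun s => Derive v (f t s (u s))) x0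
        (jet1 f m t x0 y0 * (rhs e (f t x0 y0) (g t x0 y0) (Derive v (f t x0 y0))))).
      { apply (is_derive_compR (Derive v) (fun s => f t s (u s)));
          [rewrite U0; exact Dv2|rewrite U0 in Df1; exact Df1]. }
      assert (Dm := is_derive_multR _ _ _ _ _ Dc (J2 f Sf) Rmult_comm).
      cbv beta in Dm; rewrite U0, U1 in Dm.
      match type of Dm with is_derive _ _ ?a => match goal with |- is_derive _ _ ?b =>
        replace b with a; [exact Dm|] end end.
      unfold plus, mult; simpl; ring. }
    (* The residual is the cube of the first velocity component times the defect of v in the
       equation, and that defect is zero. *)
    unfold residual, cubic; rewrite K1, K2; unfold rhs; ring. }
  assert (D := residual_derive (in_box p d) W HU HW (coP e) (coQ e) (coR e) (coS e) (vx X) (vy X)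
    SP SQ SR SS SX SY f g Sf Sg (fun t x y H => proj2 (proj2 H)) Ff Fg x0 y0 m n 0 W0).
  assert (R0 := Rz 0 ltac:(rewrite Rabs_R0; lra) W0).
  rewrite R0, Rmult_0_r, Rplus_0_l in D.
  destruct (flow_jets_at_0 W f g m n x0 y0 HW Sf Sg F0 W0) as (E1 & _ & E3 & _).
  destruct (F0 x0 y0 W0) as [E5 E6].
  rewrite E1, E3, E5, E6 in D.
  rewrite <- (is_derive_unique _ _ _ D).
  rewrite (Derive_ext_loc _ (fun _ => 0)); [apply Derive_const|].
  destruct (locally_3d_self _ _ _ _ (HW _ _ _ W0)) as [L _].
  apply (filter_imp (fun t => W t x0 y0 /\ Rabs (t - 0) < tau)).
  - intros t [H1 H2]; apply Rz; [rewrite Rminus_0_r in H2; exact H2|exact H1].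
  - apply filter_and; [exact L|].
    exists (mkposreal _ (proj1 Htau)); intros s Hs; exact Hs. }
unfold lie_cubic in main.
(* Four slopes determine a cubic polynomial in m. *)
assert (A0 := main 0); assert (A1 := main 1); assert (A2 := main (-1)); assert (A3 := main 2).
unfold lie_vanishes; repeat split; lra.
Qed.

(** * Uniqueness for linear equations *)

Lemma zero_derive_constant (w : R -> R) eps : (forall t, Rabs t < eps -> is_derive w t 0) ->
  forall t, Rabs t < eps -> w t = w 0.
Proof.
intros H t Ht.
assert (Hin : forall s, Rmin 0 t <= s <= Rmax 0 t -> Rabs s < eps).
{ intros s; apply Rabs_def2 in Ht; unfold Rmin, Rmax; destruct (Rle_dec 0 t);
    intros; apply Rabs_def1; lra. }
destruct (MVT_gen w 0 t (fun _ => 0)) as (s & _ & E).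
- intros s Hs; apply H, Hin; lra.
- intros s Hs; apply continuity_pt_filterlim.
  apply (ex_derive_continuousR); eexists; apply H, Hin, Hs.
- lra.
Qed.

(** The product of r with the integrating factor, the exponential of minus the integral of a, has
    zero derivative. *)
Lemma linear_ode_unique (r a : R -> R) eps : 0 < eps ->
  (forall t, Rabs t < eps -> continuous a t) ->
  (forall t, Rabs t < eps -> is_derive r t (a t * r t)) -> r 0 = 0 ->
  forall t, Rabs t < eps -> r t = 0.
Proof.
intros Heps Ca Dr R0.
assert (DA : forall t, Rabs t < eps -> is_derive (fun t => RInt a 0 t) t (a t)).
{ intros t Ht; apply (is_derive_RInt a _ 0); [|apply Ca, Ht].
  destruct (Rabs_lt_open t eps Ht) as [d Hd]; exists d; intros s Hs.
  apply (RInt_correct (V := R_CompleteNormedModule)).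
  apply (ex_RInt_continuous (V := R_CompleteNormedModule)); intros z Hz; apply Ca.
  assert (Hs' := Hd s Hs); apply Rabs_def2 in Hs'.
  revert Hz; unfold Rmin, Rmax; destruct (Rle_dec 0 s); intros; apply Rabs_def1; lra. }
assert (Dw : forall t, Rabs t < eps -> is_derive (fun t => r t * exp (- RInt a 0 t)) t 0).
{ intros t Ht.
  assert (De : is_derive (fun t => exp (- RInt a 0 t)) t (- a t * exp (- RInt a 0 t))).
  { apply (is_derive_compR exp (fun t => - RInt a 0 t));
      [apply is_derive_exp|].
    apply (is_derive_opp (K := R_AbsRing) (V := R_NormedModule)), DA, Ht. }
  assert (Dm := is_derive_multR _ _ _ _ _ (Dr t Ht) De Rmult_comm).
  cbv beta in Dm.
  match type of Dm with is_derive _ _ ?b => assert (Eb : b = 0) by (unfold plus, mult; simpl;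
    ring) end.
  rewrite Eb in Dm; exact Dm. }
intros t Ht; assert (E := zero_derive_constant _ eps Dw t Ht); cbv beta in E.
rewrite R0, Rmult_0_l in E; apply Rmult_integral in E; destruct E as [E|E]; [exact E|].
exfalso; generalize (exp_pos (- RInt a 0 t)); lra.
Qed.

(** * Inverse functions of one variable *)

Section InverseFunction.

Variables (h h1 : R -> R) (al be : R).
Hypothesis Hab : al < be.
Hypothesis Dh : forall s, al <= s <= be -> is_derive h s (h1 s).
Hypothesis h1_large : forall s, al <= s <= be -> / 2 < h1 s.
Hypothesis h1_cont : forall s, al < s < be -> continuous h1 s.

Lemma h_mvt s s' : al <= s <= be -> al <= s' <= be ->
  exists z, Rmin s s' <= z <= Rmax s s' /\ al <= z <= be /\ h s' - h s = h1 z * (s' - s).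
Proof.
intros Hs Hs'.
assert (Hin : forall z, Rmin s s' <= z <= Rmax s s' -> al <= z <= be)
  by (intros z; unfold Rmin, Rmax; destruct (Rle_dec s s'); lra).
destruct (MVT_gen h s s' h1) as (z & Z1 & Z2).
- intros z Hz; apply Dh, Hin; lra.
- intros z Hz; apply continuity_pt_filterlim.
  apply (ex_derive_continuousR); eexists; apply Dh, Hin, Hz.
- exists z; auto.
Qed.

Lemma h_lt s s' : al <= s <= be -> al <= s' <= be -> s < s' -> h s < h s'.
Proof.
intros Hs Hs'; destruct (h_mvt s s' Hs Hs') as (z & _ & Hz & E).
assert (P := h1_large z Hz); intros; nra.
Qed.

Definition hinv y := epsilon (inhabits 0) (fun s => al < s < be /\ h s = y).

Lemma hinv_spec y : h al < y < h be -> al < hinv y < be /\ h (hinv y) = y.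
Proof.
intros Hy; unfold hinv; apply epsilon_spec.
destruct (Ranalysis5.IVT_interv (fun s => h s - y) al be) as (s & S1 & S2); try lra.
- intros s Hs; apply continuity_pt_minus.
  + apply continuity_pt_filterlim.
    apply (ex_derive_continuousR); eexists; apply Dh, Hs.
  + apply continuity_pt_const; intros ? ?; reflexivity.
- assert (s <> al) by (intros ->; lra); assert (s <> be) by (intros ->; lra).
  exists s; split; lra.
Qed.

Lemma hinv_h s : al < s < be -> hinv (h s) = s /\ h al < h s < h be.
Proof.
intros Hs.
assert (B : h al < h s < h be) by (split; apply h_lt; lra).
split; [|exact B]; destruct (hinv_spec (h s) B) as [H1 H2].
destruct (Rtotal_order (hinv (h s)) s) as [L|[L|L]]; auto; exfalso;
  apply h_lt in L; lra.
Qed.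

Lemma hinv_derive y : h al < y < h be -> is_derive hinv y (/ h1 (hinv y)).
Proof.
intros Hy; destruct (hinv_spec y Hy) as [H1 H2]; set (s := hinv y) in *.
assert (P := h1_large s ltac:(lra)).
replace (/ h1 s) with (1 / h1 s) by (unfold Rdiv; ring).
apply is_derive_quotient; [lra|]; intros eps.
assert (C := proj1 (filterlim_locally _ _) (h1_cont s H1) eps).
destruct C as [d Hd].
assert (Hq : 0 < Rmin (d / 2) (Rmin (y - h al) (h be - y))).
{ repeat apply Rmin_glb_lt; try lra; generalize (cond_pos d); lra. }
Rmin_bounds (Rmin (d / 2) (Rmin (y - h al) (h be - y))).
exists (mkposreal _ Hq); intros y' Hy'.
change (Rabs (y' - y) < Rmin (d / 2) (Rmin (y - h al) (h be - y))) in Hy'.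
assert (Hy2 := Hy'); apply Rabs_def2 in Hy2.
destruct (hinv_spec y' ltac:(lra)) as [G1 G2]; set (s' := hinv y') in *.
destruct (h_mvt s s' ltac:(lra) ltac:(lra)) as (z & Z1 & Z2 & Z3).
assert (Pz := h1_large z Z2).
exists 1, (h1 z); split; [|split].
- rewrite Rabs_diag; apply cond_pos.
- apply Hd; change (Rabs (z - s) < d).
  assert (Hss : Rabs (s' - s) < d).
  { assert (E : Rabs (y' - y) = h1 z * Rabs (s' - s)).
    { rewrite <- G2, <- H2, Z3, Rabs_mult, (Rabs_right (h1 z)) by lra; reflexivity. }
    assert (0 <= Rabs (s' - s)) by apply Rabs_pos; nra. }
  apply Rabs_def2 in Hss; revert Z1; unfold Rmin, Rmax; destruct (Rle_dec s s');
    intros; apply Rabs_def1; lra.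
- change (h1 z * (s' - s) = 1 * (y' - y)); lra.
Qed.

End InverseFunction.

Lemma residual_at_0 e W f g m x y : open_3d W ->
  (forall k, class3_on W k f) -> (forall k, class3_on W k g) ->
  (forall x y, W 0 x y -> f 0 x y = x /\ g 0 x y = y) -> W 0 x y ->
  residual (coP e) (coQ e) (coR e) (coS e) f g m
    (rhs e x y m) 0 x y = 0.
Proof.
intros HW Sf Sg E H0; unfold residual, cubic.
destruct (flow_jets_at_0 W f g m (rhs e x y m) x y HW Sf Sg E H0) as (-> & -> & -> & ->).
destruct (E x y H0) as [-> ->]; unfold rhs; ring.
Qed.

(** When the Lie derivative vanishes, the residual solves a homogeneous linear equation in t with
    initial value 0 on jets of solutions, so it stays 0. For small t a short piece of the graph is
    carried to a graph, and zero residual is the equation for it. *)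
Lemma lie_symmetry e p X d eps f g : 0 < d -> 0 < eps -> smooth_equation_on (in_box p d) e ->
  smooth_on (in_box p d) (vx X) -> smooth_on (in_box p d) (vy X) ->
  (forall x y, in_box p d x y -> lie_vanishes e X x y) ->
  is_local_flow X p eps f g ->
  (forall t x y, Rabs t < eps -> in_box p eps x y -> in_box p d (f t x y) (g t x y)) ->
  point_symmetry e p X.
Proof.
intros Hd Heps (SP & SQ & SR & SS) SX SY Hlie Hflow Hin.
assert (HU : open_2d (in_box p d)) by apply open_2d_in_box.
split.
{ assert (Hn : forall F, smooth_on (in_box p d) F -> smooth_near p F).
  { intros F SF; exists (mkposreal d Hd); intros x y Hx Hy n; apply SF; split; assumption. }
  split; apply Hn; assumption. }
exists eps, f, g; split; [exact Heps|split; [exact Hflow|]].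
intros a b u Hsol Hbox x0 Hx0.
destruct (flow_on_domain X p d eps f g Hflow) as (HW & Sf & Sg & Ff & Fg & F0).
set (W := flow_domain p d eps f g) in *.
assert (HWi : forall t x y, Rabs t < eps -> in_box p eps x y -> W t x y).
{ intros t x y Ht Hxy; split; [exact Ht|split; [exact Hxy|apply Hin; assumption]]. }
assert (Z : Rabs 0 < eps) by (rewrite Rabs_R0; exact Heps).
assert (Res : forall m x y t, Rabs t < eps -> in_box p eps x y ->
  residual (coP e) (coQ e) (coR e) (coS e) f g m
    (rhs e x y m) t x y = 0).
{ intros m x y t Ht Hxy.
  set (n := rhs e x y m).
  apply (linear_ode_unique
    (fun t => residual (coP e) (coQ e) (coR e) (coS e) f g m n t x y)
    (fun t => dx (vx X) (f t x y) (g t x y) + dy (vy X) (f t x y) (g t x y)) eps Heps); auto.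
  - intros s Hs.
    assert (Hfg := Hin s x y Hs Hxy).
    destruct (Hflow x y Hxy) as (_ & _ & H); destruct (H s Hs) as (_ & _ & Df & Dg).
    assert (Cf : continuous (fun t => f t x y) s)
      by (apply (ex_derive_continuousR); eexists; exact Df).
    assert (Cg : continuous (fun t => g t x y) s)
      by (apply (ex_derive_continuousR); eexists; exact Dg).
    apply (continuous_plus (V := R_NormedModule)).
    + apply (continuous_comp_2 (fun t => f t x y) (fun t => g t x y) (dx (vx X)) s Cf Cg).
      apply (continuity_2d_pt_filterlim (dx (vx X))).
      apply (class_on_cont (in_box p d) 0 _ (smooth_on_dx _ _ SX 0%nat)); exact Hfg.
    + apply (continuous_comp_2 (fun t => f t x y) (fun t => g t x y) (dy (vy X)) s Cf Cg).
      apply (continuity_2d_pt_filterlim (dy (vy X))).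
      apply (class_on_cont (in_box p d) 0 _ (smooth_on_dy _ _ SY 0%nat)); exact Hfg.
  - intros s Hs.
    assert (D := residual_derive (in_box p d) W HU HW (coP e) (coQ e) (coR e) (coS e) (vx X) (vy X)
      SP SQ SR SS SX SY f g Sf Sg (fun t x y H => proj2 (proj2 H)) Ff Fg x y m n s (HWi s x y Hs
        Hxy)).
    unfold lie_cubic in D.
    destruct (Hlie _ _ (Hin s x y Hs Hxy)) as (L0 & L1 & L2 & L3).
    rewrite L0, L1, L2, L3 in D.
    match type of D with is_derive _ _ ?q => match goal with |- is_derive _ _ ?q' =>
      replace q' with q by ring end end; exact D.
  - apply residual_at_0 with W; auto. }
assert (DU : forall x, a < x < b -> is_derive u x (Derive u x)).
{ intros x Hx; apply Derive_correct, (Hsol x Hx). }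
assert (W0 : W 0 x0 (u x0)) by (apply HWi; auto).
(* This derivative is 1 at t = 0 and s = x0, hence above 1/2 nearby. The radius depends on the slope
   of u near x0, which is why the time range does too. *)
assert (Cjet : exists del : posreal, forall t s, Rabs t < del -> Rabs (s - x0) < del -> a < s < b ->
  / 2 < jet1 f (Derive u s) t s (u s)).
{ assert (C1 : continuity_3d_pt (d1 f) 0 x0 (u x0)).
  { exact (ex_diff3_n_cont _ _ _ _ _ (proj1 (proj2 (class3_on_d W 0 f (Sf 1%nat))) 0 x0 (u x0)
      W0)). }
  assert (C2 : continuity_3d_pt (d2 f) 0 x0 (u x0)).
  { exact (ex_diff3_n_cont _ _ _ _ _ (proj2 (proj2 (class3_on_d W 0 f (Sf 1%nat))) 0 x0 (u x0)
      W0)). }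
  destruct (flow_jets_at_0 W f g (Derive u x0) 0 x0 (u x0) HW Sf Sg F0 W0) as (J & _).
  assert (Cc : continuity_3d_pt (fun u v w => u + v * w) (d1 f 0 x0 (u x0)) (d2 f 0 x0 (u x0))
    (Derive u x0)).
  { assert (HF : open_3d (fun _ _ _ => True)) by (intros ? ? ? _; exists (mkposreal 1 Rlt_0_1);
      auto).
    apply ex_diff3_n_cont with 0%nat.
    apply (class3_on_plus (fun _ _ _ => True) HF 0 (fun u _ _ => u) (fun _ v w => v * w)); auto.
    - apply class3_on_t; exact HF.
    - apply class3_on_mult;
        [exact HF|exact (proj1 (class3_on_xy _ 0 HF))|exact (proj2 (class3_on_xy _ 0 HF))]. }
  assert (H2 : 0 < / 2) by lra.
  destruct (Cc (mkposreal _ H2)) as [e1 E1]; simpl in E1.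
  destruct (locally_3d_and _ _ _ _ _ (C1 e1) (C2 e1)) as [e2 E2].
  assert (Cu : continuous u x0).
  { apply (ex_derive_continuousR); eexists; apply DU, Hx0. }
  assert (Cu1 : continuous (Derive u) x0).
  { apply (ex_derive_continuousR); eexists; apply (Hsol x0 Hx0). }
  destruct (proj1 (filterlim_locally _ _) Cu e2) as [e3 E3].
  destruct (proj1 (filterlim_locally _ _) Cu1 e1) as [e4 E4].
  assert (He : 0 < Rmin (Rmin e2 e3) e4) by (repeat apply Rmin_glb_lt; apply cond_pos).
  exists (mkposreal _ He); simpl; intros t s Ht Hs _.
  assert (Q1 := Rmin_l (Rmin e2 e3) e4); assert (Q2 := Rmin_r (Rmin e2 e3) e4).
  assert (Q3 := Rmin_l e2 e3); assert (Q4 := Rmin_r e2 e3).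
  assert (B3 : Rabs (u s - u x0) < e2) by (apply E3; change (Rabs (s - x0) < e3); lra).
  assert (B4 : Rabs (Derive u s - Derive u x0) < e1) by (apply E4; change (Rabs (s - x0) < e4);
    lra).
  destruct (E2 t s (u s)) as [B1 B2]; [rewrite Rminus_0_r; lra|lra|exact B3|].
  assert (B := E1 _ _ _ B1 B2 B4).
  fold (jet1 f (Derive u s) t s (u s)) in B; fold (jet1 f (Derive u x0) 0 x0 (u x0)) in B.
  rewrite J in B; apply Rabs_def2 in B; lra. }
destruct Cjet as [del Hdel].
(* Half of the room, so that the closed interval of radius [eta] still lies in (a, b) and within
   [del] of x0. *)
set (eta := Rmin del (Rmin (x0 - a) (b - x0)) / 2).
Rmin_bounds (Rmin del (Rmin (x0 - a) (b - x0))).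
assert (Q5 : 0 < Rmin del (Rmin (x0 - a) (b - x0)))
  by (repeat apply Rmin_glb_lt; try apply cond_pos; lra).
assert (Heta : 0 < eta) by (unfold eta; lra).
assert (Heta2 : 2 * eta = Rmin del (Rmin (x0 - a) (b - x0))) by (unfold eta; field).
assert (Q6 := Rmin_l del eps); assert (Q7 := Rmin_r del eps).
exists (Rmin del eps), eta.
split; [split; [apply Rmin_glb_lt; [apply cond_pos|exact Heps]|exact Q7]|].
split; [exact Heta|split; [lra|split; [lra|]]].
intros t Ht.
assert (Hte : Rabs t < eps) by lra.
assert (Hr : forall s, x0 - eta <= s <= x0 + eta -> a < s < b /\ Rabs (s - x0) < del).
{ intros s Hs; split; [lra|apply Rabs_def1; lra]. }
set (h := fun s => f t s (u s)); set (k := fun s => g t s (u s)).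
set (h1 := fun s => jet1 f (Derive u s) t s (u s));
  set (k1 := fun s => jet1 g (Derive u s) t s (u s)).
set (u2 := fun s => rhs e s (u s) (Derive u s)).
assert (DDU : forall s, a < s < b -> is_derive (Derive u) s (u2 s)) by (intros; apply Hsol;
  assumption).
assert (Ws : forall s, a < s < b -> W t s (u s)) by (intros; apply HWi; auto).
assert (Dh : forall s, a < s < b -> is_derive h s (h1 s))
  by (intros; apply graph_jet1 with W; auto).
assert (Dk : forall s, a < s < b -> is_derive k s (k1 s))
  by (intros; apply graph_jet1 with W; auto).
assert (Dh1 : forall s, a < s < b -> is_derive h1 s (jet2 f (Derive u s) (u2 s) t s (u s)))
  by (intros; apply graph_jet2 with W; auto).
assert (Dk1 : forall s, a < s < b -> is_derive k1 s (jet2 g (Derive u s) (u2 s) t s (u s)))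
  by (intros; apply graph_jet2 with W; auto).
assert (Hh1 : forall s, x0 - eta <= s <= x0 + eta -> / 2 < h1 s).
{ intros s Hs; destruct (Hr s Hs); apply Hdel; auto; lra. }
assert (Hab : x0 - eta < x0 + eta) by lra.
assert (Dh' : forall s, x0 - eta <= s <= x0 + eta -> is_derive h s (h1 s))
  by (intros s Hs; apply Dh, Hr, Hs).
assert (Ch1 : forall s, x0 - eta < s < x0 + eta -> continuous h1 s).
{ intros s Hs; apply (ex_derive_continuousR); eexists; apply Dh1, Hr; lra. }
set (chi := hinv h (x0 - eta) (x0 + eta)).
assert (Spec := hinv_spec h h1 (x0 - eta) (x0 + eta) Hab Dh').
assert (Inv := hinv_h h h1 (x0 - eta) (x0 + eta) Hab Dh' Hh1).
assert (Dchi := hinv_derive h h1 (x0 - eta) (x0 + eta) Hab Dh' Hh1 Ch1).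
fold chi in Spec, Inv, Dchi.
set (c := h (x0 - eta)) in *; set (d' := h (x0 + eta)) in *.
set (v := fun y => k (chi y)); set (v1 := fun y => k1 (chi y) / h1 (chi y)).
assert (Dv : forall y, c < y < d' -> is_derive v y (v1 y)).
{ intros y Hy; destruct (Spec y Hy) as [G1 G2].
  unfold v1, Rdiv; rewrite Rmult_comm.
  apply (is_derive_compR k chi); [|apply Dchi, Hy].
  apply Dk, Hr; lra. }
exists c, d', v; split; [apply (h_lt h h1 (x0 - eta) (x0 + eta)); auto; lra|split].
- intros y Hy; split; [eexists; apply Dv, Hy|].
  destruct (Spec y Hy) as [G1 G2].
  assert (Rs : a < chi y < b) by (apply Hr; lra).
  assert (Pos : h1 (chi y) <> 0) by (assert (P := Hh1 (chi y) ltac:(lra)); lra).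
  assert (Dv1 : is_derive v1 y
    (/ h1 (chi y) * ((jet2 g (Derive u (chi y)) (u2 (chi y)) t (chi y) (u (chi y)) * h1 (chi y)
      - k1 (chi y) * jet2 f (Derive u (chi y)) (u2 (chi y)) t (chi y) (u (chi y)))
      / h1 (chi y) ^ 2))).
  { apply (is_derive_compR (fun s => k1 s / h1 s) chi);
      [|apply Dchi, Hy].
    apply (is_derive_div k1 h1); auto. }
  assert (Lv : locally y (fun y => v1 y = Derive v y)).
  { apply (filter_imp (fun y => c < y < d')).
    - intros y' Hy'; symmetry; apply is_derive_unique, Dv, Hy'.
    - apply (open_and _ _ (open_gt c) (open_lt d')); exact Hy. }
  apply (is_derive_ext_loc v1); [exact Lv|].
  rewrite (is_derive_unique _ _ _ (Dv y Hy)).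
  match type of Dv1 with is_derive _ _ ?q => match goal with |- is_derive _ _ ?q' =>
    replace q' with q; [exact Dv1|] end end.
  assert (E := Res (Derive u (chi y)) (chi y) (u (chi y)) t Hte (Hbox _ Rs)).
  fold (u2 (chi y)) in E; unfold residual, cubic in E.
  fold (h1 (chi y)) in E; fold (k1 (chi y)) in E.
  change (f t (chi y) (u (chi y))) with (h (chi y)) in E.
  change (g t (chi y) (u (chi y))) with (v y) in E.
  rewrite G2 in E.
  match type of E with ?q - ?q' - ?cub = 0 => assert (E' : q - q' = cub) by lra end.
  unfold v1.
  (* Dividing the vanishing residual by the cube of the first velocity component gives the second
     derivative of v. *)
  match type of E' with ?l - ?l' = ?r => transitivity (r / h1 (chi y) ^ 3) end;
    [rewrite <- E'; field; exact Pos|field; exact Pos].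
- intros x' y'; split.
  + intros [Hx' ->]; destruct (Spec x' Hx') as [G1 G2].
    exists (chi x'); split; [exact G1|split; [symmetry; exact G2|reflexivity]].
  + intros (s & Hs & -> & ->); destruct (Inv s Hs) as [G1 G2].
    split; [exact G2|unfold v; change (f t s (u s)) with (h s); rewrite G1; reflexivity].
Qed.

(** * Germs *)

Lemma near_box p (Pr : R -> R -> Prop) :
  near p Pr <-> exists d, 0 < d /\ forall x y, in_box p d x y -> Pr x y.
Proof.
split.
- intros [d H]; exists d; split; [apply cond_pos|intros x y [Hx Hy]; apply H; assumption].
- intros (d & Hd & H); exists (mkposreal d Hd); intros x y Hx Hy; apply H; split; assumption.
Qed.

Lemma in_box_le p d d' x y : d' <= d -> in_box p d' x y -> in_box p d x y.
Proof. intros H [Hx Hy]; split; lra. Qed.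

Lemma near_and p (P1 P2 : R -> R -> Prop) :
  near p P1 -> near p P2 -> near p (fun x y => P1 x y /\ P2 x y).
Proof. intros; apply locally_2d_and; assumption. Qed.

Lemma near_imp p (P1 P2 : R -> R -> Prop) :
  (forall x y, P1 x y -> P2 x y) -> near p P1 -> near p P2.
Proof. intros H; apply locally_2d_impl, locally_2d_forall; exact H. Qed.

Lemma smooth_equation_box e p : smooth_equation e p ->
  exists d, 0 < d /\ smooth_equation_on (in_box p d) e.
Proof.
intros (HP & HQ & HR & HS).
assert (H := near_and _ _ _ (near_and _ _ _ HP HQ) (near_and _ _ _ HR HS)).
apply near_box in H; destruct H as (d & Hd & H); exists d; split; [exact Hd|].
split; [|split; [|split]]; intros n x y Hxy; destruct (H x y Hxy) as [[K1 K2] [K3 K4]]; auto.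
Qed.

Lemma near_neq0 p d f : 0 < d -> smooth_on (in_box p d) f -> at_pt f p <> 0 ->
  near p (fun x y => f x y <> 0).
Proof.
intros Hd Sf H; apply continuity_2d_pt_neq_0; [|exact H].
apply (class_on_cont (in_box p d) 0 f (Sf 0%nat)), in_box_center, Hd.
Qed.

Definition regular_box (e : equation) (p : R * R) (d : R) : Prop :=
  0 < d /\ smooth_equation_on (in_box p d) e /\ chart_on e p (in_box p d) /\
  forall x y, in_box p d x y ->
    cN e p x y <> 0 /\ cLambda e p x y <> 0 /\ cF e x y = 0 /\ cM e p x y = 0 /\ cOmega e p x y = 0.

Lemma smooth_equation_on_incl e p d d' : d' <= d ->
  smooth_equation_on (in_box p d) e -> smooth_equation_on (in_box p d') e.
Proof.
intros Hd (HP & HQ & HR & HS).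
assert (H : forall x y, in_box p d' x y -> in_box p d x y) by (intros; apply in_box_le with d';
  auto).
split; [|split; [|split]]; apply smooth_on_incl with (in_box p d); assumption.
Qed.

Lemma chart_on_incl e p d d' : d' <= d -> chart_on e p (in_box p d) -> chart_on e p (in_box p d').
Proof.
intros Hd [[H1 H2]|[H1 H2]]; [left|right]; split; auto; intros; eapply H2, in_box_le; eauto.
Qed.

Lemma regular_box_le e p d d' : 0 < d' <= d -> regular_box e p d -> regular_box e p d'.
Proof.
intros [H0 H1] (H2 & H3 & H4 & H5); split; [exact H0|split; [|split]].
- apply (smooth_equation_on_incl e p d); assumption.
- apply (chart_on_incl e p d); assumption.
- intros x y Hxy; apply H5, (in_box_le p d d'); assumption.
Qed.

(** The chart is secured first: smoothness of N and Lambda, which spreads their non-vanishing from p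
    to a box, depends on its denominator. *)
Lemma third_case_regular e p : smooth_equation e p -> third_case e p ->
  exists d, regular_box e p d.
Proof.
intros Hs (HAB & HF & HM & HO & HN & HL).
destruct (smooth_equation_box e p Hs) as (d & Hd & Sd).
destruct (smooth_AB e _ (open_2d_in_box p d) Sd) as [SA SB].
assert (HC : exists d1, 0 < d1 <= d /\ chart_on e p (in_box p d1)).
{ destruct (Req_EM_T (at_pt (cB e) p) 0) as [EB|EB].
  - assert (HA : at_pt (cA e) p <> 0) by tauto.
    apply (near_neq0 p d _ Hd SA), near_box in HA; destruct HA as (d' & Hd' & HA).
    exists (Rmin d d'); split; [split; [apply Rmin_glb_lt; assumption|apply Rmin_l]|].
    right; split; [exact EB|intros x y Hxy; apply HA; eapply in_box_le; [apply Rmin_r|exact Hxy]].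
  - assert (HB := EB); apply (near_neq0 p d _ Hd SB), near_box in HB;
      destruct HB as (d' & Hd' & HB).
    exists (Rmin d d'); split; [split; [apply Rmin_glb_lt; assumption|apply Rmin_l]|].
    left; split; [exact EB|intros x y Hxy; apply HB; eapply in_box_le; [apply Rmin_r|exact Hxy]]. }
destruct HC as (d1 & [Hd1 Hd1'] & HC).
assert (S1 := smooth_equation_on_incl e p d d1 Hd1' Sd).
assert (SN := smooth_N e p _ (open_2d_in_box p d1) S1 HC).
assert (SL := smooth_Lambda e p _ (open_2d_in_box p d1) S1 HC).
assert (H := near_and _ _ _ (near_and _ _ _ (near_neq0 p d1 _ Hd1 SN HN) (near_neq0 p d1 _ Hd1 SL
  HL))
  (near_and _ _ _ HF (near_and _ _ _ HM HO))).
apply near_box in H; destruct H as (d2 & Hd2 & H).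
exists (Rmin d1 d2); split; [apply Rmin_glb_lt; assumption|split; [|split]].
- apply (smooth_equation_on_incl e p d1); [apply Rmin_l|exact S1].
- apply (chart_on_incl e p d1); [apply Rmin_l|exact HC].
- intros x y Hxy; specialize (H x y (in_box_le _ _ _ _ _ (Rmin_r d1 d2) Hxy)); tauto.
Qed.

Lemma regular_geometry e p d : regular_box e p d -> third_case_frame e p (in_box p d).
Proof.
intros (Hd & Se & Hc & H).
apply third_case_geometry; auto; try apply open_2d_in_box; intros x y Hxy; apply (H x y Hxy).
Qed.

(** * Symmetries as multiples of the canonical field *)

Lemma constant_on_box p d f : 0 < d -> smooth_on (in_box p d) f ->
  (forall x y, in_box p d x y -> dx f x y = 0 /\ dy f x y = 0) ->
  forall x y, in_box p d x y -> f x y = at_pt f p.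
Proof.
intros Hd Sf H x y Hxy; unfold at_pt.
destruct (in_box_center p d Hd) as [P1 P2]; destruct Hxy as [Hx Hy].
assert (D := smooth_on_pderiv _ _ Sf).
transitivity (f (fst p) y).
- replace x with (fst p + (x - fst p)) by ring.
  rewrite (zero_derive_constant (fun t => f (fst p + t) y) d); [f_equal; ring| |exact Hx].
  intros t Ht; assert (B : in_box p d (fst p + t) y).
  { split; [replace (fst p + t - fst p) with t by ring; exact Ht|exact Hy]. }
  destruct (pderiv_elim _ _ _ _ _ _ D B) as [Dx _].
  rewrite (proj1 (H _ _ B)) in Dx.
  evar_last; [apply (is_derive_comp (fun z => f z y) (fun t => fst p + t)); [exact Dx|]|].
  + auto_derive; [exact I|reflexivity].
  + unfold scal; simpl; unfold mult; simpl; ring.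
- replace y with (snd p + (y - snd p)) by ring.
  rewrite (zero_derive_constant (fun t => f (fst p) (snd p + t)) d); [f_equal; ring| |exact Hy].
  intros t Ht; assert (B : in_box p d (fst p) (snd p + t)).
  { split; [exact P1|replace (snd p + t - snd p) with t by ring; exact Ht]. }
  destruct (pderiv_elim _ _ _ _ _ _ D B) as [_ Dy].
  rewrite (proj2 (H _ _ B)) in Dy.
  evar_last; [apply (is_derive_comp (fun z => f (fst p) z) (fun t => snd p + t)); [exact Dy|]|].
  + auto_derive; [exact I|reflexivity].
  + unfold scal; simpl; unfold mult; simpl; ring.
Qed.

Lemma smooth_vfield_box p X : smooth_vfield p X -> exists d, 0 < d /\
  smooth_on (in_box p d) (vx X) /\ smooth_on (in_box p d) (vy X).
Proof.
intros [H1 H2]; assert (H := near_and _ _ _ H1 H2); apply near_box in H.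
destruct H as (d & Hd & H); exists d; split; [exact Hd|].
split; intros n x y Hxy; destruct (H x y Hxy); auto.
Qed.

(** The factor of V in a symmetry has zero differential, so it is constant on a box; if it is
    nonzero, the differentials of both invariants vanish there. *)
Lemma symmetry_canonical e p X d : regular_box e p d -> point_symmetry e p X ->
  exists c, vfield_eq_near p X (VField (fun x y => c * canon_field1 e p x y) (fun x y => c *
    canon_field2 e p x y)) /\
    (c <> 0 -> constant_near p (I1 e p) /\ constant_near p (I2 e p)).
Proof.
intros Hr HX.
destruct (smooth_vfield_box p X (proj1 HX)) as (d1 & Hd1 & SX & SY).
assert (Hd : 0 < d) by apply Hr.
assert (Hm : 0 < Rmin d d1 <= d) by (split; [apply Rmin_glb_lt; assumption|apply Rmin_l]).
assert (Hr1 := regular_box_le e p d _ Hm Hr).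
assert (M := Rmin_r d d1).
destruct (symmetry_lie e p X (Rmin d d1)) as (d2 & Hd2 & Hlie); auto; try apply Hr1;
  try (eapply smooth_on_incl; [|eassumption]; intros x y; apply in_box_le; exact M).
assert (Hr2 := regular_box_le e p _ d2 Hd2 Hr1).
destruct (regular_geometry e p d2 Hr2) as ((_ & _ & _ & _ & _ & S1 & S2) & _ & Hsym & _).
destruct (Hsym (vx X) (vy X)) as (mu & Smu & Hmu).
- eapply smooth_on_incl; [|exact SX]; intros x y; apply in_box_le; lra.
- eapply smooth_on_incl; [|exact SY]; intros x y; apply in_box_le; lra.
- intros x y Hxy; destruct X; apply Hlie, Hxy.
- assert (Cmu : forall x y, in_box p d2 x y -> mu x y = at_pt mu p).
  { apply constant_on_box; [lra|exact Smu|]; intros x y Hxy; destruct (Hmu x y Hxy); tauto. }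
  exists (at_pt mu p); split.
  + apply near_box; exists d2; split; [lra|]; intros x y Hxy; simpl.
    rewrite <- (Cmu x y Hxy); destruct (Hmu x y Hxy) as (_ & _ & E1 & E2 & _); auto.
  + intros Hc; split; eexists; apply near_box; exists d2; (split; [lra|]);
      apply constant_on_box; try lra; try assumption; intros x y Hxy;
      destruct (Hmu x y Hxy) as (_ & _ & _ & _ & K); rewrite (Cmu x y Hxy) in K;
      specialize (K Hc); tauto.
Qed.

(** Constancy is assumed only for nonzero c, so that the statement also covers the zero germ, which
    belongs to the trivial algebra. *)
Lemma canonical_symmetry e p d c Y : regular_box e p d ->
  vfield_eq_near p Y (VField (fun x y => c * canon_field1 e p x y) (fun x y => c * canon_field2 e
    p x y)) ->
  (c <> 0 -> constant_near p (I1 e p) /\ constant_near p (I2 e p)) ->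
  point_symmetry e p Y.
Proof.
intros Hr HY HI; apply near_box in HY; destruct HY as (d1 & Hd1 & HY); simpl in HY.
assert (HC : exists c1 c2 d2, 0 < d2 /\ forall x y, in_box p d2 x y ->
  c = 0 \/ (I1 e p x y = c1 /\ I2 e p x y = c2)).
{ destruct (Req_dec c 0) as [E|E].
  - exists 0, 0, 1; split; [lra|auto].
  - destruct (HI E) as [[c1 H1] [c2 H2]]; exists c1, c2.
    assert (H := near_and _ _ _ H1 H2); apply near_box in H; destruct H as (d2 & Hd2 & H).
    exists d2; split; [exact Hd2|intros x y Hxy; right; apply H, Hxy]. }
destruct HC as (c1 & c2 & d2 & Hd2 & HC).
assert (Hd : 0 < d) by apply Hr.
set (r := Rmin d (Rmin d1 d2)).
assert (M1 := Rmin_l d (Rmin d1 d2)); assert (M2 := Rmin_r d (Rmin d1 d2));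
  assert (M3 := Rmin_l d1 d2); assert (M4 := Rmin_r d1 d2).
assert (Hrr : 0 < r <= d) by (split; [repeat apply Rmin_glb_lt; assumption|exact M1]).
fold r in M1, M2.
assert (Hr' := regular_box_le e p d r Hrr Hr).
destruct (regular_geometry e p r Hr') as ((SF1 & SF2 & Sq1 & Sq2 & SI & _) & Hframe & _ & Hconv).
assert (EX : forall x y, in_box p r x y -> vx Y x y = c * canon_field1 e p x y).
{ intros x y Hxy; apply HY, (in_box_le p d1 r); [lra|exact Hxy]. }
assert (EY : forall x y, in_box p r x y -> vy Y x y = c * canon_field2 e p x y).
{ intros x y Hxy; apply HY, (in_box_le p d1 r); [lra|exact Hxy]. }
assert (HO := open_2d_in_box p r).
assert (SX : smooth_on (in_box p r) (vx Y)).
{ apply smooth_on_ext with (fun x y => c * canon_field1 e p x y); [exact HO|intros; symmetry;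
    apply EX; assumption|].
  apply smooth_on_mult; auto using smooth_on_const. }
assert (SY : smooth_on (in_box p r) (vy Y)).
{ apply smooth_on_ext with (fun x y => c * canon_field2 e p x y); [exact HO|intros; symmetry;
    apply EY; assumption|].
  apply smooth_on_mult; auto using smooth_on_const. }
assert (Hlie : forall x y, in_box p r x y -> lie_vanishes e Y x y).
(* For c = 0 the field and its derivatives vanish on the box; otherwise the invariants are constant
   there and the converse applies. *)
{ destruct (Req_dec c 0) as [E|E].
  - intros x y Hxy.
    assert (Z : forall f, smooth_on (in_box p r) f -> (forall x y, in_box p r x y -> f x y = 0) ->
      forall x y, in_box p r x y -> f x y = 0 /\ dx f x y = 0 /\ dy f x y = 0).
    { intros f Sf Hf u v Huv; split; [apply Hf, Huv|].
      exact (pderiv_eq _ HO f (fun _ _ => 0) _ _ _ _ Hf (smooth_on_pderiv _ _ Sf)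
        (pderiv_const _ 0) u v Huv). }
    assert (Z1 : forall f, smooth_on (in_box p r) f -> (forall x y, in_box p r x y -> f x y = 0) ->
      (f x y = 0 /\ dx f x y = 0 /\ dy f x y = 0) /\
      (dx (dx f) x y = 0 /\ dy (dx f) x y = 0) /\ (dx (dy f) x y = 0 /\ dy (dy f) x y = 0)).
    { intros f Sf Hf; assert (H := Z f Sf Hf); split; [apply H, Hxy|split].
      - apply (Z (dx f)); [apply smooth_on_dx, Sf| |exact Hxy]; intros; apply H; assumption.
      - apply (Z (dy f)); [apply smooth_on_dy, Sf| |exact Hxy]; intros; apply H; assumption. }
    destruct (Z1 (vx Y) SX) as ((X0 & X1 & X2) & (X3 & X4) & (X5 & X6)).
    { intros; rewrite EX, E by assumption; ring. }
    destruct (Z1 (vy Y) SY) as ((Y0 & Y1 & Y2) & (Y3 & Y4) & (Y5 & Y6)).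
    { intros; rewrite EY, E by assumption; ring. }
    unfold lie_vanishes, lie0, lie1, lie2, lie3.
    rewrite ?X0, ?X1, ?X2, ?X3, ?X4, ?X5, ?X6, ?Y0, ?Y1, ?Y2, ?Y3, ?Y4, ?Y5, ?Y6.
    repeat split; ring.
  - intros x y Hxy; destruct Y as [X' Y']; apply (Hconv c c1 c2); auto;
      intros u v Huv; (destruct (HC u v) as [K|[K1 K2]]; [|contradiction|assumption]);
      apply (in_box_le p d2 r); auto; lra. }
destruct (potential p r (canon_form1 e p) (canon_form2 e p)) as [s Ds]; try assumption;
  try apply Hrr.
{ intros x y Hxy; apply Hframe, Hxy. }
assert (Ss := smooth_on_of_pderiv _ s _ _ HO Ds Sq1 Sq2).
assert (Dsx := pderiv_dx _ _ _ _ Ds); assert (Dsy := pderiv_dy _ _ _ _ Ds).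
destruct (flow_exists (in_box p r) (vx Y) (vy Y) (canon_inv e p) s c p HO SI Ss)
  as (eps & f & g & Heps & Hflow & Hin).
- apply in_box_center, Hrr.
- intros x y Hxy; rewrite Dsx, Dsy by exact Hxy; apply Hframe, Hxy.
- intros x y Hxy; rewrite EX, EY by exact Hxy.
  destruct (Hframe x y Hxy) as (_ & _ & K & _).
  transitivity (c * (canon_field1 e p x y * dx (canon_inv e p) x y + canon_field2 e p x y * dy
    (canon_inv e p) x y));
    [ring|rewrite K; ring].
- intros x y Hxy; rewrite EX, EY, Dsx, Dsy by exact Hxy.
  destruct (Hframe x y Hxy) as (_ & K & _ & _).
  transitivity (c * (canon_field1 e p x y * canon_form1 e p x y + canon_field2 e p x y *
    canon_form2 e p x y));
    [ring|rewrite K; ring].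
- apply (lie_symmetry e p Y r eps f g); auto; try apply Hrr; try apply Hr'.
Qed.

Lemma near_center p Pr : near p Pr -> Pr (fst p) (snd p).
Proof. apply locally_2d_singleton. Qed.

Lemma vfield_eq_near_trans p X Y Z : vfield_eq_near p X Y -> vfield_eq_near p Y Z ->
  vfield_eq_near p X Z.
Proof.
intros H1 H2; assert (H := near_and _ _ _ H1 H2); revert H; apply near_imp.
intros x y [[-> ->] H]; exact H.
Qed.

Lemma vfield_eq_near_pointwise p X Y :
  (forall x y, vx X x y = vx Y x y /\ vy X x y = vy Y x y) -> vfield_eq_near p X Y.
Proof. intros H; apply locally_2d_forall, H. Qed.

Theorem theorem9p2 (e : equation) (p : R * R)
  (hsmooth : smooth_equation e p) (hcase : third_case e p) :
  (symmetry_algebra_dim e p 1 <->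
     constant_near p (I1 e p) /\ constant_near p (I2 e p)) /\
  (~ constant_near p (I1 e p) \/ ~ constant_near p (I2 e p) ->
     symmetry_algebra_dim e p 0).
Proof.
destruct (third_case_regular e p hsmooth hcase) as [d Hr].
assert (Hframe : canon_field1 e p (fst p) (snd p) * canon_form1 e p (fst p) (snd p)
  + canon_field2 e p (fst p) (snd p) * canon_form2 e p (fst p) (snd p) = 1).
{ destruct (regular_geometry e p d Hr) as (_ & H & _); apply H, in_box_center, Hr. }
split; [split|].
- intros (X & Hind & HX).
  assert (HX0 : point_symmetry e p (X 0%nat)).
  { apply HX; exists (fun _ => 1); apply vfield_eq_near_pointwise; simpl; intros; split; ring. }
  (* A zero factor would make the basis germ vanish, against independence. *)
  destruct (symmetry_canonical e p (X 0%nat) d Hr HX0) as (c & E & HI); apply HI; intros ->.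
  assert (K : 1 = 0); [|lra].
  apply (Hind (fun _ => 1)) with 0%nat; [|lia].
  revert E; apply near_imp; simpl; intros x y [-> ->]; split; ring.
- intros HI; exists (fun _ => VField (canon_field1 e p) (canon_field2 e p)); split.
  + intros c Hc i Hi; replace i with 0%nat by lia.
    apply near_center in Hc; simpl in Hc; destruct Hc as [Hc1 Hc2].
    (* Pairing with the form dual to V extracts the coefficient. *)
    rewrite <- (Rmult_1_r (c 0%nat)), <- Hframe.
    transitivity ((0 + c 0%nat * canon_field1 e p (fst p) (snd p)) * canon_form1 e p (fst p) (snd p)
      + (0 + c 0%nat * canon_field2 e p (fst p) (snd p)) * canon_form2 e p (fst p) (snd p));
          [ring|].
    rewrite Hc1, Hc2; ring.
  + intros Y; split.
    * intros HY; destruct (symmetry_canonical e p Y d Hr HY) as (c & E & _).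
      exists (fun _ => c); apply (vfield_eq_near_trans p _ _ _ E), vfield_eq_near_pointwise.
      simpl; intros; split; ring.
    * intros [c E]; apply (canonical_symmetry e p d (c 0%nat) Y Hr); auto.
      apply (vfield_eq_near_trans p _ _ _ E), vfield_eq_near_pointwise.
      simpl; intros; split; ring.
(* A default family: in dimension 0 only the empty combination occurs. *)
- intros HI; exists (fun _ => VField (canon_field1 e p) (canon_field2 e p)); split; [intros; lia|].
  intros Y; split.
  + intros HY; destruct (symmetry_canonical e p Y d Hr HY) as (c & E & HC).
    destruct (Req_dec c 0) as [->|Hc]; [|exfalso; tauto].
    exists (fun _ => 0); apply (vfield_eq_near_trans p _ _ _ E), vfield_eq_near_pointwise.
    simpl; intros; split; ring.
  + intros [c E]; apply (canonical_symmetry e p d 0 Y Hr); [|lra].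
    apply (vfield_eq_near_trans p _ _ _ E), vfield_eq_near_pointwise.
    simpl; intros; split; ring.
Qed.
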